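(* Let $\{(X,Y),(X_i,Y_i):i\in\mathbb{N}\}$ be a sequence of real-valued i.i.d. random vectors with marginal distributions $F$ (of $X$) and $G$ (of $Y$), following a common bivariate Farlie-Gumbel-Morgenstern (FGM) distribution with parameter $r\in[-1,1]$. Let $\{\xi_i,\eta_i:i\in\mathbb{N}\}$ be two sequences of arbitrarily dependent nonnegative random variables, independent of $\{(X,Y),(X_i,Y_i):i\in\mathbb{N}\}$, satisfying $\mathbb{P}(\xi_i\in[a_1,b_1],\eta_j\in[a_2,b_2])=1$ for all $i,j\in\mathbb{N}$ and some $0<a_1\le b_1<\infty$, $0<a_2\le b_2<\infty$. Let $S_n^\xi=\sum_{i=1}^n\xi_iX_i$ and $T_m^\eta=\sum_{j=1}^m\eta_jY_j$. If $F,G\in\widetilde{\mathscr S}_2$ and $F(x,x+1]\asymp G(x,x+1]$ as $x\to\infty$, then for any fixed $n,m\in\mathbb{N}$, as $x\to\infty$, \begin{align*} \mathbb{P}\left(S_n^\xi+T_m^\eta>x\right) &=\sum_{i=1}^n\mathbb{P}(\xi_iX_i>x)+\sum_{j=1}^m\mathbb{P}(\eta_jY_j>x)+\mu_F\sum_{i=1}^n\sum_{l\in\Lambda_n^i}\mathbb{E}\left[\xi_i\mathbf{1}_{\{\xi_lX_l\in(x,x+1]\}}\right]\\ &\quad+\mu_G\sum_{j=1}^m\sum_{l\in\Lambda_m^j}\mathbb{E}\left[\eta_j\mathbf{1}_{\{\eta_lY_l\in(x,x+1]\}}\right]\\ &\quad+\sum_{i=1}^n\sum_{j=1}^m\Big(\mathbb{E}\left[\xi_iX_i\mathbf{1}_{\{\eta_jY_j\in(x,x+1]\}}\right]+\mathbb{E}\left[\eta_jY_j\mathbf{1}_{\{\xi_iX_i\in(x,x+1]\}}\right]\Big)\\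 &\quad+o\left(\sum_{i=1}^n\mathbb{P}(\xi_iX_i\in(x,x+1])+\sum_{j=1}^m\mathbb{P}(\eta_jY_j\in(x,x+1])\right). \end{align*}
   Context: Notation: for a distribution function $F$, $\overline F=1-F$ (assumed $>0$ on $(0,\infty)$), $F(x,x+t]=F(x+t)-F(x)$, and $\mu_F$ is the mean of $F$. $\Lambda_n^i=\{1,\dots,n\}\setminus\{i\}$; empty sums are $0$. $f\sim g$ means $f/g\to1$; $f\asymp g$ means $f=O(g)$ and $g=O(f)$. FGM distribution: the bivariate FGM distribution with marginals $F,G$ and parameter $r\in[-1,1]$ has joint distribution function $\Pi(x,y)=F(x)G(y)\left(1+r\overline F(x)\overline G(y)\right)$. Class $\mathscr L_\Delta$: a distribution $F$ belongs to $\mathscr L_\Delta$ if for every $t>0$, $F(x+y,x+y+t]\sim F(x,x+t]$ as $x\to\infty$ uniformly in $y\in[0,1]$. Class $\mathscr S_2$: a distribution $F$ on $[0,\infty)$ with finite mean $\mu_F$ belongs to $\mathscr S_2$ if $F\in\mathscr L_\Delta$ and $\overline{F^{2*}}(x)-2\overline F(x)\sim 2\mu_F F(x,x+1]$ as $x\to\infty$, where $F^{2*}$ is the convolution of $F$ with itself. Class $\widetilde{\mathscr S}_2$: a distribution $F$ on $(-\infty,\infty)$ with finite mean belongs to $\widetilde{\mathscr S}_2$ if $F^+\in\mathscr S_2$, where $F^+(x)=F(x)\mathbf{1}_{\{x\ge0\}}$, and $x\mapsto F(x,x+1]$ is almost decreasing, i.e. ultimately positive with $\sup_{y\ge x}F(y,y+1]\asymp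 F(x,x+1]$ as $x\to\infty$. *)

(* Defs.v *)
From HB Require Import structures.
From mathcomp Require Import all_boot all_order all_algebra finmap.
From mathcomp Require Import all_classical all_reals all_analysis measurable_realfun.

Set Implicit Arguments.
Unset Strict Implicit.
Unset Printing Implicit Defensive.

Import Order.TTheory GRing.Theory Num.Theory.
Import numFieldTopology.Exports numFieldNormedType.Exports.

Local Open Scope classical_set_scope.
Local Open Scope ring_scope.

(** The filter at +oo, packed so that the Landau notations accept it. *)
Canonical pinfty_filter_on (R : realType) : filter_on R :=
  FilterType (pinfty_nbhs R) _.

(** A distribution on the line is represented by the probability measure it
    induces; its distribution function is [df]. *)
Notation distr R := (probability (measurableTypeR R) R).

Definition Pr d (T : measurableType d) (R : realType) (P : probability T R)
  (A : set T) : R := fine (P A).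

Section distributions.
Context {R : realType}.
Implicit Types F G : distr R.

Definition df F (x : R) : R := Pr F `]-oo, x].

Definition tail F (x : R) : R := 1 - df F x.

(** F(x, x + t] *)
Definition incr F (t x : R) : R := df F (x + t) - df F x.

Definition finite_mean F : Prop := F.-integrable setT EFin.

Definition mean F : R := fine (\int[F]_x x%:E).

Definition pos_map (x : measurableTypeR R) : measurableTypeR R := Num.max x 0.

Lemma measurable_pos_map : measurable_fun setT pos_map.
Proof. exact: (measurable_maxr (@measurable_id _ _ _) (measurable_cst _)). Qed.

HB.instance Definition _ :=
  isMeasurableFun.Build _ _ _ _ pos_map measurable_pos_map.

(** The law of max(X, 0) for X of law F; see [df_pos_part]. *)
Definition pos_part F : distr R := distribution F pos_map.

Lemma df_pos_part F x : df (pos_part F) x = df F x * (0 <= x)%R%:R.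
Proof.
rewrite /df /Pr /= /distribution /pushforward.
have [x0|x0] := leP 0 x; [rewrite mulr1; congr (fine (F _))|].
  by apply/seteqP; split=> y; rewrite /pos_map /= !in_itv /= ge_max x0 andbT.
rewrite mulr0 (_ : _ @^-1` _ = set0) ?measure0//.
apply/seteqP; split=> y //; rewrite /pos_map /= in_itv /= ge_max.
by case/andP=> _; rewrite leNgt x0.
Qed.

Definition add_map (p : measurableTypeR R * measurableTypeR R) :
  measurableTypeR R := p.1 + p.2.

Lemma measurable_add_map : measurable_fun setT add_map.
Proof. exact: (measurable_funD measurable_fst measurable_snd). Qed.

HB.instance Definition _ :=
  isMeasurableFun.Build _ _ _ _ add_map measurable_add_map.

Definition conv F G : distr R := distribution (F \x G)%E add_map.

(** Since [y / 0 = 0], [asymp_equiv f g] forces [g] to be ultimately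
    nonzero. *)
Definition asymp_equiv (f g : R -> R) : Prop :=
  f x / g x @[x --> +oo] --> (1 : R).

Definition same_order (f g : R -> R) : Prop :=
  (f =O_ (pinfty_nbhs R) g) /\ (g =O_ (pinfty_nbhs R) f).

Definition L_Delta F : Prop :=
  forall t, 0 < t -> forall eps, 0 < eps -> \forall x \near +oo,
    forall y, y \in `[0, 1] -> `| incr F t (x + y) / incr F t x - 1 | <= eps.

Definition S_2 F : Prop :=
  [/\ F [set x : R | x < 0] = 0%E, finite_mean F, L_Delta F &
    asymp_equiv (fun x => tail (conv F F) x - 2 * tail F x)
                (fun x => 2 * mean F * incr F 1 x)].

Definition almost_decreasing (f : R -> R) : Prop :=
  (\forall x \near +oo, 0 < f x) /\
  same_order (fun x => sup [set f y | y in `[x, +oo[]) f.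

Definition S_2_tilde F : Prop :=
  [/\ finite_mean F, S_2 (pos_part F) & almost_decreasing (incr F 1)].

Definition FGM_df F G (r x y : R) : R :=
  df F x * df G y * (1 + r * tail F x * tail G y).

End distributions.

Section independence.
Context d (T : measurableType d) (R : realType) (P : probability T R).

Definition mutually_independent d' (U : measurableType d') (Z : nat -> T -> U)
    : Prop :=
  forall (J : {fset nat}) (B : nat -> set U), (forall i, measurable (B i)) ->
    Pr P (\bigcap_(i in [set` J]) Z i @^-1` B i) =
    \prod_(i <- J) Pr P (Z i @^-1` B i).

(** The sigma-algebra generated by a sequence of random elements. *)
Definition sigma_gen d' (U : measurableType d') (Z : nat -> T -> U)
    : set (set T) :=
  <<s \bigcup_i preimage_set_system setT (Z i) measurable >>.

Definition independent_sequences d1 (U1 : measurableType d1)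
    d2 (U2 : measurableType d2) (Z : nat -> T -> U1) (W : nat -> T -> U2)
    : Prop :=
  forall A B, sigma_gen Z A -> sigma_gen W B ->
    Pr P (A `&` B) = Pr P A * Pr P B.

End independence.

(* Main.v *)
Require Import Defs.
From HB Require Import structures.
From mathcomp Require Import all_boot all_order all_algebra finmap.
From mathcomp Require Import all_classical all_reals all_analysis measurable_realfun.
From mathcomp Require Import ring lra.

(** Write [p x = F(x, x + 1]]; every error term is [o(p x)].

    Let [U], [V] be independent, with increments [P(x < U <= x + s)] that are [O(p x)] and
    asymptotically linear in [s] on bounded ranges. The event [U + V > x] is split
    according to whether [|U| <= A], [|V| <= A], both variables exceed [A], or one of them
    is very negative. The first two parts give the tail of one variable plus the mean of the
    other times an increment; the part where both exceed [A] is compared with the same event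
    for two independent variables of law [F^+], and for these membership in [S_2] says
    exactly that it is negligible. The hypotheses on [U] and [V] are inherited by [U + V],
    so the expansion iterates.

    An FGM pair is a mixture of four pairs with independent coordinates, whose laws are
    those of the minimum or the maximum of two independent copies of a marginal; this gives
    the expansion of one block [c X + e Y].

    All estimates are uniform over weights in a compact subset of [(0, +oo)], so that random
    weights are handled by conditioning. For fixed weights one divides by the largest one,
    [M]: since it is attained, [p (x / M)] is bounded by a multiple of the sum of the
    increments of the weighted variables. *)

Set Implicit Arguments.
Unset Strict Implicit.
Unset Printing Implicit Defensive.

Import Order.TTheory GRing.Theory Num.Theory.
Import numFieldTopology.Exports numFieldNormedType.Exports.

Local Open Scope classical_set_scope.
Local Open Scope ring_scope.


(** * Expectations and product measures *)

(** The hypotheses bound [p y] by a multiple of [p x] only for [y >= x]; nothing bounds [p x] by a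
    multiple of [p (2 * x)]. Increments of variables with different weights are therefore not
    comparable at a common scale. Division by the largest weight puts all weights in (0, 1], so that
    every evaluation point [x / c] lies to the right of [x]. The price is that the unit window
    becomes one of length 1 / M, so increments and cross moments have to be followed for windows of
    every bounded length.

    The two coordinates of one pair are dependent while distinct pairs are independent, so summation
    proceeds pair by pair.

    In one component of the FGM mixture the second-order term is a mean times an increment. Mixing
    these products again gives the cross moments of the original pair, which do not factor; for
    distinct pairs they do factor.

    Neither the extrema nor the weighted variables need belong to S_2. They are compared with the
    reference law through their increments alone, which suffices because the remaining region is a
    union of windows in either variable. *)

Section expectation_operator.
Context d (T : measurableType d) (R : realType) (P : probability T R).
Implicit Types (f g : T -> R).

Definition Ex f : R := \int[P]_w f w.
Definition L1 f : Prop := P.-integrable setT (EFin \o f).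

Lemma L1_measurable f : L1 f -> measurable_fun setT f.
Proof. by move=> /integrableP[/measurable_EFinP]. Qed.

Lemma eq_L1 f g : f =1 g -> L1 f -> L1 g.
Proof. by move=> /funext ->. Qed.

Lemma L1_bounded f (M : R) : measurable_fun setT f ->
  (forall w, `|f w| <= M) -> L1 f.
Proof.
move=> mf fM.
apply: (measurable_bounded_integrable measurableT _ mf).
  by rewrite ltey_eq fin_num_measure.
exists M; split; first exact: num_real.
by move=> y My w _ /=; rewrite (le_trans (fM w))// ltW.
Qed.

Lemma L1_le f g : measurable_fun setT f -> (forall w, `|f w| <= g w) ->
  L1 g -> L1 f.
Proof.
move=> mf fg; apply: le_integrable => //; first exact/measurable_EFinP.
by move=> w _ /=; rewrite lee_fin (le_trans (fg w))// ler_norm.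
Qed.

Lemma L1D f g : L1 f -> L1 g -> L1 (fun w => f w + g w).
Proof. by move=> lf lg; exact: (integrableD measurableT lf lg). Qed.

Lemma L1B f g : L1 f -> L1 g -> L1 (fun w => f w - g w).
Proof. by move=> lf lg; exact: (integrableB measurableT lf lg). Qed.

Lemma L1Zl (k : R) f : L1 f -> L1 (fun w => k * f w).
Proof. by move=> lf; exact: (integrableZl measurableT k lf). Qed.

Lemma L1_cst (k : R) : L1 (fun=> k).
Proof. exact: (@L1_bounded _ `|k|). Qed.

Lemma L1_norm f : L1 f -> L1 (fun w => `|f w|).
Proof. by move=> lf; exact: (integrable_abse lf). Qed.

Lemma L1_sum (I : Type) (s : seq I) (D : pred I) (f : I -> T -> R) :
  (forall i, D i -> L1 (f i)) -> L1 (fun w => \sum_(i <- s | D i) f i w).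
Proof.
move=> lf; elim: s => [|a s IH].
  by apply: (eq_L1 _ (L1_cst 0)) => w; rewrite big_nil.
apply: (@eq_L1 (fun w => (if D a then f a w else 0) + \sum_(i <- s | D i) f i w)).
  by move=> w; rewrite big_cons; case: ifP; rewrite ?add0r.
by apply: L1D => //; case: (boolP (D a)) => Da; [exact: lf|exact: L1_cst].
Qed.

Lemma L1M_bounded (M : R) f g : L1 f -> measurable_fun setT g ->
  (forall w, `|g w| <= M) -> L1 (fun w => f w * g w).
Proof.
move=> lf mg gM; apply: (@L1_le _ (fun w => M * `|f w|)).
- by apply: measurable_funM => //; exact: L1_measurable.
- by move=> w; rewrite normrM mulrC ler_wpM2r.
- by apply: L1Zl; exact: L1_norm.
Qed.

Lemma eq_Ex f g : f =1 g -> Ex f = Ex g.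
Proof. by move=> fg; congr Rintegral; apply/funext. Qed.

Lemma ExD f g : L1 f -> L1 g -> Ex (fun w => f w + g w) = Ex f + Ex g.
Proof. by move=> lf lg; apply: RintegralD. Qed.

Lemma ExB f g : L1 f -> L1 g -> Ex (fun w => f w - g w) = Ex f - Ex g.
Proof. by move=> lf lg; apply: RintegralB. Qed.

Lemma ExZl (k : R) f : L1 f -> Ex (fun w => k * f w) = k * Ex f.
Proof. by move=> lf; apply: RintegralZl. Qed.

Lemma ExZr (k : R) f : L1 f -> Ex (fun w => f w * k) = Ex f * k.
Proof. by move=> lf; apply: RintegralZr. Qed.

Lemma Ex_cst (k : R) : Ex (fun=> k) = k.
Proof.
rewrite /Ex Rintegral_cst// (_ : fine (P setT) = 1) ?mulr1//.
by rewrite (@probability_setT _ _ _ P).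
Qed.

Lemma le_Ex f g : L1 f -> L1 g -> (forall w, f w <= g w) -> Ex f <= Ex g.
Proof. by move=> lf lg fg; apply: le_Rintegral. Qed.

Lemma Ex_ge0 f : (forall w, 0 <= f w) -> 0 <= Ex f.
Proof. by move=> f0; apply: Rintegral_ge0. Qed.

Lemma normr_Ex f : L1 f -> `|Ex f| <= Ex (fun w => `|f w|).
Proof. by move=> lf; apply: le_normr_Rintegral. Qed.

Lemma Ex_sum (I : Type) (s : seq I) (D : pred I) (f : I -> T -> R) :
  (forall i, D i -> L1 (f i)) ->
  Ex (fun w => \sum_(i <- s | D i) f i w) = \sum_(i <- s | D i) Ex (f i).
Proof.
move=> lf; elim: s => [|a s IH].
  rewrite big_nil -[RHS](Ex_cst 0).
  by apply: eq_Ex => w; rewrite big_nil.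
rewrite big_cons -IH; case: ifPn => Da; last first.
  by apply: eq_Ex => w; rewrite big_cons (negbTE Da).
rewrite -ExD; [|exact: lf|exact: L1_sum].
by apply: eq_Ex => w; rewrite big_cons Da.
Qed.

Lemma Ex_indic (b : T -> bool) : measurable_fun setT b ->
  Ex (fun w => (b w)%:R) = Pr P [set w | b w].
Proof.
move=> mb.
have mB : measurable [set w | b w].
  by rewrite -[X in measurable X]setTI; exact: (mb measurableT [set true]).
rewrite /Ex /Rintegral /Pr -[X in P X]setIT -integral_indic//.
by congr fine; apply: eq_integral => w _; rewrite indicE mem_setE.
Qed.

Lemma ae_eq_Ex f g : measurable_fun setT f -> measurable_fun setT g ->
  {ae P, forall w, f w = g w} -> Ex f = Ex g.
Proof.
move=> mf mg fg; rewrite /Ex /Rintegral; congr fine.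
apply: ae_eq_integral => //; [exact/measurable_EFinP..|].
by apply: filterS fg => w fgw _; rewrite fgw.
Qed.

End expectation_operator.

Section measurability.
Context d (T : measurableType d) (R : realType).

Lemma measurable_natb (b : T -> bool) : measurable_fun setT b ->
  measurable_fun setT (fun w => (b w)%:R : R).
Proof.
move=> mb; apply: (@measurableT_comp _ _ _ _ _ _ (fun c : bool => c%:R : R)) => //.
Qed.

Lemma measurable_pair (d1 d2 : measure_display) (T1 : measurableType d1)
    (T2 : measurableType d2) (f : T -> T1) (g : T -> T2) :
  measurable_fun setT f -> measurable_fun setT g ->
  measurable_fun setT (fun w => (f w, g w)).
Proof. by move=> mf mg; exact: (measurable_fun_pair mf mg). Qed.

Lemma measurable_comp_fst d2 (T2 : measurableType d2) d3 (T3 : measurableType d3)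
  (f : T -> T3) : measurable_fun setT f ->
  measurable_fun setT (fun w : T * T2 => f w.1).
Proof. by move=> mf; exact: (measurableT_comp mf measurable_fst). Qed.

Lemma measurable_comp_snd d2 (T2 : measurableType d2) d3 (T3 : measurableType d3)
  (f : T -> T3) : measurable_fun setT f ->
  measurable_fun setT (fun w : T2 * T => f w.2).
Proof. by move=> mf; exact: (measurableT_comp mf measurable_snd). Qed.

Lemma measurable_norm (f : T -> R) : measurable_fun setT f ->
  measurable_fun setT (fun w => `|f w|).
Proof. by move=> mf; exact: (measurableT_comp (@normr_measurable _ _) mf). Qed.

Lemma measurable_opp (f : T -> R) : measurable_fun setT f ->
  measurable_fun setT (fun w => - f w).
Proof. by move=> mf; exact: (measurableT_comp (@oppr_measurable _ _) mf). Qed.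

Lemma measurable_set_bool (b : T -> bool) : measurable_fun setT b ->
  measurable [set w | b w].
Proof.
by move=> mb; rewrite -[X in measurable X]setTI; exact: (mb measurableT [set true]).
Qed.

End measurability.

Ltac meas :=
  lazymatch goal with
  | |- measurable_fun _ (fun w => (nat_of_bool (@?b w))%:R) =>
      apply: measurable_natb; meas
  | |- measurable_fun _ (fun w => @?f w && @?g w) => apply: measurable_and; meas
  | |- measurable_fun _ (fun w => @?f w || @?g w) => apply: measurable_or; meas
  | |- measurable_fun _ (fun w => ~~ @?f w) => apply: measurable_neg; meas
  | |- measurable_fun _ (fun w => (@?f w < @?g w)%R) => apply: measurable_fun_ltr; meas
  | |- measurable_fun _ (fun w => (@?f w <= @?g w)%R) => apply: measurable_fun_ler; meas
  | |- measurable_fun _ (fun w => @?f w + @?g w) => apply: measurable_funD; meas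
  | |- measurable_fun _ (fun w => - @?f w) => apply: measurable_opp; meas
  | |- measurable_fun _ (fun w => @?f w * @?g w) => apply: measurable_funM; meas
  | |- measurable_fun _ (fun w => `| @?f w |) => apply: measurable_norm; meas
  | |- measurable_fun _ (fun w => Num.max (@?f w) (@?g w)) => apply: measurable_maxr; meas
  | |- measurable_fun _ (fun w => Num.min (@?f w) (@?g w)) => apply: measurable_minr; meas
  | |- measurable_fun _ (fun w => (@?f w, @?g w)) => apply: measurable_pair; meas
  | |- measurable_fun _ ?f =>
      lazymatch f with
      | context [@fst] => first [ exact: measurable_fst | apply: measurable_comp_fst; meas ]
      | context [@snd] => first [ exact: measurable_snd | apply: measurable_comp_snd; meas ]
      | _ => first [ assumption | exact: measurable_id | exact: measurable_cst
               | exact: normr_measurable | exact: oppr_measurable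
               | apply: measurable_fun_ltr; meas | apply: measurable_fun_ler; meas
               | apply: measurable_funD; meas | apply: measurable_funM; meas ]
      end
  end.

Section product_expectation.
Context d1 d2 (T1 : measurableType d1) (T2 : measurableType d2) (R : realType).
Variables (P1 : probability T1 R) (P2 : probability T2 R).

Definition prodP : probability (T1 * T2)%type R := (P1 \x P2)%E.

Lemma L1_prod_bounded (M : R) (f : T1 * T2 -> R) : measurable_fun setT f ->
  (forall w, `|f w| <= M) -> L1 prodP f.
Proof. exact: L1_bounded. Qed.

(** Fubini for real-valued expectations. Integrability is asked of every section, not of almost
    every one, so that each inner integral is finite and [fine] loses nothing. *)
Lemma Ex_prod12 (f : T1 * T2 -> R) : L1 prodP f ->
  (forall w1, L1 P2 (fun w2 => f (w1, w2))) ->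
  L1 P1 (fun w1 => Ex P2 (fun w2 => f (w1, w2))) /\
  Ex prodP f = Ex P1 (fun w1 => Ex P2 (fun w2 => f (w1, w2))).
Proof.
move=> lf lf1.
have E w1 : fubini_F P2 (EFin \o f) w1 = (Ex P2 (fun w2 => f (w1, w2)))%:E.
  by rewrite /Ex /Rintegral fineK//; exact: integrable_fin_num (lf1 w1).
split.
  rewrite /L1 (_ : EFin \o _ = fubini_F P2 (EFin \o f)); last first.
    by apply/funext => w1; rewrite E.
  exact: integrable_fubini_F lf.
rewrite /Ex /Rintegral; congr fine.
rewrite -(integral12_prod_meas1 lf).
by apply: eq_integral => w1 _; rewrite E.
Qed.

Lemma Ex_prod21 (f : T1 * T2 -> R) : L1 prodP f ->
  (forall w2, L1 P1 (fun w1 => f (w1, w2))) ->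
  L1 P2 (fun w2 => Ex P1 (fun w1 => f (w1, w2))) /\
  Ex prodP f = Ex P2 (fun w2 => Ex P1 (fun w1 => f (w1, w2))).
Proof.
move=> lf lf1.
have E w2 : fubini_G P1 (EFin \o f) w2 = (Ex P1 (fun w1 => f (w1, w2)))%:E.
  by rewrite /Ex /Rintegral fineK//; exact: integrable_fin_num (lf1 w2).
split.
  rewrite /L1 (_ : EFin \o _ = fubini_G P1 (EFin \o f)); last first.
    by apply/funext => w2; rewrite E.
  have mf := measurable_int _ lf.
  apply/integrableP; split; first exact: measurable_fubini_G lf.
  apply: le_lt_trans ((integrable21ltyP P1 P2 mf).1 lf).
  apply: ge0_le_integral => //.
  - by apply: measurableT_comp => //; exact: measurable_fubini_G lf.
  - apply: (measurable_fun_fubini_tonelli_G (abse \o (EFin \o f))) => //=.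
    exact: measurableT_comp.
  - by move=> w2 _; apply: le_abse_integral => //; exact: (measurable_int _ (lf1 w2)).
rewrite /Ex /Rintegral; congr fine.
rewrite -(integral21_prod_meas1 lf).
by apply: eq_integral => w2 _; rewrite E.
Qed.

Lemma L1_section1 (M : R) (f : T1 * T2 -> R) : measurable_fun setT f ->
  (forall w, `|f w| <= M) -> forall w1, L1 P2 (fun w2 => f (w1, w2)).
Proof.
move=> mf fM w1; apply: (@L1_bounded _ _ _ _ _ M) => //.
exact: (measurableT_comp mf (pair1_measurable w1)).
Qed.

Lemma L1_section2 (M : R) (f : T1 * T2 -> R) : measurable_fun setT f ->
  (forall w, `|f w| <= M) -> forall w2, L1 P1 (fun w1 => f (w1, w2)).
Proof.
move=> mf fM w2; apply: (@L1_bounded _ _ _ _ _ M) => //.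
exact: (measurableT_comp mf (pair2_measurable w2)).
Qed.

Lemma Ex_swap (M : R) (f : T1 -> T2 -> R) :
  measurable_fun setT (fun w => f w.1 w.2) -> (forall w1 w2, `|f w1 w2| <= M) ->
  Ex P1 (fun w1 => Ex P2 (f w1)) = Ex P2 (fun w2 => Ex P1 (fun w1 => f w1 w2)).
Proof.
move=> mf fM; have bf : forall w, `|f w.1 w.2| <= M by [].
have lf := L1_prod_bounded mf bf.
rewrite -(Ex_prod12 lf (L1_section1 mf bf)).2.
by rewrite (Ex_prod21 lf (L1_section2 mf bf)).2.
Qed.

Lemma L1_Ex1 (M : R) (f : T1 -> T2 -> R) :
  measurable_fun setT (fun w => f w.1 w.2) -> (forall w1 w2, `|f w1 w2| <= M) ->
  L1 P1 (fun w1 => Ex P2 (f w1)).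
Proof.
move=> mf fM; have bf : forall w, `|f w.1 w.2| <= M by [].
exact: (Ex_prod12 (L1_prod_bounded mf bf) (L1_section1 mf bf)).1.
Qed.

Lemma L1_Ex2 (M : R) (f : T1 -> T2 -> R) :
  measurable_fun setT (fun w => f w.1 w.2) -> (forall w1 w2, `|f w1 w2| <= M) ->
  L1 P2 (fun w2 => Ex P1 (fun w1 => f w1 w2)).
Proof.
move=> mf fM; have bf : forall w, `|f w.1 w.2| <= M by [].
exact: (Ex_prod21 (L1_prod_bounded mf bf) (L1_section2 mf bf)).1.
Qed.

Lemma L1_prod_fst (f : T1 -> R) : L1 P1 f -> L1 prodP (fun w => f w.1).
Proof.
move=> lf; have mf := L1_measurable lf.
have mf1 : measurable_fun setT (fun w : T1 * T2 => f w.1) by meas.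
apply/(integrable12ltyP P1 P2); first exact/measurable_EFinP.
under eq_integral do rewrite /= integral_cst//= probability_setT mule1.
by have /integrableP[] := lf.
Qed.

Lemma L1_prod_snd (f : T2 -> R) : L1 P2 f -> L1 prodP (fun w => f w.2).
Proof.
move=> lf; have mf := L1_measurable lf.
have mf1 : measurable_fun setT (fun w : T1 * T2 => f w.2) by meas.
apply/(integrable21ltyP P1 P2); first exact/measurable_EFinP.
under eq_integral do rewrite /= integral_cst//= probability_setT mule1.
by have /integrableP[] := lf.
Qed.

Lemma Ex_prod_fst (f : T1 -> R) : L1 P1 f -> Ex prodP (fun w => f w.1) = Ex P1 f.
Proof.
move=> lf; rewrite (Ex_prod21 (L1_prod_fst lf) _).2//=.
exact: Ex_cst.
Qed.

Lemma Ex_prod_snd (f : T2 -> R) : L1 P2 f -> Ex prodP (fun w => f w.2) = Ex P2 f.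
Proof.
move=> lf; rewrite (Ex_prod12 (L1_prod_snd lf) _).2//=.
exact: Ex_cst.
Qed.

End product_expectation.

Section probability_sets.
Context d (T : measurableType d) (R : realType) (P : probability T R).

Lemma PrT : Pr P setT = 1.
Proof. by rewrite /Pr (@probability_setT _ _ _ P). Qed.

Lemma Pr_fin (A : set T) : measurable A -> P A = (Pr P A)%:E.
Proof. by move=> mA; rewrite /Pr fineK// fin_num_measure. Qed.

Lemma Pr_D (A B : set T) : measurable A -> measurable B -> B `<=` A ->
  Pr P (A `\` B) = Pr P A - Pr P B.
Proof.
move=> mA mB BA; rewrite /Pr measureD//.
  by rewrite setIidr// fineB ?fin_num_measure.
by rewrite -ge0_fin_numE// fin_num_measure.
Qed.

End probability_sets.

(** * Uniqueness of measures, laws, mixtures and independence *)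

Section uniqueness.
Context d1 d2 (T1 : measurableType d1) (T2 : measurableType d2) (R : realType).

(** Measurable rectangles form a generating system stable under intersection; since the total mass
    is finite, the constant sequence [setT] serves as the exhausting one. *)
Lemma prod_measure_eq (m1 m2 : {measure set (T1 * T2) -> \bar R}) :
  (m1 setT < +oo)%E ->
  (forall A B, measurable A -> measurable B -> m1 (A `*` B) = m2 (A `*` B)) ->
  forall X, measurable X -> m1 X = m2 X.
Proof.
move=> m1oo m12 X mX.
pose C : set (set (T1 * T2)) := [set A `*` B | A in measurable & B in measurable].
apply: (measure_unique C (fun=> setT)) => //.
- exact: measurable_prod_measurableType.
- move=> _ _ [A1 mA1 [A2 mA2 <-]] [B1 mB1 [B2 mB2 <-]].
  rewrite -setXI; exists (A1 `&` B1); first exact: measurableI.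
  by exists (A2 `&` B2) => //; exact: measurableI.
- by move=> _; exists setT => //; exists setT => //; rewrite setXTT.
- by rewrite bigcup_const.
- by move=> _ [A mA [B mB <-]]; exact: m12.
Qed.

End uniqueness.

(** Half-open intervals generate the Borel sets and are differences of rays; finiteness of both
    measures makes the subtraction legitimate. *)
Lemma ray_measure_eq (R : realType) (m1 m2 : {measure set (measurableTypeR R) -> \bar R}) :
  (m1 setT < +oo)%E -> (m2 setT < +oo)%E ->
  (forall x : R, m1 `]-oo, x]%classic = m2 `]-oo, x]%classic) ->
  forall X, measurable X -> m1 X = m2 X.
Proof.
move=> m1oo m2oo m12 X mX.
have fin (m : {measure set (measurableTypeR R) -> \bar R}) : (m setT < +oo)%E ->
    forall A, measurable A -> (m A < +oo)%E.
  by move=> moo A mA; apply: le_lt_trans moo; apply: le_measure; rewrite ?inE.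
apply: (@measure_unique _ R (measurableTypeR R) (@ocitv R)
  (fun k : nat => `] (- k%:R)%R, k%:R]%classic) _ _ _ _ m1 m2 _ _ X mX) => //.
- exact: ocitvI.
- by move=> i; exact: is_ocitv.
- by rewrite bigcup_itvT.
- move=> _ [[a b] _ <-] /=.
  have [ab|ba] := leP a b; last by rewrite set_itv_ge ?measure0// bnd_simp -leNgt ltW.
  have -> : `]a, b]%classic = `]-oo, b] `\` `]-oo, a] :> set R.
    by rewrite -[RHS]setCK setCD setCitvl setUC -[LHS]setCK setCitv.
  have mI (x : R) : measurable (`]-oo, x]%classic : set (measurableTypeR R)).
    exact: measurable_itv.
  have sub : (`]-oo, a]%classic `<=` `]-oo, b]%classic) by exact: subset_itvl.
  have := measureD (mI b) (mI a) (fin m1 m1oo _ (mI b)).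
  have := measureD (mI b) (mI a) (fin m2 m2oo _ (mI b)).
  rewrite setIidr// => E2 E1.
  by rewrite [LHS]E1 [RHS]E2; congr (_ - _)%E; exact: m12.
- by move=> k; apply: fin.
Qed.

Definition mfun_of d1 d2 (T1 : measurableType d1) (T2 : measurableType d2)
    (f : T1 -> T2) (mf : measurable_fun setT f) : {mfun T1 >-> T2} :=
  HB.pack f (isMeasurableFun.Build _ _ _ _ f mf).

(** The measurability proof is an explicit argument, so that functions built on the spot also have a
    law. *)
Definition law d1 d2 (T1 : measurableType d1) (T2 : measurableType d2)
    (R : realType) (P : probability T1 R) (f : T1 -> T2)
    (mf : measurable_fun setT f) : probability T2 R :=
  distribution P (mfun_of mf).

Section laws.
Context d1 d2 (T1 : measurableType d1) (T2 : measurableType d2) (R : realType).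

Lemma L1_law (P : probability T1 R) (f : T1 -> T2) (mf : measurable_fun setT f)
    (h : T2 -> R) : measurable_fun setT h ->
  L1 (law P mf) h <-> L1 P (fun w => h (f w)).
Proof.
move=> mh; split=> [/integrableP[_ hoo]|lh].
  apply/integrableP; split; first by apply/measurable_EFinP; exact: measurableT_comp.
  move: hoo; rewrite ge0_integral_distribution//.
  by apply: measurableT_comp => //; exact/measurable_EFinP.
apply: (integrable_pushforward (phi := f) mf) => //; first exact/measurable_EFinP.
Qed.

Lemma Ex_law (P : probability T1 R) (f : T1 -> T2) (mf : measurable_fun setT f)
    (h : T2 -> R) : measurable_fun setT h ->
  L1 P (fun w => h (f w)) -> Ex (law P mf) h = Ex P (fun w => h (f w)).
Proof.
move=> mh lh; rewrite /Ex /Rintegral; congr fine.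
rewrite integral_distribution//; exact/measurable_EFinP.
Qed.

End laws.

Lemma eq_law d1 d2 d3 (T1 : measurableType d1) (T2 : measurableType d2)
    (T3 : measurableType d3) (R : realType) (P : probability T1 R) (Q : probability T3 R)
    (f : T1 -> T2) (mf : measurable_fun setT f)
    (g : T3 -> T2) (mg : measurable_fun setT g) (h : T2 -> R) :
  (forall A, measurable A -> P (f @^-1` A) = Q (g @^-1` A)) ->
  measurable_fun setT h -> L1 P (fun w => h (f w)) ->
  L1 Q (fun w => h (g w)) /\ Ex P (fun w => h (f w)) = Ex Q (fun w => h (g w)).
Proof.
move=> PQ mh lh.
have lgh : L1 Q (fun w => h (g w)).
  apply/(L1_law Q mg mh); move/(L1_law P mf mh) : lh => /integrableP[mEh hoo].
  apply/integrableP; split => //.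
  rewrite (eq_measure_integral (law P mf)) => [|A mA _]; first exact: hoo.
  first [exact: (PQ A mA) | exact: (esym (PQ A mA))].
split => //.
rewrite -(Ex_law mf mh lh) -(Ex_law mg mh lgh) /Ex /Rintegral.
congr fine; apply: eq_measure_integral => A mA _.
first [exact: (PQ A mA) | exact: (esym (PQ A mA))].
Qed.

Section mixture.
Context d1 d2 (T1 : measurableType d1) (T2 : measurableType d2) (R : realType).
Context d3 (T3 : measurableType d3).
Variables (P : probability T1 R) (Q : probability T3 R).
Variables (Z : T1 -> T2) (mZ : measurable_fun setT Z).
Variables (W : nat -> T3 -> T2) (mW : forall i, measurable_fun setT (W i)).
Variables (k : nat -> {nonneg R}) (n : nat).
Hypothesis ZW : forall A, measurable A ->
  P (Z @^-1` A) = (\sum_(i < n) (k i)%:num%:E * Q (W i @^-1` A))%E.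

Let mix := msum (fun i => mscale (k i) (law Q (mW i))) n.

Lemma ge0_integral_mixture (h : T2 -> R) : measurable_fun setT h ->
  (forall x, 0 <= h x) ->
  (\int[P]_w (h (Z w))%:E =
    \sum_(i < n) (k i)%:num%:E * \int[Q]_w (h (W i w))%:E)%E.
Proof.
move=> mh h0; have mEh : measurable_fun setT (EFin \o h) by exact/measurable_EFinP.
have h0' y : (0 <= (EFin \o h) y)%E by rewrite lee_fin.
rewrite -(@ge0_integral_distribution _ _ _ _ _ P (mfun_of mZ) _ mEh h0').
rewrite (eq_measure_integral mix) => [|A mA _]; last first.
  by rewrite /= /distribution /pushforward ZW.
rewrite ge0_integral_measure_sum//; apply: eq_bigr => i _.
rewrite ge0_integral_mscale//; congr (_ * _)%E.
exact: (@ge0_integral_distribution _ _ _ _ _ Q (mfun_of (mW i)) _ mEh h0').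
Qed.

Lemma L1_mixture (h : T2 -> R) : measurable_fun setT h ->
  (forall i, (i < n)%N -> L1 Q (fun w => h (W i w))) -> L1 P (fun w => h (Z w)).
Proof.
move=> mh lh; apply/integrableP; split.
  by apply/measurable_EFinP; exact: measurableT_comp.
have := @ge0_integral_mixture (fun x => `|h x|) _ (fun=> normr_ge0 _).
rewrite /= => ->; last by meas.
rewrite lte_sum_pinfty// => i _.
by apply: lte_mul_pinfty => //; have /integrableP[_] := lh _ (ltn_ord i).
Qed.

Lemma ge0_Ex_mixture (h : T2 -> R) : measurable_fun setT h ->
  (forall x, 0 <= h x) ->
  (forall i, (i < n)%N -> L1 Q (fun w => h (W i w))) ->
  Ex P (fun w => h (Z w)) = \sum_(i < n) (k i)%:num * Ex Q (fun w => h (W i w)).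
Proof.
move=> mh h0 lh; apply: EFin_inj; rewrite /Ex /Rintegral fineK; last first.
  exact: (integrable_fin_num _ (L1_mixture mh lh)).
rewrite ge0_integral_mixture// -sumEFin; apply: eq_bigr => i _.
by rewrite EFinM fineK//; exact: (integrable_fin_num _ (lh _ (ltn_ord i))).
Qed.

(** Additivity of the integral in the measure is a statement on nonnegative integrands; the signed
    case follows by splitting [h] into positive and negative parts. *)
Lemma Ex_mixture (h : T2 -> R) : measurable_fun setT h ->
  (forall i, (i < n)%N -> L1 Q (fun w => h (W i w))) ->
  Ex P (fun w => h (Z w)) = \sum_(i < n) (k i)%:num * Ex Q (fun w => h (W i w)).
Proof.
move=> mh lh.
pose hp x := Num.max (h x) 0; pose hm x := Num.max (- h x) 0.
have hE x : h x = hp x - hm x by rewrite /hp /hm /Num.max; case: ltP => ?; case: ltP => ?; lra.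
have mhp : measurable_fun setT hp by rewrite /hp; meas.
have mhm : measurable_fun setT hm by rewrite /hm; meas.
have hp0 x : 0 <= hp x by rewrite /hp le_max lexx orbT.
have hm0 x : 0 <= hm x by rewrite /hm le_max lexx orbT.
have lhp i : (i < n)%N -> L1 Q (fun w => hp (W i w)).
  move=> i_n; apply: (L1_le _ _ (L1_norm (lh i i_n))).
    exact: (measurableT_comp mhp (mW i)).
  by move=> w; rewrite ger0_norm// /hp /Num.max; case: ltP => // _; exact: ler_norm.
have lhm i : (i < n)%N -> L1 Q (fun w => hm (W i w)).
  move=> i_n; apply: (L1_le _ _ (L1_norm (lh i i_n))).
    exact: (measurableT_comp mhm (mW i)).
  move=> w; rewrite ger0_norm// /hm /Num.max -normrN; case: ltP => // _; exact: ler_norm.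
rewrite (eq_Ex P (fun w => hE (Z w))) ExB; [|exact: L1_mixture..].
rewrite !ge0_Ex_mixture// -sumrB; apply: eq_bigr => i _.
rewrite -mulrBr -ExB; [|exact: lhp|exact: lhm].
by congr (_ * _); apply: eq_Ex => w; rewrite hE.
Qed.

End mixture.

Section independence.
Context d (T : measurableType d) (R : realType) (P : probability T R).
Context d1 d2 (T1 : measurableType d1) (T2 : measurableType d2).

Definition indep (Z : T -> T1) (W : T -> T2) := forall A B,
  measurable A -> measurable B ->
  Pr P (Z @^-1` A `&` W @^-1` B) = Pr P (Z @^-1` A) * Pr P (W @^-1` B).

Variables (Z : T -> T1) (mZ : measurable_fun setT Z).
Variables (W : T -> T2) (mW : measurable_fun setT W).
Hypothesis ZW : indep Z W.

(** An independent pair is realised on two copies of the sample space, each coordinate reading its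
    own copy. The variables keep their definition as functions, and Fubini applies to [P] with
    itself. *)
Lemma indep_measure A : measurable A ->
  P ((fun w => (Z w, W w)) @^-1` A) =
  prodP P P ((fun w => (Z w.1, W w.2)) @^-1` A).
Proof.
have mp : measurable_fun setT (fun w => (Z w, W w)) by meas.
have mp2 : measurable_fun setT (fun w : T * T => (Z w.1, W w.2)) by meas.
apply: (prod_measure_eq (m1 := law P mp) (m2 := law (prodP P P) mp2)).
  by rewrite /= /distribution /pushforward preimage_setT ltey_eq fin_num_measure.
move=> X Y mX mY; rewrite /= /distribution /pushforward.
have mZX : measurable (Z @^-1` X) by rewrite -[X in measurable X]setTI; exact: mZ.
have mWY : measurable (W @^-1` Y) by rewrite -[X in measurable X]setTI; exact: mW.
have -> : mfun_of mp @^-1` (X `*` Y) = Z @^-1` X `&` W @^-1` Y by [].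
have -> : mfun_of mp2 @^-1` (X `*` Y) = (Z @^-1` X) `*` (W @^-1` Y) by [].
transitivity (Pr P (Z @^-1` X `&` W @^-1` Y))%:E.
  by apply: Pr_fin; exact: measurableI.
rewrite ZW// EFinM; transitivity (P (Z @^-1` X) * P (W @^-1` Y))%E.
  by congr (_ * _)%E; apply/esym/Pr_fin.
by rewrite product_measure1E.
Qed.

Lemma indep_Ex (h : T1 * T2 -> R) : measurable_fun setT h ->
  L1 P (fun w => h (Z w, W w)) ->
  L1 (prodP P P) (fun w => h (Z w.1, W w.2)) /\
  Ex P (fun w => h (Z w, W w)) = Ex (prodP P P) (fun w => h (Z w.1, W w.2)).
Proof.
by move=> mh lh; apply: eq_law => //; [meas|meas|exact: indep_measure].
Qed.

End independence.

(** * Tails and increments *)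

Section tails.
Context d (T : measurableType d) (R : realType) (P : probability T R).
Implicit Types (U V : T -> R).

(** The increments [ic U s x] are also used for negative [s]. *)
Definition tl U (x : R) : R := Ex P (fun w => (x < U w)%R%:R).

Definition ic U (s x : R) : R := tl U x - tl U (x + s).

Lemma L1_natb (b : T -> bool) : measurable_fun setT b -> L1 P (fun w => (b w)%:R).
Proof.
move=> mb; apply: (@L1_bounded _ _ _ _ _ 1); first by meas.
by move=> w; case: (b w); rewrite ?normr1 ?normr0.
Qed.

Lemma L1M_natb (f : T -> R) (b : T -> bool) : L1 P f -> measurable_fun setT b ->
  L1 P (fun w => f w * (b w)%:R).
Proof.
move=> lf mb; apply: (@L1M_bounded _ _ _ _ 1) => //; first by meas.
by move=> w; case: (b w); rewrite ?normr1 ?normr0.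
Qed.

Lemma Ex_natb_le1 (b : T -> bool) : measurable_fun setT b ->
  Ex P (fun w => (b w)%:R) <= 1.
Proof.
move=> mb; rewrite -[leRHS](Ex_cst P); apply: le_Ex; [exact: L1_natb|exact: L1_cst|].
by move=> w; case: (b w).
Qed.

Variables (U : T -> R) (mU : measurable_fun setT U).

Lemma tl_ge0 x : 0 <= tl U x.
Proof. by apply: Ex_ge0 => w; rewrite ler0n. Qed.

Lemma tl_le1 x : tl U x <= 1.
Proof. by apply: Ex_natb_le1; meas. Qed.

Lemma tl_mono x y : x <= y -> tl U y <= tl U x.
Proof.
move=> xy; apply: le_Ex; [apply: L1_natb; meas..|].
by move=> w; rewrite ler_nat; case: (ltP y (U w)) => // yU; rewrite (le_lt_trans xy).
Qed.

Lemma ic_ge0 s x : 0 <= s -> 0 <= ic U s x.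
Proof. by move=> s0; rewrite subr_ge0 tl_mono// lerDl. Qed.

Lemma ic_mono s t x : s <= t -> ic U s x <= ic U t x.
Proof. by move=> st; rewrite /ic lerB// tl_mono// lerD2l. Qed.

Lemma Ex_itv a b : a <= b ->
  Ex P (fun w => (a < U w <= b)%R%:R) = tl U a - tl U b.
Proof.
move=> ab; rewrite -ExB; [|apply: L1_natb; meas..].
apply: eq_Ex => w; case: (ltP b (U w)) => bU.
  by rewrite (le_lt_trans ab bU) subrr.
by case: (ltP a (U w)) => aU; rewrite /= subr0.
Qed.

Lemma ic_itv s x : 0 <= s -> ic U s x = Ex P (fun w => (x < U w <= x + s)%R%:R).
Proof. by move=> s0; rewrite Ex_itv// lerDl. Qed.

Lemma ic_add s t x : ic U (s + t) x = ic U s x + ic U t (x + s).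
Proof. by rewrite /ic addrA; lra. Qed.

Lemma tl_cvg0 e : 0 < e -> exists M, forall x, M <= x -> tl U x <= e.
Proof.
move=> e0; have := @cvg_ccdfy0 _ _ _ P (mfun_of mU).
move=> /fine_cvg /cvgrPdist_le /(_ _ e0)[M [_ hM]].
exists (M + 1) => x Mx; have /= := hM x; rewrite sub0r normrN => H.
have : M < x by lra.
move=> /H; rewrite /tl Ex_indic; last by meas.
rewrite /ccdf /distribution /pushforward /=.
rewrite (_ : mfun_of mU @^-1` `]x, +oo[ = [set w | x < U w]); last first.
  by apply/seteqP; split=> w; rewrite /= in_itv/= andbT.
by apply: le_trans; exact: ler_norm.
Qed.

End tails.

(** For [s < 0] the increment at [x] is minus the increment of length [- s] at [x + s], which is
    linear there with slope [ic P U 1 (x + s)]. Comparing the windows of lengths [- s] and [1 - s]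
    at [x + s] shows that this slope is close to [ic P U 1 x]; hence the range [t + 1] in the
    hypothesis. *)
Lemma ic_lin_sym d (T : measurableType d) (R : realType) (P : probability T R)
    (U : T -> R) (p : R -> R) (t e x : R) : 0 <= t -> 0 < e -> 0 < p x ->
  (forall y, `|y| <= t -> p (x + y) <= 2 * p x) ->
  (forall y, `|y| <= t -> forall s, 0 <= s <= t + 1 ->
    `|ic P U s (x + y) - s * ic P U 1 (x + y)| <= e * p (x + y)) ->
  forall s, `|s| <= t ->
    `|ic P U s x - s * ic P U 1 x| <= e * (2 * (1 + 2 * t)) * p x.
Proof.
move=> t0 e0 p0 hp H s st; have [s0|s0] := leP 0 s.
  have := H 0; rewrite normr0 addr0 => /(_ t0 s).
  move: st; rewrite ger0_norm// => st.
  have -> : 0 <= s <= t + 1 by lra.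
  move=> /(_ isT) h; apply: le_trans h _; rewrite -mulrA ler_pM2l//.
  have : 0 <= t * p x by rewrite mulr_ge0// ltW.
  lra.
have ps := hp s st.
have us : - s <= t by move: st; rewrite ltr0_norm.
have h1 := H s st (- s).
have h2 := H s st (1 - s).
have {h1} := h1 _; have {h2} := h2 _.
have -> : 0 <= 1 - s <= t + 1 by lra.
have -> : 0 <= - s <= t + 1 by lra.
move=> /(_ isT) h2 /(_ isT) h1.
rewrite (_ : 1 - s = - s + 1) in h2; last by lra.
rewrite ic_add addrK in h2.
have -> : ic P U s x = - ic P U (- s) (x + s).
  by rewrite /ic addrK; lra.
move: h1 h2; set h := ic P U 1 (x + s); set a := ic P U (- s) (x + s).
set b := ic P U 1 x => h1 h2.
have hb : `|b - h| <= 2 * e * p (x + s).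
  have -> : b - h = (a + b - (- s + 1) * h) - (a - - s * h) by lra.
  by apply: le_trans (ler_normB _ _) _; lra.
have -> : - a - s * b = - (a - - s * h) - s * (b - h) by lra.
apply: le_trans (ler_normB _ _) _; rewrite normrN normrM.
have : `|s| * `|b - h| <= t * (2 * e * p (x + s)) by apply: ler_pM.
have : e * (1 + 2 * t) * p (x + s) <= e * (1 + 2 * t) * (2 * p x).
  by rewrite ler_wpM2l// mulr_ge0 ?ltW//; lra.
lra.
Qed.

Lemma nearyP (R : realType) (Q : R -> Prop) :
  (\forall x \near +oo, Q x) <-> exists M, forall x, M <= x -> Q x.
Proof.
split=> [[M [_ QM]]|[M QM]].
  by exists (M + 1) => x Mx; apply: QM; rewrite /=; lra.
by exists M; split; [exact: num_real|move=> x /ltW; exact: QM].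
Qed.

Lemma near_ge_all (R : realType) (Q : R -> Prop) :
  (\forall x \near +oo, Q x) -> \forall x \near +oo, forall y, x <= y -> Q y.
Proof.
move=> /nearyP[M QM]; apply/nearyP; exists M => x Mx y xy.
by apply: QM; exact: le_trans xy.
Qed.

Lemma near_shift (R : realType) (Q : R -> Prop) t :
  (\forall x \near +oo, Q x) ->
  \forall x \near +oo, forall y, `|y| <= t -> Q (x + y).
Proof.
move=> /nearyP[M QM]; apply/nearyP; exists (M + t) => x Mx y.
by rewrite ler_norml => /andP[ty _]; apply: QM; lra.
Qed.

(** * Reference laws and regular families *)

Section reference.
Context (R : realType) (K : distr R).

Notation p := (ic K id 1).

(** All that the summation argument uses of the law. [ref_sq] governs the event that both variables
    exceed [x], [ref_both] the event that both lie between [A] and [x] while their sum exceeds [x].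
    In [ref_both] the level [A] is fixed before [x] tends to infinity. *)
Record reference : Prop := Reference {
  ref_pos : \forall x \near +oo, 0 < p x;
  ref_decr : exists2 C, 0 < C & \forall x \near +oo, forall y, x <= y -> p y <= C * p x;
  ref_shift : forall t e, 0 < e -> \forall x \near +oo, forall y, `|y| <= t ->
    `|p (x + y) - p x| <= e * p x;
  ref_sq : forall e, 0 < e -> \forall x \near +oo, tl K id x ^+ 2 <= e * p x;
  ref_both : forall e, 0 < e -> exists A0, forall A, A0 <= A ->
    \forall x \near +oo,
    Ex K (fun u => Ex K (fun v => [&& A < u <= x, A < v <= x & x < u + v]%R%:R))
      <= e * p x }.

Variable (I : Type).
Implicit Types (f g : I -> R -> R).

Definition usmall f := forall e, 0 < e ->
  \forall x \near +oo, forall i, `|f i x| <= e * p x.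

Lemma usmallD f g : usmall f -> usmall g -> usmall (fun i x => f i x + g i x).
Proof.
move=> sf sg e e0; have e2 : 0 < e / 2 by lra.
near=> x => i.
have h1 : forall i, `|f i x| <= e / 2 * p x by near: x; exact: sf.
have h2 : forall i, `|g i x| <= e / 2 * p x by near: x; exact: sg.
by have := ler_normD (f i x) (g i x); have := h1 i; have := h2 i; lra.
Unshelve. all: by end_near. Qed.

Lemma usmallN f : usmall f -> usmall (fun i x => - f i x).
Proof.
move=> sf e e0; apply: filterS (sf e e0) => x H i; rewrite normrN; exact: H.
Qed.

Lemma usmallB f g : usmall f -> usmall g -> usmall (fun i x => f i x - g i x).
Proof. by move=> sf sg; apply: usmallD => //; exact: usmallN. Qed.

Lemma usmallM (k : I -> R -> R) M f : (forall i x, `|k i x| <= M) ->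
  usmall f -> usmall (fun i x => k i x * f i x).
Proof.
move=> kM sf e e0; have M0 : 0 < `|M| + 1 by rewrite ltr_wpDl.
have eM : 0 < e / (`|M| + 1) by rewrite divr_gt0.
apply: filterS (sf _ eM) => x H i; rewrite normrM.
have kM1 : `|k i x| <= `|M| + 1.
  by rewrite (le_trans (kM i x))// (le_trans (ler_norm M))// lerDl.
apply: le_trans (ler_pM (normr_ge0 _) (normr_ge0 _) kM1 (H i)) _.
by rewrite mulrA (mulrC (_ + 1)) divfK// gt_eqF.
Qed.

Lemma eq_usmall f g : (\forall x \near +oo, forall i, f i x = g i x) ->
  usmall f -> usmall g.
Proof.
move=> fg sf e e0; near=> x => i.
have -> : g i x = f i x by apply/esym; move: i; near: x.
by move: i; near: x; exact: sf.
Unshelve. all: by end_near. Qed.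

Lemma usmall_cst0 : reference -> usmall (fun _ _ => 0).
Proof.
move=> rK e e0; apply: filterS (ref_pos rK) => x p0 i.
by rewrite normr0 mulr_ge0 ?ltW.
Qed.

Lemma usmall_sum (J : Type) (s : seq J) (D : pred J) (f : J -> I -> R -> R) :
  reference -> (forall j, D j -> usmall (f j)) ->
  usmall (fun i x => \sum_(j <- s | D j) f j i x).
Proof.
move=> rK sf; elim: s => [|a s IH].
  apply: eq_usmall (usmall_cst0 rK); apply: nearW => x i.
  by rewrite big_nil.
case Da : (D a); last first.
  by apply: eq_usmall IH; apply: nearW => x i; rewrite big_cons Da.
apply: eq_usmall (usmallD (sf a Da) IH); apply: nearW => x i.
by rewrite big_cons Da.
Qed.

(** [U i] ranges over a family of random variables; all bounds are uniform in [i]. *)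
Record regular d (T : measurableType d) (P : probability T R) (U : I -> T -> R)
    : Prop := Regular {
  reg_meas : forall i, measurable_fun setT (U i);
  reg_L1 : forall i, L1 P (U i);
  reg_ui : forall e, 0 < e -> exists A, forall i,
    Ex P (fun w => `|U i w| * (A < `|U i w|)%R%:R) <= e;
  reg_big : exists2 C, 0 < C & \forall x \near +oo, forall i, ic P (U i) 1 x <= C * p x;
  reg_lin : forall t e, 0 < e -> \forall x \near +oo, forall i s, 0 <= s <= t ->
    `|ic P (U i) s x - s * ic P (U i) 1 x| <= e * p x }.

Section regular_theory.
Context d (T : measurableType d) (P : probability T R).
Hypothesis rK : reference.
Variable U : I -> T -> R.
Hypothesis rU : regular P U.

Let mU i : measurable_fun setT (U i) := reg_meas rU i.

Lemma reg_linN t e : 0 < e -> \forall x \near +oo, forall i s, `|s| <= t ->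
  `|ic P (U i) s x - s * ic P (U i) 1 x| <= e * p x.
Proof.
move=> e0; have [t0|t0] := ltP t 0.
  apply: nearW => x i s st; have := normr_ge0 s; lra.
pose e' := e / (2 * (1 + 2 * t)).
have e'0 : 0 < e' by rewrite divr_gt0//; lra.
have ee' : e = e' * (2 * (1 + 2 * t)).
  rewrite /e' divfK// gt_eqF//; lra.
near=> x => i s st.
have p0 : 0 < p x by near: x; exact: ref_pos.
have H : forall y, `|y| <= t -> forall i s, 0 <= s <= t + 1 ->
    `|ic P (U i) s (x + y) - s * ic P (U i) 1 (x + y)| <= e' * p (x + y).
  by near: x; exact: (near_shift t (reg_lin rU (t + 1) e'0)).
have Hp : forall y, `|y| <= t -> `|p (x + y) - p x| <= 1 * p x.
  by near: x; exact: (ref_shift rK t ltr01).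
rewrite ee'; apply: (ic_lin_sym (p := p)) => // y yt; last by move=> u; exact: H.
by have := Hp y yt; rewrite ler_norml; lra.
Unshelve. all: by end_near. Qed.

(** A window of length [s] is covered by at most [s + 1] unit windows to the right of [x], each
    controlled by [ref_decr]. There is no upper limit on [s], and the growth is linear, so that [s]
    may later be replaced by an integrable random length. *)
Lemma reg_ic_le : exists2 C, 0 < C & \forall x \near +oo, forall i s, 0 <= s ->
  ic P (U i) s x <= C * (s + 1) * p x.
Proof.
have [C C0 hC] := reg_big rU; have [D D0 hD] := ref_decr rK.
exists (C * D); first exact: mulr_gt0.
near=> x => i s s0.
have p0 : 0 < p x by near: x; exact: ref_pos.
have H : forall y, x <= y -> forall i, ic P (U i) 1 y <= C * p y.
  by near: x; exact: near_ge_all.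
have Hp : forall y, x <= y -> p y <= D * p x by near: x.
have IH n : ic P (U i) n%:R x <= C * D * n%:R * p x.
  elim: n => [|n IH]; first by rewrite /ic addr0 subrr mulr0 mul0r.
  rewrite -natr1 ic_add.
  have xn : x <= x + n%:R by rewrite lerDl.
  have := H _ xn i; have : C * p (x + n%:R) <= C * (D * p x).
    by rewrite ler_pM2l// Hp.
  lra.
have := truncnS_gt s; set n := (Num.truncn s).+1 => sn.
have : ic P (U i) s x <= ic P (U i) n%:R x by apply: ic_mono => //; exact: ltW.
move=> /le_trans; apply; apply: le_trans (IH n) _.
rewrite ler_pM2r// ler_pM2l ?mulr_gt0// -natr1 lerD2r.
by have := truncn_le s; rewrite s0.
Unshelve. all: by end_near. Qed.

(** Sum the unit-window bound over consecutive windows starting at [s]. The last window may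
    overshoot [y] by less than 1, whence [y + 1] on the side of [K]. The bound on tails is the limit
    for [y] tending to infinity. *)
Lemma reg_dom : exists2 C, 0 < C & exists z, forall i,
  (forall s y, z <= s -> s <= y ->
    tl P (U i) s - tl P (U i) y <= C * (tl K id s - tl K id (y + 1))) /\
  (forall s, z <= s -> tl P (U i) s <= C * tl K id s).
Proof.
have [C C0 /nearyP[z hC]] := reg_big rU; exists C => //; exists z => i.
have IH n s : z <= s -> ic P (U i) n%:R s <= C * ic K id n%:R s.
  move=> zs; elim: n => [|n IH]; first by rewrite /ic !addr0 !subrr mulr0.
  rewrite -natr1 !ic_add mulrDr lerD// hC//.
  by rewrite (le_trans zs)// lerDl.
have dom s y : z <= s -> s <= y ->
    tl P (U i) s - tl P (U i) y <= C * (tl K id s - tl K id (y + 1)).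
  move=> zs sy; have := truncnS_gt (y - s).
  set n := (Num.truncn (y - s)).+1 => sn.
  have ny : n%:R <= y - s + 1.
    by rewrite -natr1 lerD2r; have := truncn_le (y - s); rewrite subr_ge0 sy.
  have := IH n _ zs; rewrite /ic.
  have h1 : tl P (U i) (s + n%:R) <= tl P (U i) y by apply: tl_mono => //; lra.
  have h2 : tl K id (y + 1) <= tl K id (s + n%:R) by apply: tl_mono => //; lra.
  have : C * (tl K id s - tl K id (s + n%:R)) <= C * (tl K id s - tl K id (y + 1)).
    by rewrite ler_pM2l//; lra.
  lra.
split=> // s zs; apply/ler_addgt0Pr => e e0.
have [M hM] := tl_cvg0 P (mU i) e0.
have hy := hM (Num.max M s) _.
have := dom s (Num.max M s) zs; rewrite le_max lexx orbT => /(_ isT).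
have := hy; rewrite le_max lexx => /(_ isT).
have : 0 <= C * tl K id (Num.max M s + 1) by rewrite mulr_ge0 ?tl_ge0 ?ltW.
lra.
Qed.

Lemma reg_Ex_bound : exists M, forall i, `|Ex P (U i)| <= M.
Proof.
have [A hA] := reg_ui rU ltr01.
exists (`|A| + 1) => i; apply: le_trans (normr_Ex (reg_L1 rU i)) _.
have lU := L1_norm (reg_L1 rU i).
have lt : L1 P (fun w => `|U i w| * (A < `|U i w|)%R%:R).
  by have mUi := mU i; apply: L1M_natb => //; meas.
apply: (@le_trans _ _ (Ex P (fun w => `|A| + `|U i w| * (A < `|U i w|)%R%:R))).
  apply: le_Ex => //; first by apply: L1D => //; exact: L1_cst.
  move=> w; case: ltP => h; first by rewrite mulr1 lerDr.
  by rewrite mulr0 addr0 (le_trans h)// ler_norm.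
rewrite ExD//; last exact: L1_cst.
by rewrite Ex_cst lerD2l.
Qed.

End regular_theory.
End reference.

(** * Sums of two independent variables *)

(** If [|u|] and [|v|] exceed [A], the excess is nonzero only if both variables are large or
    one is very negative while the other is just above [x]. *)
Lemma excess_split (R : realType) (A x u v : R) : 0 < A -> 2 * A < x ->
  `| ((x < u + v)%R%:R - (x < u)%R%:R - (x < v)%R%:R)
     - (- A <= v <= A)%R%:R * ((x < u + v)%R%:R - (x < u)%R%:R)
     - (- A <= u <= A)%R%:R * ((x < u + v)%R%:R - (x < v)%R%:R) | <=
  ((x < u) && (x < v))%R%:R + [&& A < u <= x, A < v <= x & x < u + v]%R%:R +
  ((u < - A) && (x < v <= x - u))%R%:R + ((v < - A) && (x < u <= x - v))%R%:R :> R.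
Proof.
move=> A0 Ax; rewrite ler_norml.
rewrite (ltNge A u) (ltNge A v) (ltNge u (- A)) (ltNge v (- A)).
rewrite (leNgt u x) (leNgt v x) (lerBrDl v x u) (lerBrDl u x v) (leNgt (u + v)).
rewrite (leNgt (v + u)) (addrC v u).
case: (ltP x (u + v)) => h1; case: (ltP x u) => h2; case: (ltP x v) => h3;
case: (leP u A) => h4; case: (leP v A) => h5;
case: (leP (- A) u) => h6; case: (leP (- A) v) => h7 /=; apply/andP;
  first [solve [clear; split; lra] | exfalso; lra | split; lra].
Qed.

Lemma natb_diff_le1 (R : realType) (a b c : bool) :
  `|a%:R * (b%:R - c%:R)| <= 1 :> R.
Proof.
by case: a; case: b; case: c; rewrite ?mul1r ?mul0r ?subrr ?subr0 ?sub0r ?normrN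
  ?normr1 ?normr0.
Qed.

Section two_variables.
Context d (T : measurableType d) (R : realType) (P : probability T R).

Lemma indep_bounded (U V : T -> R) (M : R) (f : R -> R -> R) :
  measurable_fun setT U -> measurable_fun setT V -> indep P U V ->
  measurable_fun setT (fun z => f z.1 z.2) -> (forall u v, `|f u v| <= M) ->
  Ex P (fun w => f (U w) (V w)) = Ex P (fun w2 => Ex P (fun w1 => f (U w1) (V w2))).
Proof.
move=> mU mV UV mf fM.
have lf : L1 P (fun w => (fun z : R * R => f z.1 z.2) (U w, V w)).
  apply: (@L1_bounded _ _ _ _ _ M) => //.
  exact: (measurableT_comp mf (measurable_pair mU mV)).
rewrite (indep_Ex mU mV UV mf lf).2.
have mh : measurable_fun setT (fun z : T * T => f (U z.1) (V z.2)).
  have mg : measurable_fun setT (fun z : T * T => (U z.1, V z.2)) by meas.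
  exact: (measurableT_comp mf mg).
have bh : forall z : T * T, `|f (U z.1) (V z.2)| <= M by [].
have -> : Ex (prodP P P) (fun w => (fun z => f z.1 z.2) (U w.1, V w.2)) =
  Ex (prodP P P) (fun z => f (U z.1) (V z.2)) by [].
by rewrite (Ex_prod21 (L1_prod_bounded P P mh bh) (L1_section2 P mh bh)).2.
Qed.

Lemma indepC (U V : T -> R) : indep P U V -> indep P V U.
Proof. by move=> UV A B mA mB; rewrite setIC mulrC UV. Qed.

(** Given [V = v] with [|v| <= A], the integrand has expectation [- ic P U (- v) x], which is
    [v * ic P U 1 x] up to [e]. Integrating over [v] gives the truncated mean of [V]; the last term
    of the bound restores the full mean. *)
Lemma small_part (U V : T -> R) (A x e : R) :
  measurable_fun setT U -> L1 P V -> indep P U V -> 0 <= e ->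
  (forall s, `|s| <= A -> `|ic P U s x - s * ic P U 1 x| <= e) ->
  `| Ex P (fun w => (- A <= V w <= A)%R%:R *
       ((x < U w + V w)%R%:R - (x < U w)%R%:R)) - ic P U 1 x * Ex P V | <=
  e + ic P U 1 x * Ex P (fun w => `|V w| * (A < `|V w|)%R%:R).
Proof.
move=> mU lV UV e0 hU; have mV := L1_measurable lV.
pose f (u v : R) : R := (- A <= v <= A)%R%:R * ((x < u + v)%R%:R - (x < u)%R%:R).
have -> : Ex P (fun w => (- A <= V w <= A)%R%:R *
       ((x < U w + V w)%R%:R - (x < U w)%R%:R)) =
  Ex P (fun w2 => Ex P (fun w1 => f (U w1) (V w2))).
  apply: (indep_bounded (M := 1) (f := f)) => //; first by rewrite /f; meas.
  by move=> u v; exact: natb_diff_le1.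
have fE w2 : Ex P (fun w1 => f (U w1) (V w2)) =
    (- A <= V w2 <= A)%R%:R * - ic P U (- V w2) x.
  rewrite /f ExZl; last by apply: L1B; apply: L1_natb; meas.
  congr (_ * _); rewrite ExB; [|apply: L1_natb; meas..].
  rewrite /ic opprB; congr (_ - _); apply: eq_Ex => w1.
  by rewrite ltrBlDr.
set h := ic P U 1 x.
have h0 : 0 <= h by apply: ic_ge0.
have lI : L1 P (fun w2 => Ex P (fun w1 => f (U w1) (V w2))).
  apply: (L1_Ex2 _ _ (M := 1) (f := fun w1 w2 => f (U w1) (V w2))).
    by rewrite /f; meas.
  by move=> w1 w2; exact: natb_diff_le1.
have lVA : L1 P (fun w => `|V w| * (A < `|V w|)%R%:R).
  by apply: L1M_natb; [exact: L1_norm|meas].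
rewrite -ExZl// -ExB//; last exact: L1Zl.
apply: le_trans (normr_Ex _) _; first by apply: L1B => //; exact: L1Zl.
rewrite -(ExZl h lVA) -[X in X + _](Ex_cst P e) -ExD; [|exact: L1_cst|exact: L1Zl].
apply: le_Ex.
- by apply: L1_norm; apply: L1B => //; exact: L1Zl.
- by apply: L1D; [exact: L1_cst|exact: L1Zl].
move=> w; rewrite fE -ler_norml.
case: (leP `|V w| A) => [VA|AV].
  rewrite mulr0 mulr0 addr0 mul1r.
  have := hU (- V w); rewrite normrN => /(_ VA).
  by rewrite -normrN; congr (`|_| <= _); rewrite /h; lra.
rewrite mul0r sub0r normrN mulr1 normrM (ger0_norm h0).
by rewrite lerDr.
Qed.

(** Given [U = u < - A], the variable [V] lies in a window of length [- u], which has probability at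
    most [C * (|u| + 1)]; as [|u| > A >= 1], this is at most [2 * C * |u|], and integrability of [U]
    makes it small. *)
Lemma cross_part (U V : T -> R) (A x C : R) :
  measurable_fun setT V -> L1 P U -> indep P U V -> 1 <= A -> 0 <= C ->
  (forall s, 0 <= s -> ic P V s x <= C * (s + 1)) ->
  Ex P (fun w => ((U w < - A) && (x < V w <= x - U w))%R%:R) <=
  2 * C * Ex P (fun w => `|U w| * (A < `|U w|)%R%:R).
Proof.
move=> mV lU UV A1 C0 hV; have mU := L1_measurable lU.
pose f (v u : R) : R := ((u < - A) && (x < v <= x - u))%R%:R.
have -> : Ex P (fun w => ((U w < - A) && (x < V w <= x - U w))%R%:R) =
  Ex P (fun w2 => Ex P (fun w1 => f (V w1) (U w2))).
  apply: (indep_bounded (M := 1) (f := f)) => //; first exact: indepC.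
  - by rewrite /f; meas.
  - by move=> v u; rewrite /f; case: (_ && _); rewrite ?normr1 ?normr0.
have lI : L1 P (fun w2 => Ex P (fun w1 => f (V w1) (U w2))).
  apply: (L1_Ex2 _ _ (M := 1) (f := fun w1 w2 => f (V w1) (U w2))).
    by rewrite /f; meas.
  by move=> w1 w2; rewrite /f; case: (_ && _); rewrite ?normr1 ?normr0.
have lUA : L1 P (fun w => `|U w| * (A < `|U w|)%R%:R).
  by apply: L1M_natb; [exact: L1_norm|meas].
rewrite -ExZl//; apply: le_Ex => //; first exact: L1Zl.
move=> w; rewrite /f; case: (ltP (U w) (- A)) => /= UA; last first.
  by rewrite Ex_cst !mulr_ge0.
have U0 : U w < 0 by lra.
rewrite ltr0_norm//; have -> : A < - U w by lra.
have := hV (- U w); rewrite ic_itv//; last by lra.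
move=> H; apply: le_trans (H _) _; first by lra.
rewrite mulr1 (mulrC 2) -mulrA ler_wpM2l//; lra.
Qed.

End two_variables.

Section domination.
Context (R : realType) (K : distr R).
Context d (T : measurableType d) (P : probability T R).

(** For fixed [v] the event is the single window from [max(A, x - v)] to [x], so the domination of
    increments by those of [K] applies to it. *)
Lemma dom_section (U : T -> R) (C z A x v : R) : measurable_fun setT U -> 0 <= C ->
  (forall s y, z <= s -> s <= y ->
    tl P U s - tl P U y <= C * (tl K id s - tl K id (y + 1))) ->
  z <= A ->
  Ex P (fun w => ((A < U w <= x) && (x < U w + v))%R%:R) <=
  C * Ex K (fun k => ((A < k <= x + 1) && (x < k + v))%R%:R).
Proof.
move=> mU C0 dom zA; pose s := Num.max A (x - v).
have E (w : R) y : (A < w <= y) && (x < w + v) = (s < w <= y).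
  by rewrite /s gt_max ltrBlDr; case: (A < w); case: (x < _); case: (w <= y).
rewrite (eq_Ex P (g := fun w => (s < U w <= x)%R%:R)) => [|w]; last by rewrite E.
rewrite (eq_Ex K (g := fun w => (s < w <= x + 1)%R%:R)) => [|w]; last by rewrite E.
have [sx|xs] := leP s x; last first.
  rewrite (eq_Ex P (g := fun=> 0)) => [|w].
    by rewrite Ex_cst mulr_ge0//; apply: Ex_ge0.
  by case: (ltP s (U w)) => //= sU; rewrite leNgt (lt_trans xs).
rewrite !Ex_itv//; last by rewrite (le_trans sx)// lerDl.
by apply: dom => //; rewrite (le_trans zA)// le_max lexx.
Qed.

(** The variables are replaced by copies of law [K] one at a time, with Fubini in between. Each
    replacement extends the range to [x + 1]; the added region, with one coordinate in []x, x + 1]]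
    and the other above [A], contributes at most [p x * tl K id A], twice by symmetry. *)
Lemma dom_both (U V : T -> R) (C C' z A x : R) :
  measurable_fun setT U -> measurable_fun setT V -> indep P U V ->
  0 <= C -> 0 <= C' ->
  (forall s y, z <= s -> s <= y ->
    tl P U s - tl P U y <= C * (tl K id s - tl K id (y + 1))) ->
  (forall s y, z <= s -> s <= y ->
    tl P V s - tl P V y <= C' * (tl K id s - tl K id (y + 1))) ->
  z <= A -> A <= x ->
  Ex P (fun w => [&& A < U w <= x, A < V w <= x & x < U w + V w]%R%:R) <=
  C * C' * (Ex K (fun u => Ex K (fun v =>
    [&& A < u <= x, A < v <= x & x < u + v]%R%:R)) + 2 * ic K id 1 x * tl K id A).
Proof.
move=> mU mV UV C0 C'0 domU domV zA Ax.
pose f (u v : R) : R := [&& A < u <= x, A < v <= x & x < u + v]%R%:R.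
have -> : Ex P (fun w => [&& A < U w <= x, A < V w <= x & x < U w + V w]%R%:R) =
  Ex P (fun w2 => Ex P (fun w1 => f (U w1) (V w2))).
  apply: (indep_bounded (M := 1) (f := f)) => //; first by rewrite /f; meas.
  by move=> u v; rewrite /f; case: [&& _, _ & _]; rewrite ?normr1 ?normr0.
pose g (k v : R) : R := [&& A < k <= x + 1, A < v <= x & x < k + v]%R%:R.
pose g' (k k' : R) : R := [&& A < k <= x + 1, A < k' <= x + 1 & x < k + k']%R%:R.
have b1 (b : bool) : `|b%:R| <= 1 :> R by case: b; rewrite ?normr1 ?normr0.
have step1 : Ex P (fun w2 => Ex P (fun w1 => f (U w1) (V w2))) <=
    C * Ex P (fun w2 => Ex K (fun k => g k (V w2))).
  have lg : L1 P (fun w2 => Ex K (fun k => g k (V w2))).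
    by apply: (L1_Ex2 K P (M := 1) (f := fun k w2 => g k (V w2)));
      [rewrite /g; meas|move=> *; exact: b1].
  rewrite -ExZl//; apply: le_Ex; last first.
  - move=> w; rewrite /f /g; case: (A < V w <= x) => /=.
      by apply: (dom_section (z := z)).
    rewrite (eq_Ex P (g := fun=> 0)) => [|w']; last by rewrite andbF.
    by rewrite Ex_cst mulr_ge0//; apply: Ex_ge0.
  - exact: L1Zl.
  - by apply: (L1_Ex2 _ _ (M := 1) (f := fun w1 w2 => f (U w1) (V w2)));
      [rewrite /f; meas|move=> *; exact: b1].
apply: le_trans step1 _; rewrite -mulrA ler_wpM2l//.
have mg : measurable_fun setT (fun z : measurableTypeR R * T => g z.1 (V z.2)).
  by rewrite /g; meas.
rewrite -(Ex_swap K P (M := 1) (f := fun k w2 => g k (V w2)) mg (fun _ _ => b1 _))//.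
have lg' : L1 K (fun k => Ex K (g' k)).
  by apply: (L1_Ex1 K K (M := 1)); [rewrite /g'; meas|move=> *; exact: b1].
have step2 : Ex K (fun k => Ex P (fun w2 => g k (V w2))) <= C' * Ex K (fun k => Ex K (g' k)).
  rewrite -ExZl//; apply: le_Ex; last first.
  - move=> k; rewrite /g /g'; case: (A < k <= x + 1) => /=; last first.
      by rewrite !Ex_cst mulr0.
    have := dom_section (z := z) x k mV C'0 domV zA.
    rewrite (eq_Ex P (g := fun w => ((A < V w <= x) && (x < k + V w))%R%:R)); last first.
      by move=> w; rewrite (addrC k).
    move=> /le_trans; apply; rewrite ler_wpM2l//; apply: le_Ex => [||k'].
    + by apply: L1_natb; meas.
    + by apply: L1_natb; meas.
    + by rewrite (addrC k).
  - exact: L1Zl.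
  - by apply: (L1_Ex1 K P (M := 1) (f := fun k w2 => g k (V w2)));
      [rewrite /g; meas|move=> *; exact: b1].
apply: le_trans step2 _; rewrite ler_wpM2l//.
pose q (u v : R) : R := [&& A < u <= x, A < v <= x & x < u + v]%R%:R.
pose r (u v : R) : R := ((x < u <= x + 1) && (A < v))%R%:R.
have lq : L1 K (fun k => Ex K (q k)).
  by apply: (L1_Ex1 K K (M := 1)); [rewrite /q; meas|move=> *; exact: b1].
have lr : L1 K (fun k => Ex K (r k)).
  by apply: (L1_Ex1 K K (M := 1)); [rewrite /r; meas|move=> *; exact: b1].
have lr' : L1 K (fun k => Ex K (fun k' => r k' k)).
  by apply: (L1_Ex1 K K (M := 1) (f := fun k k' => r k' k)); [rewrite /r; meas|move=> *; exact: b1].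
have rE k : Ex K (r k) = (x < k <= x + 1)%R%:R * tl K id A.
  rewrite -ExZl; last by apply: L1_natb; meas.
  apply: eq_Ex => k'; rewrite /r.
  by case: (x < k <= x + 1); case: (A < k'); rewrite ?mulr1 ?mulr0 ?mul0r.
have Er : Ex K (fun k => Ex K (r k)) = ic K id 1 x * tl K id A.
  rewrite (eq_Ex K rE) ExZr; last by apply: L1_natb; meas.
  by rewrite ic_itv.
have Er' : Ex K (fun k => Ex K (fun k' => r k' k)) = ic K id 1 x * tl K id A.
  have mr : measurable_fun setT (fun z : measurableTypeR R * measurableTypeR R => r z.2 z.1).
    by rewrite /r; meas.
  by rewrite -Er (Ex_swap K K (M := 1) (f := fun k k' => r k' k) mr (fun _ _ => b1 _)).
rewrite [X in _ <= X](_ : _ =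
    Ex K (fun k => Ex K (q k) + Ex K (r k) + Ex K (fun k' => r k' k))); last first.
  rewrite ExD//; last exact: L1D.
  by rewrite ExD// Er Er' -addrA -mulrA mulr_natl mulr2n.
apply: le_Ex => //; first by apply: L1D => //; exact: L1D.
move=> k.
have lk (h : R -> bool) : measurable_fun setT h -> L1 K (fun k => (h k)%:R).
  by move=> mh; apply: L1_natb.
rewrite -!ExD; do ?[by apply: lk; meas]; do ?[by apply: L1D; apply: lk; meas].
apply: le_Ex => [||k'].
- by apply: lk; meas.
- by apply: L1D; [apply: L1D; apply: lk; meas|apply: lk; meas].
rewrite /g' /q /r (leNgt k x) (leNgt k' x).
case: (x < k); case: (x < k'); case: (A < k); case: (A < k'); case: (k <= x + 1);
  case: (k' <= x + 1); case: (x < k + k');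
  by rewrite /= ?addr0 ?add0r ?lerDl ?lerDr ?addr_ge0 ?ler01.
Qed.

End domination.

Section sum_of_two.
Context (R : realType) (K : distr R) (I : Type).
Context d (T : measurableType d) (P : probability T R).

Notation p := (ic K id 1).

Lemma reg_ui_ge (U : I -> T -> R) : regular K P U -> forall e, 0 < e ->
  exists A0, forall A, A0 <= A -> forall i,
    Ex P (fun w => `|U i w| * (A < `|U i w|)%R%:R) <= e.
Proof.
move=> rU e e0; have [A0 hA] := reg_ui rU e0; exists A0 => A AA i.
apply: le_trans (hA i).
have mUi := reg_meas rU i.
apply: le_Ex.
- by apply: L1M_natb; [exact: L1_norm (reg_L1 rU i)|meas].
- by apply: L1M_natb; [exact: L1_norm (reg_L1 rU i)|meas].
- move=> w; rewrite ler_wpM2l// ler_nat.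
  by case: (ltP A `|U i w|) => // h; rewrite (le_lt_trans AA h).
Qed.

Hypothesis rK : reference K.
Variables U V : I -> T -> R.
Hypotheses (rU : regular K P U) (rV : regular K P V).
Hypothesis UV : forall i, indep P (U i) (V i).

Let S i w := U i w + V i w.

(** Expectation of the pointwise bound [excess_split]. The truncated parts produce the two products
    of a mean and an increment; the four terms on its right-hand side are negligible by [ref_sq],
    [dom_both] and [cross_part]. *)
Lemma tail_sum2 : usmall K (fun i x => tl P (S i) x - tl P (U i) x - tl P (V i) x
  - Ex P (V i) * ic P (U i) 1 x - Ex P (U i) * ic P (V i) 1 x).
Proof.
have mU := reg_meas rU; have mV := reg_meas rV.
have [cU cU0 hcU] := reg_big rU; have [cV cV0 hcV] := reg_big rV.
have [dU dU0 hdU] := reg_ic_le rK rU; have [dV dV0 hdV] := reg_ic_le rK rV.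
have [CU CU0 [zU domU]] := reg_dom rU; have [CV CV0 [zV domV]] := reg_dom rV.
move=> e e0.
have CC0 : 0 < CU * CV by exact: mulr_gt0.
(* [B] collects the coefficients of [D * p x]: one [CU * CV] for both variables above [x] and three
   for both above [A], [2 * dU] and [2 * dV] for a very negative variable, and [1 + cU], [1 + cV]
   for the two truncated parts. *)
pose B := 4 * (CU * CV) + 2 * dU + 2 * dV + cU + cV + 2.
have B0 : 0 < B by rewrite /B; lra.
pose D := e / B.
have D0 : 0 < D by rewrite divr_gt0.
have eB : e = D * B by rewrite /D divfK// gt_eqF.
have [AU hAU] := reg_ui_ge rU D0; have [AV hAV] := reg_ui_ge rV D0.
have [AQ hAQ] := ref_both rK D0.
have [At hAt] := @tl_cvg0 _ _ _ K id (@measurable_id _ _ _) _ D0.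
pose A := Num.max 1 (Num.max zU (Num.max zV (Num.max AU (Num.max AV (Num.max AQ At))))).
have [A1 [AzU [AzV [AAU [AAV [AAQ AAt]]]]]] : 1 <= A /\ zU <= A /\ zV <= A /\
    AU <= A /\ AV <= A /\ AQ <= A /\ At <= A.
  by rewrite /A; do ?split; rewrite !le_max lexx ?orbT.
have A0 : 0 < A by apply: lt_le_trans A1.
near=> x.
have p0 : 0 < p x by near: x; exact: ref_pos.
have Ax : A <= x by near: x; apply: nbhs_pinfty_ge; exact: num_real.
have xA : 2 * A < x by near: x; apply: nbhs_pinfty_gt; exact: num_real.
have hsq : tl K id x ^+ 2 <= D * p x by near: x; exact: ref_sq.
have hboth : Ex K (fun u => Ex K (fun v =>
   [&& A < u <= x, A < v <= x & x < u + v]%R%:R)) <= D * p x.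
  by near: x; exact: (hAQ A AAQ).
have hlinU' : forall i s, `|s| <= A -> `|ic P (U i) s x - s * ic P (U i) 1 x| <= D * p x.
  by near: x; apply: (reg_linN rK rU).
have hlinV' : forall i s, `|s| <= A -> `|ic P (V i) s x - s * ic P (V i) 1 x| <= D * p x.
  by near: x; apply: (reg_linN rK rV).
have bU' : forall i, ic P (U i) 1 x <= cU * p x by near: x.
have bV' : forall i, ic P (V i) 1 x <= cV * p x by near: x.
have icU' : forall i s, 0 <= s -> ic P (U i) s x <= dU * (s + 1) * p x by near: x.
have icV' : forall i s, 0 <= s -> ic P (V i) s x <= dV * (s + 1) * p x by near: x.
move=> i.
have hlinU := hlinU' i; have hlinV := hlinV' i.
have bU := bU' i; have bV := bV' i; have icU := icU' i; have icV := icV' i.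
have mUi := mU i; have mVi := mV i.
have lU := reg_L1 rU i; have lV := reg_L1 rV i.
have UVi := UV i; have VUi := indepC UVi.
have Dp0 : 0 <= D * p x by rewrite mulr_ge0 ?ltW.
have hgU := small_part mUi lV UVi Dp0 hlinU.
have hgV := small_part mVi lU VUi Dp0 hlinV.
set g1 := Ex P _ in hgU.
set g2 := Ex P _ in hgV.
have hUA := hAU A AAU i; have hVA := hAV A AAV i.
set uA := Ex P _ in hUA; set vA := Ex P _ in hVA.
rewrite -/vA in hgU; rewrite -/uA in hgV.
have uA0 : 0 <= uA by apply: Ex_ge0 => w; rewrite mulr_ge0.
have vA0 : 0 <= vA by apply: Ex_ge0 => w; rewrite mulr_ge0.
have hU0 : 0 <= ic P (U i) 1 x by apply: ic_ge0.
have hV0 : 0 <= ic P (V i) 1 x by apply: ic_ge0.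
have e3 : Ex P (fun w => ((U i w < - A) && (x < V i w <= x - U i w))%R%:R) <=
    2 * (dV * p x) * uA.
  apply: cross_part => //; first by rewrite mulr_ge0 ?ltW.
  by move=> s s0; rewrite mulrAC; exact: icV.
have e4 : Ex P (fun w => ((V i w < - A) && (x < U i w <= x - V i w))%R%:R) <=
    2 * (dU * p x) * vA.
  apply: cross_part => //; first by rewrite mulr_ge0 ?ltW.
  by move=> s s0; rewrite mulrAC; exact: icU.
have e2 := dom_both (K := K) (x := x) mUi mVi UVi (ltW CU0) (ltW CV0)
  (z := A) (A := A) _ _ (lexx A) _.
have {}e2 := e2 (fun s y As sy => (domU i).1 s y (le_trans AzU As) sy)
  (fun s y As sy => (domV i).1 s y (le_trans AzV As) sy) _.
have {}e2 : Ex P (fun w => [&& A < U i w <= x, A < V i w <= x & x < U i w + V i w]%R%:R) <=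
    CU * CV * (D * p x + 2 * p x * D).
  apply: le_trans (e2 Ax) _; rewrite ler_wpM2l ?(ltW CC0)//.
  apply: lerD; first exact: hboth.
  by rewrite ler_wpM2l ?mulr_ge0 ?(ltW p0)// hAt.
have e1 : Ex P (fun w => ((x < U i w) && (x < V i w))%R%:R) <= CU * CV * (D * p x).
  have -> : Ex P (fun w => ((x < U i w) && (x < V i w))%R%:R) = tl P (U i) x * tl P (V i) x.
    pose f (u v : R) : R := ((x < u) && (x < v))%R%:R.
    rewrite (indep_bounded (M := 1) (f := f) mUi mVi UVi); last 2 first.
    - by rewrite /f; meas.
    - by move=> u v; rewrite /f; case: (_ && _); rewrite ?normr1 ?normr0.
    rewrite /tl -ExZl; last by apply: L1_natb; meas.
    apply: eq_Ex => w2; rewrite mulrC -ExZl; last by apply: L1_natb; meas.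
    apply: eq_Ex => w1; rewrite /f.
    by case: (x < U i w1)%R; case: (x < V i w2)%R; rewrite ?mulr1 ?mulr0.
  apply: (@le_trans _ _ (CU * tl K id x * (CV * tl K id x))).
    apply: ler_pM; rewrite ?tl_ge0//.
      by apply: (domU i).2; exact: le_trans AzU Ax.
    by apply: (domV i).2; exact: le_trans AzV Ax.
  by rewrite mulrACA -expr2 ler_pM2l.
have l (b : T -> bool) : measurable_fun setT b -> L1 P (fun w => (b w)%:R).
  exact: L1_natb.
pose f w : R := (x < U i w + V i w)%R%:R - (x < U i w)%R%:R - (x < V i w)%R%:R.
pose G1 w : R := (- A <= V i w <= A)%R%:R * ((x < U i w + V i w)%R%:R - (x < U i w)%R%:R).
pose G2 w : R := (- A <= U i w <= A)%R%:R * ((x < V i w + U i w)%R%:R - (x < V i w)%R%:R).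
have lf : L1 P f by apply: L1B; [apply: L1B|]; apply: l; meas.
have lG1 : L1 P G1.
  by apply: (@L1_bounded _ _ _ _ _ 1); [rewrite /G1; meas|move=> w; exact: natb_diff_le1].
have lG2 : L1 P G2.
  by apply: (@L1_bounded _ _ _ _ _ 1); [rewrite /G2; meas|move=> w; exact: natb_diff_le1].
have Ef : Ex P f = tl P (S i) x - tl P (U i) x - tl P (V i) x.
  rewrite ExB; [|by apply: L1B; apply: l; meas|by apply: l; meas].
  by rewrite ExB//; apply: l; meas.
have key : `|Ex P f - g1 - g2| <= CU * CV * (D * p x) + CU * CV * (D * p x + 2 * p x * D)
    + 2 * (dV * p x) * uA + 2 * (dU * p x) * vA.
  have -> : Ex P f - g1 - g2 = Ex P (fun w => f w - G1 w - G2 w).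
    by rewrite ExB//; [rewrite ExB|exact: L1B].
  apply: le_trans (normr_Ex _) _; first by apply: L1B => //; exact: L1B.
  apply: le_trans (lerD (lerD (lerD e1 e2) e3) e4).
  rewrite -!ExD; do ?[by apply: l; meas]; do ?[by apply: L1D; apply: l; meas];
    do ?[by apply: L1D; [apply: L1D|]; apply: l; meas].
  apply: le_Ex => [||w].
  - by apply: L1_norm; apply: L1B => //; exact: L1B.
  - by apply: L1D; [apply: L1D; [apply: L1D|]|]; apply: l; meas.
  by have := excess_split (U i w) (V i w) A0 xA; rewrite /f /G1 /G2 (addrC (V i w)).
rewrite -Ef.
have -> : Ex P f - Ex P (V i) * ic P (U i) 1 x - Ex P (U i) * ic P (V i) 1 x =
  (Ex P f - g1 - g2) + (g1 - ic P (U i) 1 x * Ex P (V i)) +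
  (g2 - ic P (V i) 1 x * Ex P (U i)) by ring.
apply: le_trans (ler_normD _ _) _; apply: le_trans (lerD (ler_normD _ _) (lexx _)) _.
have k1 : ic P (U i) 1 x * vA <= cU * p x * D by apply: ler_pM.
have k2 : ic P (V i) 1 x * uA <= cV * p x * D by apply: ler_pM.
have k3 : 2 * (dV * p x) * uA <= 2 * (dV * p x) * D.
  by rewrite ler_wpM2l// !mulr_ge0 ?ltW.
have k4 : 2 * (dU * p x) * vA <= 2 * (dU * p x) * D.
  by rewrite ler_wpM2l// !mulr_ge0 ?ltW.
rewrite eB /B; lra.
Unshelve. all: by end_near. Qed.

(** Subtract [tail_sum2] at [x + s] from [tail_sum2] at [x]. The products of a mean and an increment
    cancel up to a negligible error because unit increments hardly change under a bounded shift; so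
    increments are additive to first order. *)
Lemma incr_sum2 t e : 0 < e -> \forall x \near +oo, forall i s, 0 <= s <= t ->
  `|ic P (S i) s x - ic P (U i) s x - ic P (V i) s x| <= e * p x.
Proof.
move=> e0.
have [mV hmV] := reg_Ex_bound rV; have [mU hmU] := reg_Ex_bound rU.
pose M := `|mU| + `|mV|.
have M0 : 0 <= M by rewrite addr_ge0.
pose D := e / (3 + 2 * M).
have B0 : 0 < 3 + 2 * M by lra.
have D0 : 0 < D by rewrite divr_gt0.
have eB : e = D * (3 + 2 * M) by rewrite /D divfK// gt_eqF.
have [t0|t0] := ltP t 0.
  by apply: nearW => x i s; lra.
have /nearyP[M0' hM0] := tail_sum2 D0.
have D2 : 0 < D / 2 by rewrite divr_gt0.
near=> x.
have p0 : 0 < p x by near: x; exact: ref_pos.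
have hE : forall y, `|y| <= t -> forall i, `|tl P (S i) (x + y) - tl P (U i) (x + y)
   - tl P (V i) (x + y) - Ex P (V i) * ic P (U i) 1 (x + y)
   - Ex P (U i) * ic P (V i) 1 (x + y)| <= D * p (x + y).
  have xM : M0' + t <= x by near: x; apply: nbhs_pinfty_ge; exact: num_real.
  by move=> y; rewrite ler_norml => /andP[ty _] i; apply: hM0; lra.
have hp' : forall s, `|s| <= t -> `|p (x + s) - p x| <= 1 * p x.
  by near: x; exact: (ref_shift rK t ltr01).
have lU : forall i s, 0 <= s <= t + 1 -> `|ic P (U i) s x - s * ic P (U i) 1 x| <= D / 2 * p x.
  by near: x; exact: (reg_lin rU (t + 1) D2).
have lV : forall i s, 0 <= s <= t + 1 -> `|ic P (V i) s x - s * ic P (V i) 1 x| <= D / 2 * p x.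
  by near: x; exact: (reg_lin rV (t + 1) D2).
move=> i s st.
have hp : `|p (x + s) - p x| <= 1 * p x.
  by apply: hp'; rewrite ger0_norm; lra.
(* The window of length [s + 1] at [x] is the one of length [s] followed by a unit window at
   [x + s]; linearity at both lengths compares the two unit windows. *)
have d1 (W : T -> R) : (forall s, 0 <= s <= t + 1 ->
    `|ic P W s x - s * ic P W 1 x| <= D / 2 * p x) ->
    `|ic P W 1 x - ic P W 1 (x + s)| <= D * p x.
  move=> h; have := h s _; have := h (s + 1) _; rewrite ic_add.
  have -> : 0 <= s <= t + 1 by lra.
  have -> : 0 <= s + 1 <= t + 1 by lra.
  by move=> /(_ isT) + /(_ isT); rewrite !ler_norml; lra.
have := hE s _ i; rewrite ger0_norm; last by lra.
have -> : s <= t by lra.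
move=> /(_ isT) h1.
have := hE 0 _ i; rewrite normr0 addr0 t0 => /(_ isT) h2.
set E1 := (X in `|X| <= _) in h1; set E2 := (X in `|X| <= _) in h2.
have -> : ic P (S i) s x - ic P (U i) s x - ic P (V i) s x =
  (E2 - E1) + (Ex P (V i) * (ic P (U i) 1 x - ic P (U i) 1 (x + s))
    + Ex P (U i) * (ic P (V i) 1 x - ic P (V i) 1 (x + s))).
  by rewrite /E1 /E2 /ic; lra.
have k1 := ler_pM (normr_ge0 _) (normr_ge0 _) (le_trans (hmV i) (ler_norm _)) (d1 _ (lU i)).
have k2 := ler_pM (normr_ge0 _) (normr_ge0 _) (le_trans (hmU i) (ler_norm _)) (d1 _ (lV i)).
apply: le_trans (ler_normD _ _) _.
apply: le_trans (lerD (ler_normB _ _) (ler_normD _ _)) _.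
rewrite !normrM eB /M.
have k3 : D * p (x + s) <= D * (2 * p x).
  by rewrite ler_pM2l//; move: hp; rewrite ler_norml; lra.
have : 0 <= (`|mU| + `|mV|) * (D * p x).
  by apply: mulr_ge0; [exact: M0|rewrite mulr_ge0 ?ltW].
lra.
Unshelve. all: by end_near. Qed.

Lemma regular_sum2 : regular K P S.
Proof.
have mU := reg_meas rU; have mV := reg_meas rV.
split.
- by move=> i; have mUi := mU i; have mVi := mV i; rewrite /S; meas.
- by move=> i; apply: L1D; [exact: reg_L1 rU i|exact: reg_L1 rV i].
- move=> e e0; have e4 : 0 < e / 4 by lra.
  have [AU hAU] := reg_ui_ge rU e4; have [AV hAV] := reg_ui_ge rV e4.
  pose A := Num.max AU AV; exists (2 * A) => i.
  have mUi := mU i; have mVi := mV i.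
  have lt (W : T -> R) : L1 P W -> L1 P (fun w => `|W w| * (A < `|W w|)%R%:R).
    move=> lW; have mW := L1_measurable lW.
    by apply: L1M_natb; [exact: L1_norm|meas].
  have hU : Ex P (fun w => `|U i w| * (A < `|U i w|)%R%:R) <= e / 4.
    by apply: hAU; rewrite le_max lexx.
  have hV : Ex P (fun w => `|V i w| * (A < `|V i w|)%R%:R) <= e / 4.
    by apply: hAV; rewrite le_max lexx orbT.
  have lU := lt _ (reg_L1 rU i); have lV := lt _ (reg_L1 rV i).
  (* If [|U + V| > 2 * A], the larger of [|U|] and [|V|] exceeds [A], and [|U + V|] is at most twice
     that one. *)
  apply: (@le_trans _ _ (Ex P (fun w => 2 * (`|U i w| * (A < `|U i w|)%R%:R) +
      2 * (`|V i w| * (A < `|V i w|)%R%:R)))); last first.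
    by rewrite ExD ?ExZl//; [lra|exact: L1Zl|exact: L1Zl].
  apply: le_Ex.
  + apply: L1M_natb; last by rewrite /S; meas.
    by apply: L1_norm; apply: L1D; [exact: reg_L1 rU i|exact: reg_L1 rV i].
  + by apply: L1D; exact: L1Zl.
  + move=> w; have := ler_normD (U i w) (V i w); rewrite -/(S i w).
    have := normr_ge0 (U i w); have := normr_ge0 (V i w).
    case: (ltP (2 * A) `|S i w|) => h; case: (ltP A `|U i w|) => h1;
      case: (ltP A `|V i w|) => h2; rewrite ?mulr1 ?mulr0; lra.
- have [cU cU0 hcU] := reg_big rU; have [cV cV0 hcV] := reg_big rV.
  exists (cU + cV + 1); first by lra.
  near=> x.
  have p0 : 0 < p x by near: x; exact: ref_pos.
  have hU : forall i, ic P (U i) 1 x <= cU * p x by near: x.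
  have hV : forall i, ic P (V i) 1 x <= cV * p x by near: x.
  have : forall i s, 0 <= s <= 1 ->
     `|ic P (S i) s x - ic P (U i) s x - ic P (V i) s x| <= 1 * p x.
    by near: x; exact: (incr_sum2 1 ltr01).
  move=> + i => /(_ i 1); rewrite lexx ler01 => /(_ isT).
  by have := hU i; have := hV i; rewrite ler_norml; lra.
- move=> t e e0; have [t0|t0] := ltP t 0; first by apply: nearW => x i s; lra.
  (* The errors are: one from additivity over the window [s], at most [t] from additivity over the
     unit window multiplied by [s], and one each from the linearity of [U] and [V]. *)
  pose D := e / (3 + t); have B0 : 0 < 3 + t by lra.
  have D0 : 0 < D by rewrite divr_gt0.
  have eB : e = D * (3 + t) by rewrite /D divfK// gt_eqF.
  near=> x.
  have p0 : 0 < p x by near: x; exact: ref_pos.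
  have H : forall i s, 0 <= s <= t + 1 ->
     `|ic P (S i) s x - ic P (U i) s x - ic P (V i) s x| <= D * p x.
    by near: x; exact: (incr_sum2 (t + 1) D0).
  have hU' : forall i s, 0 <= s <= t -> `|ic P (U i) s x - s * ic P (U i) 1 x| <= D * p x.
    by near: x; exact: (reg_lin rU t D0).
  have hV' : forall i s, 0 <= s <= t -> `|ic P (V i) s x - s * ic P (V i) 1 x| <= D * p x.
    by near: x; exact: (reg_lin rV t D0).
  move=> i s st; have hU := hU' i s st; have hV := hV' i s st.
  have := H i s _; have := H i 1 _.
  have -> : 0 <= s <= t + 1 by lra.
  have -> : (0 : R) <= 1 <= t + 1 by lra.
  move=> /(_ isT) h1 /(_ isT) h2.
  have -> : ic P (S i) s x - s * ic P (S i) 1 x =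
     (ic P (S i) s x - ic P (U i) s x - ic P (V i) s x)
     - s * (ic P (S i) 1 x - ic P (U i) 1 x - ic P (V i) 1 x)
     + (ic P (U i) s x - s * ic P (U i) 1 x) + (ic P (V i) s x - s * ic P (V i) 1 x) by lra.
  apply: le_trans (ler_normD _ _) _; apply: le_trans (lerD (ler_normD _ _) (lexx _)) _.
  apply: le_trans (lerD (lerD (ler_normB _ _) (lexx _)) (lexx _)) _.
  have k : `|s * (ic P (S i) 1 x - ic P (U i) 1 x - ic P (V i) 1 x)| <= t * (D * p x).
    by rewrite normrM ler_pM// ger0_norm; lra.
  rewrite eB; lra.
Unshelve. all: by end_near. Qed.

End sum_of_two.

(** * Reference laws from the class S_2 *)

Lemma L1_tail d (T : measurableType d) (R : realType) (P : probability T R)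
    (U : T -> R) : L1 P U -> forall e, 0 < e -> exists A0, forall A, A0 <= A ->
    Ex P (fun w => `|U w| * (A < `|U w|)%R%:R) <= e.
Proof.
move=> lU e e0; have mU := L1_measurable lU.
pose f (n : nat) w : R := `|U w| * (n%:R < `|U w|)%R%:R.
have mf n : measurable_fun setT (f n) by rewrite /f; meas.
have fU n w : `|f n w| <= `|U w|.
  by rewrite /f normrM normr_id; case: (_ < _)%R; rewrite ?normr1 ?normr0 ?mulr1 ?mulr0.
have lf n : L1 P (f n) by apply: L1_le (mf n) (fU n) (L1_norm lU).
have : (fun n => Ex P (f n)) @ \oo --> (0 : R).
  have := @dominated_cvg _ T R P setT measurableT (fun n => EFin \o f n) (cst 0%E)
    (EFin \o (fun w => `|U w|)) _ _ _ (L1_norm lU) _.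
  rewrite integral_cst// mul0e => H.
  apply/fine_cvg; apply: H => [n|w _|//|n w _].
  - exact/measurable_EFinP.
  - apply: cvg_near_cst; near=> n; rewrite /f /= ltNge.
    rewrite (_ : `|U w| <= n%:R) ?mulr0//.
    by near: n; exact: nbhs_infty_ger.
  - by rewrite /= lee_fin; exact: fU.
move=> /cvgrPdist_le /(_ _ e0) [N _ hN]; exists N%:R => A NA.
have := hN N (leqnn N); rewrite /= sub0r normrN => h.
apply: le_trans (le_trans (ler_norm _) h); apply: le_Ex => //.
- by apply: L1M_natb; [exact: L1_norm|meas].
- move=> w; rewrite /f ler_wpM2l// ler_nat.
  by case: (ltP A `|U w|) => // h'; rewrite (le_lt_trans NA h').
Unshelve. all: by end_near. Qed.

Section distribution_functions.
Context (R : realType).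
Implicit Types F : distr R.

Lemma tail_tl F x : tail F x = tl F id x.
Proof.
rewrite /tail /tl Ex_indic; last by meas.
have -> : [set w : R | x < w] = setT `\` `]-oo, x].
  by apply/seteqP; split=> w; rewrite /= in_itv /= ltNge; [move/negP; split|case=> _ /negP].
rewrite Pr_D ?PrT//; exact: measurable_itv.
Qed.

Lemma df_tl F x : df F x = 1 - tl F id x.
Proof. by rewrite -tail_tl /tail; lra. Qed.

Lemma incr_ic F t x : incr F t x = ic F id t x.
Proof. by rewrite /incr !df_tl /ic; lra. Qed.

Lemma tl_pos_part F x : 0 <= x -> tl (pos_part F) id x = tl F id x.
Proof. by move=> x0; rewrite -!tail_tl /tail df_pos_part x0 mulr1. Qed.

Lemma ic_pos_part F s x : 0 <= x -> 0 <= s -> ic (pos_part F) id s x = ic F id s x.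
Proof. by move=> x0 s0; rewrite /ic !tl_pos_part// addr_ge0. Qed.

(** With the conventions of the class [L_Delta], a vanishing increment would make the
    quotient 0, hence at distance 1 from 1. *)
Lemma L_Delta_near F : L_Delta F -> forall (n : nat) t e, 0 < t -> 0 < e ->
  \forall x \near +oo, forall y, 0 <= y <= n%:R ->
    0 < ic F id t x /\ `|ic F id t (x + y) - ic F id t x| <= e * ic F id t x.
Proof.
move=> LF; have mid : measurable_fun setT (@id R) by exact: measurable_id.
have L1 t e : 0 < t -> 0 < e -> \forall x \near +oo, forall y, 0 <= y <= 1 ->
    0 < ic F id t x /\ `|ic F id t (x + y) - ic F id t x| <= e * ic F id t x.
  move=> t0 e0.
  have e20 : 0 < Num.min e (1 / 2) by rewrite lt_min e0 divr_gt0.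
  apply: filterS (LF t t0 _ e20) => x H y y01.
  have := H y; rewrite in_itv /= y01 => /(_ isT); rewrite !incr_ic.
  have q0 : 0 <= ic F id t x by apply: ic_ge0 => //; exact: ltW.
  move: q0; rewrite le_eqVlt => /orP[/eqP <-|q0].
    rewrite invr0 mulr0 sub0r normrN normr1 le_min => /andP[_]; lra.
  move=> h; split => //.
  have -> : ic F id t (x + y) - ic F id t x =
    (ic F id t (x + y) / ic F id t x - 1) * ic F id t x.
    by rewrite mulrBl mul1r divfK// gt_eqF.
  rewrite normrM (gtr0_norm q0) ler_pM2r// (le_trans h)// ge_min lexx//.
elim=> [|n IH] t e t0 e0.
  apply: filterS (L1 t e t0 e0) => x H y y0; apply: H; lra.
(* [D <= 1] makes the increment at [x + n] at most twice the one at [x], so the two steps add up to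
   an error of at most [3 * D]. *)
pose D := Num.min (e / 3) 1.
have D0 : 0 < D by rewrite lt_min ltr01 andbT divr_gt0.
have D1 : D <= 1 by rewrite ge_min lexx orbT.
have De : D <= e / 3 by rewrite ge_min lexx.
have /nearyP[M hM] := L1 t D t0 D0.
near=> x => y y01.
have xM : M <= x by near: x; apply: nbhs_pinfty_ge; exact: num_real.
have h : forall y, 0 <= y <= n%:R ->
    0 < ic F id t x /\ `|ic F id t (x + y) - ic F id t x| <= D * ic F id t x.
  by near: x; exact: (IH t D t0 D0).
have n0 : 0 <= n%:R :> R by [].
have [|q0 _] := h 0; first by rewrite lexx.
split => //; have [yn|ny] := leP y n%:R.
  have [|_ h1] := h y; first by move: y01 => /andP[-> _].
  apply: le_trans h1 _; rewrite ler_pM2r//; lra.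
have [|_ h1] := h n%:R; first by rewrite n0 lexx.
have xn : M <= x + n%:R by rewrite (le_trans xM)// lerDl.
have [|qn h2] := hM (x + n%:R) xn (y - n%:R).
  by move: y01; rewrite -natr1; lra.
have -> : ic F id t (x + y) - ic F id t x =
  (ic F id t (x + n%:R + (y - n%:R)) - ic F id t (x + n%:R))
  + (ic F id t (x + n%:R) - ic F id t x).
  by rewrite (_ : x + n%:R + (y - n%:R) = x + y); lra.
apply: le_trans (ler_normD _ _) _; apply: le_trans (lerD h2 h1) _.
set q := ic F id t x in q0 h1 *; set qn' := ic F id t (x + n%:R) in h1 *.
have h3 : qn' <= 2 * q.
  have : D * q <= 1 * q by rewrite ler_pM2r.
  by move: h1; rewrite ler_norml; lra.
have : D * qn' <= D * (2 * q) by rewrite ler_pM2l.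
have : D * q <= e / 3 * q by rewrite ler_pM2r.
lra.
Unshelve. all: by end_near. Qed.

(** Cut into windows of length 1 / N. By [L_Delta_near] each has mass close to the first one, [q],
    so a window of length m / N has mass close to [m * q] and the unit window close to [N * q]. Any
    other [s] is enclosed between two neighbouring multiples of 1 / N by monotonicity. *)
Lemma L_Delta_lin F : L_Delta F -> forall t e, 0 < e ->
  \forall x \near +oo, forall s, 0 <= s <= t ->
    `|ic F id s x - s * ic F id 1 x| <= e * ic F id 1 x.
Proof.
move=> LF t e e0; have mid : measurable_fun setT (@id R) by exact: measurable_id.
have [t0|t0] := ltP t 0; first by apply: nearW => x s; lra.
pose N := (Num.truncn (2 / e)).+1.
have Ne : 2 / e < N%:R by exact: truncnS_gt.
have N0 : 0 < N%:R :> R by rewrite ltr0n.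
have N1 : N%:R^-1 <= e / 2.
  by rewrite invf_ple ?posrE ?divr_gt0// invf_div ltW.
(* Rounding [s] to the grid costs 1 / N, at most [e / 2]. The deviations of the small windows cost
   at most [4 * D * (t + 1)], since [N * q <= 2 * p] as soon as [D <= 1 / 2]; this is the other half
   of [e]. *)
pose D := Num.min (1 / 2) (e / (8 * (t + 1))).
have T0 : 0 < 8 * (t + 1) by lra.
have D0 : 0 < D by rewrite lt_min !divr_gt0.
have D2 : D <= 1 / 2 by rewrite ge_min lexx.
have De : D * (8 * (t + 1)) <= e.
  by rewrite -ler_pdivlMr// ge_min lexx orbT.
pose n := (Num.truncn (t + 1)).+1.
have tn : t + 1 < n%:R by exact: truncnS_gt.
have Ni0 : 0 < N%:R^-1 :> R by rewrite invr_gt0.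
near=> x.
have H : forall y, 0 <= y <= n%:R -> 0 < ic F id N%:R^-1 x /\
    `|ic F id N%:R^-1 (x + y) - ic F id N%:R^-1 x| <= D * ic F id N%:R^-1 x.
  by near: x; exact: (L_Delta_near LF n Ni0 D0).
set q := ic F id N%:R^-1 x in H *.
have [|q0 _] := H 0; first by rewrite lexx /=.
have K m : m%:R / N%:R <= t + 1 ->
    `|ic F id (m%:R / N%:R) x - m%:R * q| <= m%:R * (D * q).
  elim: m => [|m IH] mt; first by rewrite !mul0r /ic addr0 !subrr normr0.
  have mt' : m%:R / N%:R <= t + 1.
    by apply: le_trans mt; rewrite ler_pM2r// ler_nat.
  have [|_ h] := H (m%:R / N%:R).
    by rewrite divr_ge0//= (le_trans mt')// ltW.
  rewrite -natr1 mulrDl mul1r ic_add.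
  have -> : ic F id (m%:R / N%:R) x + ic F id N%:R^-1 (x + m%:R / N%:R) - (m%:R + 1) * q =
    (ic F id (m%:R / N%:R) x - m%:R * q) + (ic F id N%:R^-1 (x + m%:R / N%:R) - q) by lra.
  apply: le_trans (ler_normD _ _) _; apply: le_trans (lerD (IH mt') h) _; lra.
have hp : `|ic F id 1 x - N%:R * q| <= N%:R * (D * q).
  have := K N; rewrite divff ?gt_eqF// => H'; apply: H'; lra.
set p := ic F id 1 x in hp *.
have Nq : N%:R * q <= 2 * p.
  have : D * (N%:R * q) <= 1 / 2 * (N%:R * q) by rewrite ler_pM2r// mulr_gt0.
  by move: hp; rewrite ler_norml; lra.
have p0 : 0 < p.
  have : 0 < N%:R * q by rewrite mulr_gt0.
  lra.
have G m : m%:R / N%:R <= t + 1 ->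
    `|ic F id (m%:R / N%:R) x - m%:R / N%:R * p| <= e / 2 * p.
  move=> mt; have m0 : 0 <= m%:R / N%:R :> R by rewrite divr_ge0.
  have -> : ic F id (m%:R / N%:R) x - m%:R / N%:R * p =
    (ic F id (m%:R / N%:R) x - m%:R * q) - m%:R / N%:R * (p - N%:R * q).
    have a1 : m%:R / N%:R * (N%:R * q) = m%:R * q by rewrite mulrA divfK// gt_eqF.
    by rewrite (mulrBr (m%:R / N%:R) p) a1; lra.
  apply: le_trans (ler_normB _ _) _; rewrite normrM (ger0_norm m0).
  have k1 : m%:R / N%:R * `|p - N%:R * q| <= m%:R / N%:R * (N%:R * (D * q)).
    by rewrite ler_wpM2l.
  have k2 := K m mt.
  have k3 : m%:R * (D * q) = m%:R / N%:R * (N%:R * (D * q)).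
    by rewrite [RHS]mulrA divfK// gt_eqF.
  apply: le_trans (lerD k2 k1) _; rewrite k3 -mulrDl.
  have k4 : m%:R / N%:R * (N%:R * (D * q)) <= (t + 1) * (D * (2 * p)).
    apply: ler_pM => //; first by rewrite mulr_ge0// mulr_ge0 ?ltW.
    by rewrite mulrCA ler_pM2l.
  have k5 : D * (8 * (t + 1)) * p <= e * p by rewrite ler_pM2r.
  lra.
move=> s st.
have s0 : 0 <= s * N%:R by move: st => /andP[s0 _]; rewrite mulr_ge0.
pose m := Num.truncn (s * N%:R).
have m1 : m%:R / N%:R <= s.
  by rewrite ler_pdivrMr//; have := truncn_le (s * N%:R); rewrite s0.
have m2 : s <= m.+1%:R / N%:R.
  by rewrite ler_pdivlMr// ltW//; exact: truncnS_gt.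
have mm : m.+1%:R / N%:R = m%:R / N%:R + N%:R^-1 :> R.
  by rewrite -natr1 mulrDl mul1r.
have N11 : N%:R^-1 <= 1 :> R by rewrite invf_le1// ler1n.
have g1 : m%:R / N%:R <= t + 1 by lra.
have g2 : m.+1%:R / N%:R <= t + 1 by rewrite mm; lra.
have := G m g1; have := G m.+1 g2.
have i1 := ic_mono F mid x m1; have i2 := ic_mono F mid x m2.
have k1 : (s - m%:R / N%:R) * p <= e / 2 * p by rewrite ler_pM2r//; lra.
have k2 : (m.+1%:R / N%:R - s) * p <= e / 2 * p by rewrite ler_pM2r//; lra.
rewrite !ler_norml; lra.
Unshelve. all: by end_near. Qed.

End distribution_functions.

Section product_coordinates.
Context d1 d2 (T1 : measurableType d1) (T2 : measurableType d2) (R : realType).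
Variables (P1 : probability T1 R) (P2 : probability T2 R).

Lemma indep_prod d3 d4 (E1 : measurableType d3) (E2 : measurableType d4)
    (U : T1 -> E1) (V : T2 -> E2) :
  measurable_fun setT U -> measurable_fun setT V ->
  indep (prodP P1 P2) (fun w => U w.1) (fun w => V w.2).
Proof.
move=> mU mV A B mA mB.
have mUA : measurable (U @^-1` A) by rewrite -[X in measurable X]setTI; exact: mU.
have mVB : measurable (V @^-1` B) by rewrite -[X in measurable X]setTI; exact: mV.
have -> : (fun w : T1 * T2 => U w.1) @^-1` A `&` (fun w => V w.2) @^-1` B =
  (U @^-1` A) `*` (V @^-1` B) by [].
have -> : (fun w : T1 * T2 => U w.1) @^-1` A = (U @^-1` A) `*` setT.
  by apply/seteqP; split=> w //= [].
have -> : (fun w : T1 * T2 => V w.2) @^-1` B = setT `*` (V @^-1` B).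
  by apply/seteqP; split=> w //= [].
have PrX C D : measurable C -> measurable D ->
    Pr (prodP P1 P2) (C `*` D) = Pr P1 C * Pr P2 D.
  by move=> mC mD; rewrite /Pr /= product_measure1E// fineM// fin_num_measure.
by rewrite !PrX// !PrT mulr1 mul1r.
Qed.

Lemma tl_prod_fst (U : T1 -> R) x : measurable_fun setT U ->
  tl (prodP P1 P2) (fun w => U w.1) x = tl P1 U x.
Proof.
move=> mU; rewrite /tl -(Ex_prod_fst P2 (f := fun w => (x < U w)%R%:R))//.
by apply: L1_natb; meas.
Qed.

Lemma tl_prod_snd (V : T2 -> R) x : measurable_fun setT V ->
  tl (prodP P1 P2) (fun w => V w.2) x = tl P2 V x.
Proof.
move=> mV; rewrite /tl -(Ex_prod_snd P1 (f := fun w => (x < V w)%R%:R))//.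
by apply: L1_natb; meas.
Qed.

End product_coordinates.

(** A converse of [excess_split]: the event that both variables are large is bounded by the excess
    minus its truncated parts. If a variable is negative, the excess and the truncated parts
    contribute at least -3 and the left-hand side is at most 1, hence the coefficient 4; these terms
    vanish for a law on the half-line. *)
Lemma excess_split_ge0 (R : realType) (A x u v : R) : 0 < A -> 2 * A < x ->
  [&& A < u <= x, A < v <= x & x < u + v]%R%:R <=
    ((x < u + v)%R%:R - (x < u)%R%:R - (x < v)%R%:R)
     - (- A <= v <= A)%R%:R * ((x < u + v)%R%:R - (x < u)%R%:R)
     - (- A <= u <= A)%R%:R * ((x < v + u)%R%:R - (x < v)%R%:R)
     + ((x < u) && (x < v))%R%:R + 4 * (u < 0)%R%:R + 4 * (v < 0)%R%:R :> R.
Proof.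
move=> A0 Ax.
rewrite (addrC v u) (ltNge A u) (ltNge A v) (leNgt u x) (leNgt v x).
case: (ltP x (u + v)) => h1; case: (ltP x u) => h2; case: (ltP x v) => h3;
case: (leP u A) => h4; case: (leP v A) => h5;
case: (leP (- A) u) => h6; case: (leP (- A) v) => h7;
case: (ltP u 0) => h8; case: (ltP v 0) => h9 /=;
  first [solve [clear; lra] | exfalso; lra].
Qed.

Lemma both_bound d (T : measurableType d) (R : realType) (Q : probability T R)
    (U V : T -> R) (A x D : R) :
  L1 Q U -> L1 Q V -> indep Q U V -> 0 < A -> 2 * A < x -> 0 <= D ->
  (forall s, `|s| <= A -> `|ic Q U s x - s * ic Q U 1 x| <= D) ->
  (forall s, `|s| <= A -> `|ic Q V s x - s * ic Q V 1 x| <= D) ->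
  Ex Q (fun w => [&& A < U w <= x, A < V w <= x & x < U w + V w]%R%:R) <=
  (tl Q (fun w => U w + V w) x - tl Q U x - tl Q V x)
  - ic Q U 1 x * Ex Q V - ic Q V 1 x * Ex Q U + 2 * D
  + ic Q U 1 x * Ex Q (fun w => `|V w| * (A < `|V w|)%R%:R)
  + ic Q V 1 x * Ex Q (fun w => `|U w| * (A < `|U w|)%R%:R)
  + tl Q U x * tl Q V x + 4 * Ex Q (fun w => (U w < 0)%R%:R)
  + 4 * Ex Q (fun w => (V w < 0)%R%:R).
Proof.
move=> lU lV UV A0 xA D0 hU hV.
have mU := L1_measurable lU; have mV := L1_measurable lV.
have := small_part mU lV UV D0 hU; have := small_part mV lU (indepC UV) D0 hV.
set uA := Ex Q (fun w => `|U w| * _); set vA := Ex Q (fun w => `|V w| * _).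
pose g1 w : R := (- A <= V w <= A)%R%:R * ((x < U w + V w)%R%:R - (x < U w)%R%:R).
pose g2 w : R := (- A <= U w <= A)%R%:R * ((x < V w + U w)%R%:R - (x < V w)%R%:R).
rewrite -/(Ex Q g1) -/(Ex Q g2) => s2 s1.
have l (b : T -> bool) : measurable_fun setT b -> L1 Q (fun w => (b w)%:R).
  exact: L1_natb.
pose f w : R := (x < U w + V w)%R%:R - (x < U w)%R%:R - (x < V w)%R%:R.
have lf : L1 Q f by apply: L1B; [apply: L1B|]; apply: l; meas.
have lg1 : L1 Q g1.
  by apply: (@L1_bounded _ _ _ _ _ 1); [rewrite /g1; meas|move=> w; exact: natb_diff_le1].
have lg2 : L1 Q g2.
  by apply: (@L1_bounded _ _ _ _ _ 1); [rewrite /g2; meas|move=> w; exact: natb_diff_le1].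
have Ef : Ex Q f = tl Q (fun w => U w + V w) x - tl Q U x - tl Q V x.
  rewrite ExB; [|by apply: L1B; apply: l; meas|by apply: l; meas].
  by rewrite ExB//; apply: l; meas.
have lb : L1 Q (fun w => ((x < U w) && (x < V w))%R%:R) by apply: l; meas.
have Eb : Ex Q (fun w => ((x < U w) && (x < V w))%R%:R) = tl Q U x * tl Q V x.
  rewrite Ex_indic; last by meas.
  have pre (h : T -> R) : h @^-1` `]x, +oo[ = [set w | (x < h w)%R].
    by apply/seteqP; split=> w; rewrite /= in_itv/= andbT.
  have -> : [set w | (x < U w)%R && (x < V w)%R] =
      U @^-1` `]x, +oo[ `&` V @^-1` `]x, +oo[.
    by rewrite !pre; apply/seteqP; split=> w /= => [/andP[]|[-> ->]].
  rewrite (UV _ _ (measurable_itv `]x, +oo[) (measurable_itv `]x, +oo[)) !pre.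
  by rewrite /tl !Ex_indic//; meas.
have ln1 : L1 Q (fun w => (U w < 0)%R%:R) by apply: l; meas.
have ln2 : L1 Q (fun w => (V w < 0)%R%:R) by apply: l; meas.
have key : Ex Q (fun w => [&& A < U w <= x, A < V w <= x & x < U w + V w]%R%:R) <=
    (* Here the truncated parts are subtracted, so only their lower bounds from [small_part] are
       used in the end. *)
    Ex Q f - Ex Q g1 - Ex Q g2 + tl Q U x * tl Q V x
    + 4 * Ex Q (fun w => (U w < 0)%R%:R) + 4 * Ex Q (fun w => (V w < 0)%R%:R).
  have lA1 : L1 Q (fun w => f w - g1 w) by exact: L1B.
  have lA2 : L1 Q (fun w => f w - g1 w - g2 w) by exact: L1B.
  have lA3 := L1D lA2 lb.
  have lA4 := L1D lA3 (L1Zl 4 ln1).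
  rewrite -Eb -(ExZl 4 ln1) -(ExZl 4 ln2) -(ExB lf lg1) -(ExB lA1 lg2) -(ExD lA2 lb).
  rewrite -(ExD lA3 (L1Zl 4 ln1)) -(ExD lA4 (L1Zl 4 ln2)).
  apply: le_Ex => [||w].
  - by apply: l; meas.
  - by apply: L1D => //; exact: L1Zl.
  - exact: excess_split_ge0.
apply: le_trans key _; rewrite Ef.
move: s1 s2; rewrite !ler_norml => /andP[s1 _] /andP[s2 _]; lra.
Qed.

Section reference_of_S2.
Context (R : realType) (K : distr R).
Hypothesis K_neg : K [set x : R | x < 0] = 0%E.
Hypothesis K_L1 : L1 K id.
Hypothesis K_LD : L_Delta K.
Hypothesis K_conv : asymp_equiv (fun x => tail (Defs.conv K K) x - 2 * tail K x)
                (fun x => 2 * mean K * incr K 1 x).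
Hypothesis K_pos : \forall x \near +oo, 0 < ic K id 1 x.
Hypothesis K_decr : exists2 C, 0 < C &
  \forall x \near +oo, forall y, x <= y -> ic K id 1 y <= C * ic K id 1 x.
Hypothesis K_tail : forall x, 0 < x -> 0 < tail K x.

Notation p := (ic K id 1).
Notation Q := (prodP K K).

Let mid : measurable_fun setT (@id R). Proof. exact: measurable_id. Qed.

(** For a shift to the right, subtract linearity at lengths [s] and [s + 1]. A shift to the left is
    one to the right seen from [x + y]; with [D <= 1 / 4] this gives [p (x + y) <= 2 * p x], which
    turns the error back into a multiple of [p x]. *)
Lemma S2_increments_shift t e : 0 < e -> \forall x \near +oo, forall y, `|y| <= t ->
    `|p (x + y) - p x| <= e * p x.
Proof.
move=> e0; have [t0|t0] := ltP t 0.
  by apply: nearW => x y; have := normr_ge0 y; lra.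
pose D := Num.min (e / 4) (1 / 4).
have D0 : 0 < D by rewrite lt_min !divr_gt0.
have D1 : D <= 1 / 4 by rewrite ge_min lexx orbT.
have De : D <= e / 4 by rewrite ge_min lexx.
have /nearyP[M1 h1] := L_Delta_lin K_LD (t + 1) D0.
have /nearyP[M2 h2] := K_pos.
pose M := Num.max M1 M2; apply/nearyP; exists (M + t) => x Mx y yt.
have P1 z : M <= z -> 0 < p z by move=> Mz; apply: h2; rewrite (le_trans _ Mz)// le_max lexx orbT.
have P2 z s : M <= z -> 0 <= s <= t -> `|p (z + s) - p z| <= 2 * D * p z.
  move=> Mz st; have M1z : M1 <= z by rewrite (le_trans _ Mz)// le_max lexx.
  have a1 : 0 <= s <= t + 1 by lra.
  have a2 : 0 <= s + 1 <= t + 1 by lra.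
  have := h1 z M1z _ a1; have := h1 z M1z _ a2; rewrite ic_add !ler_norml; lra.
have Mx0 : M <= x by lra.
have p0 := P1 x Mx0.
have [y0|y0] := leP 0 y.
  have yt' : 0 <= y <= t by move: yt; rewrite ger0_norm// y0.
  apply: le_trans (P2 x y Mx0 yt') _; rewrite ler_pM2r//; lra.
move: yt; rewrite ltr0_norm// => yt.
have Mxy : M <= x + y by lra.
have pxy := P1 _ Mxy.
have nyt : 0 <= - y <= t by lra.
have := P2 (x + y) (- y) Mxy nyt; rewrite addrK => h.
have k1 : D * p (x + y) <= 1 / 4 * p (x + y) by rewrite ler_pM2r.
have k2 : p (x + y) <= 2 * p x by move: h; rewrite ler_norml; lra.
have k3 : D * p (x + y) <= e / 4 * p (x + y) by rewrite ler_pM2r.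
have k4 : e / 4 * p (x + y) <= e / 4 * (2 * p x).
  by rewrite ler_pM2l// divr_gt0.
rewrite distrC; apply: le_trans h _; lra.
Qed.

(** Almost monotone increments give [h x <= C (L + 1) p x + h (x + L)] for the tail
    [h], and [x * h x --> 0]; take [L] of order [1 / h x]. *)
Lemma S2_tail_sq e : 0 < e -> \forall x \near +oo, tl K id x ^+ 2 <= e * p x.
Proof.
move=> e0; have [C C0 hC] := K_decr.
pose a := Num.min 1 (e / (4 * C)).
have a0 : 0 < a by rewrite lt_min ltr01/= divr_gt0// mulr_gt0.
have aC : 4 * C * a <= e by rewrite mulrC -ler_pdivlMr ?mulr_gt0// ge_min lexx orbT.
have a20 : 0 < a / 2 by lra.
have [A0 hA] : exists A0, forall A, A0 <= A ->
    Ex K (fun w : R => `|w| * (A < `|w|)%R%:R) <= a / 2 := L1_tail K_L1 a20.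
have [M hM] := tl_cvg0 K mid a0.
near=> x.
have p0 : 0 < p x by near: x.
have x0 : 0 < x by near: x; apply: nbhs_pinfty_gt; exact: num_real.
have xA : A0 <= x by near: x; apply: nbhs_pinfty_ge; exact: num_real.
have xM : M <= x by near: x; apply: nbhs_pinfty_ge; exact: num_real.
have hp : forall y, x <= y -> p y <= C * p x by near: x.
have ha := hM x xM.
set h := tl K id x in ha *.
have h0 : 0 < h by rewrite /h -tail_tl; exact: K_tail.
have IH n : ic K id n%:R x <= C * n%:R * p x.
  elim: n => [|n IH]; first by rewrite /ic addr0 subrr mulr0 mul0r.
  rewrite -natr1 ic_add; have := hp (x + n%:R); rewrite lerDl ler0n => /(_ isT); lra.
(* Since [L <= y], the bound [y * tl K id y <= a / 2] leaves at most [h / 2] of the tail beyond [y];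
   the other half is at most [C * (L + 1) * p x]. Multiplying by [h], with [L * h = a] and [h <= a],
   gives [h ^+ 2 <= 4 * C * a * p x]. *)
pose L := a / h; have L0 : 0 < L by rewrite divr_gt0.
have Lh : L * h = a by rewrite /L divfK// gt_eqF.
pose n := (Num.truncn L).+1.
have Ln : L <= n%:R by apply: ltW; exact: truncnS_gt.
have nL : n%:R <= L + 1.
  by rewrite -natr1 lerD2r; have := truncn_le L; rewrite (ltW L0).
pose y := x + n%:R.
have ht : y * tl K id y <= a / 2.
  have yA : A0 <= y by rewrite (le_trans xA)// lerDl.
  have y0 : 0 < y by rewrite ltr_wpDr.
  apply: le_trans (hA y yA); rewrite -ExZl; last by apply: L1_natb; meas.
  apply: le_Ex => [||w].
  - by apply: L1Zl; apply: L1_natb; meas.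
  - by apply: L1M_natb; [exact: L1_norm|meas].
  - case: (ltP y w) => yw; last by rewrite mulr0 mulr_ge0.
    have w0 : 0 < w by exact: lt_trans yw.
    by rewrite /= gtr0_norm// yw !mulr1 ltW.
have hn : h - tl K id y <= C * n%:R * p x := IH n.
have k1 : L * tl K id y <= a / 2.
  apply: le_trans ht; rewrite ler_wpM2r ?tl_ge0//; rewrite /y; lra.
have k2 : C * n%:R * p x <= C * (L + 1) * p x by rewrite ler_pM2r// ler_pM2l.
have k3 : L * h <= L * (tl K id y + C * (L + 1) * p x) by rewrite ler_pM2l//; lra.
have k4 : a / 2 <= L * (C * (L + 1) * p x) by lra.
have k5 : a / 2 * h <= L * (C * (L + 1) * p x) * h by rewrite ler_pM2r.
have k6 : a / 2 * h <= a * (C * (L + 1) * p x) by move: k5; rewrite (mulrAC L _ h) Lh.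
have k7 : h / 2 <= C * (L + 1) * p x.
  by rewrite -(ler_pM2l a0); lra.
have k8 : h / 2 * h <= C * (L + 1) * p x * h by rewrite ler_pM2r.
have k9 : C * (L + 1) * p x * h = C * p x * (a + h) by rewrite -Lh; ring.
have k10 : C * p x * (a + h) <= C * p x * (a + a) by rewrite ler_pM2l ?mulr_gt0//; lra.
have k11 : 4 * C * a * p x <= e * p x by rewrite ler_pM2r.
rewrite expr2; lra.
Unshelve. all: by end_near. Qed.

Lemma tail_conv x : tail (Defs.conv K K) x = tl Q (fun w => w.1 + w.2) x.
Proof.
rewrite tail_tl /tl.
have mD : measurable_fun setT (fun w : R * R => w.1 + w.2) by meas.
rewrite !Ex_indic; [|by meas|by meas].
by [].
Qed.

(** Apply [both_bound] to two independent copies. The two products of mean and increment there add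
    up to [2 * mu * p x], which is also the order that [K_conv] prescribes for the excess, so the
    main terms cancel. *)
Lemma S2_both_large e : 0 < e -> exists A0, forall A, A0 <= A ->
    \forall x \near +oo,
    Ex K (fun u => Ex K (fun v => [&& A < u <= x, A < v <= x & x < u + v]%R%:R))
      <= e * p x.
Proof.
move=> e0.
have K0 : Ex K (fun u => (u < 0)%R%:R) = 0.
  by rewrite Ex_indic; [rewrite /Pr K_neg|meas].
have lneg : L1 K (fun u : R => (u < 0)%R%:R) by apply: L1_natb; meas.
have mE : mean K = Ex K id by [].
pose mu := Ex K id.
(* The quotient in [K_conv] carries information only if its denominator is nonzero. There is no
   negative mass, so the mean is at least the mass above 1, which is positive by [K_tail]. *)
have mu0 : 0 < mu.
  have t1 : 0 < tl K id 1 by rewrite -tail_tl; exact: K_tail.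
  apply: (lt_le_trans t1).
  have lnegu : L1 K (fun u => `|u| * (u < 0)%R%:R).
    by apply: L1M_natb; [exact: L1_norm|meas].
  have Eneg : Ex K (fun u => `|u| * (u < 0)%R%:R) = 0.
    rewrite -[RHS](Ex_cst K) (ae_eq_Ex (L1_measurable lnegu) (measurable_cst (0 : R)))//.
    exists [set x | x < 0]; split => //.
      by apply: measurable_set_bool; meas.
    by move=> u /= h; apply: contrapT => /negP; rewrite -leNgt => u0; apply: h;
      rewrite ltNge u0 mulr0.
  rewrite -[leRHS]addr0 -Eneg -ExD//; apply: le_Ex.
  - by apply: L1_natb; meas.
  - exact: L1D.
  - move=> u; rewrite /=; case: (ltP 1 u) => u1; case: (ltP u 0) => u0 /=.
    + lra.
    + rewrite mulr0 addr0; lra.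
    + rewrite ltr0_norm//; lra.
    + rewrite mulr0 addr0; lra.
(* The total error is [2 * mu * D] from the excess, [2 * D] from linearity, [2 * D] from the
   truncated means and [D] from the squared tail. *)
pose D := Num.min 1 (e / (6 * (mu + 1))).
have B0 : 0 < 6 * (mu + 1) by lra.
have D0 : 0 < D by rewrite lt_min ltr01/= divr_gt0.
have De : D * (6 * (mu + 1)) <= e by rewrite -ler_pdivlMr// ge_min lexx orbT.
have [A0 hA] : exists A0, forall A, A0 <= A ->
    Ex K (fun w : R => `|w| * (A < `|w|)%R%:R) <= D := L1_tail K_L1 D0.
exists (Num.max 1 A0) => A; rewrite ge_max => /andP[A1 A0A].
have Apos : 0 < A by lra.
have UA := hA A A0A.
have f1 : L1 Q (fun w => w.1) by exact: (@L1_prod_fst _ _ _ _ _ K K id).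
have f2 : L1 Q (fun w => w.2) by exact: (@L1_prod_snd _ _ _ _ _ K K id).
have m1 := L1_measurable f1; have m2 := L1_measurable f2.
have I12 : indep Q (fun w => w.1) (fun w => w.2).
  exact: (@indep_prod _ _ _ _ _ K K _ _ _ _ id id mid mid).
have I21 := indepC I12.
have E1 : Ex Q (fun w => w.1) = mu by exact: (@Ex_prod_fst _ _ _ _ _ K K id).
have E2 : Ex Q (fun w => w.2) = mu by exact: (@Ex_prod_snd _ _ _ _ _ K K id).
have T1 x : tl Q (fun w => w.1) x = tl K id x.
  exact: (@tl_prod_fst _ _ _ _ _ K K id x mid).
have T2 x : tl Q (fun w => w.2) x = tl K id x.
  exact: (@tl_prod_snd _ _ _ _ _ K K id x mid).
have lA : L1 K (fun w => `|w| * (A < `|w|)%R%:R).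
  by apply: L1M_natb; [exact: L1_norm|meas].
have UA1 : Ex Q (fun w => `|w.1| * (A < `|w.1|)%R%:R) <= D.
  by apply: le_trans UA; rewrite (Ex_prod_fst K lA).
have UA2 : Ex Q (fun w => `|w.2| * (A < `|w.2|)%R%:R) <= D.
  by apply: le_trans UA; rewrite (Ex_prod_snd K lA).
(* The denominator is the factor lost in [ic_lin_sym] when passing to windows of either sign with
   length at most [A]. *)
pose D' := D / (2 * (1 + 2 * A)).
have A20 : 0 < 2 * (1 + 2 * A) by lra.
have D'0 : 0 < D' by rewrite divr_gt0.
have /nearyP[M hM] := L_Delta_lin K_LD (A + 1) D'0.
near=> x.
have p0 : 0 < p x by near: x.
have hshift : forall y, `|y| <= A -> `|p (x + y) - p x| <= 1 * p x.
  by near: x; exact: S2_increments_shift.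
have xA : 2 * A < x by near: x; apply: nbhs_pinfty_gt; exact: num_real.
have hsq : tl K id x ^+ 2 <= D * p x by near: x; exact: S2_tail_sq.
have hl : forall s, `|s| <= A -> `|ic K id s x - s * p x| <= D' * (2 * (1 + 2 * A)) * p x.
  apply: (ic_lin_sym (p := p)) => //; first exact: ltW.
    by move=> y yA; have := hshift y yA; rewrite ler_norml; lra.
  have xM : M + A <= x by near: x; apply: nbhs_pinfty_ge; exact: num_real.
  by move=> y; rewrite ler_norml => /andP[Ay _]; apply: hM; rewrite (le_trans _ (lerD xM Ay))// addrK.
have hc : `|1 - (tail (Defs.conv K K) x - 2 * tail K x) / (2 * mean K * incr K 1 x)| <= D.
  by near: x; move/cvgrPdist_le : K_conv => /(_ D D0).
rewrite divfK in hl; last by rewrite gt_eqF.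
have hl1 : forall s, `|s| <= A ->
    `|ic Q (fun w => w.1) s x - s * ic Q (fun w => w.1) 1 x| <= D * p x.
  by move=> s; rewrite /ic !T1; exact: hl.
have hl2 : forall s, `|s| <= A ->
    `|ic Q (fun w => w.2) s x - s * ic Q (fun w => w.2) 1 x| <= D * p x.
  by move=> s; rewrite /ic !T2; exact: hl.
have Dp0 : 0 <= D * p x by rewrite mulr_ge0 ?ltW.
have n1 : Ex Q (fun w => (w.1 < 0)%R%:R) = 0.
  exact: etrans (@Ex_prod_fst _ _ _ _ _ K K (fun u => (u < 0)%R%:R) lneg) K0.
have n2 : Ex Q (fun w => (w.2 < 0)%R%:R) = 0.
  exact: etrans (@Ex_prod_snd _ _ _ _ _ K K (fun u => (u < 0)%R%:R) lneg) K0.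
have := both_bound f1 f2 I12 Apos xA Dp0 hl1 hl2.
rewrite n1 n2 E1 E2 -tail_conv {1 2 3 4 5}/ic !T1 !T2 -/(p x) -expr2 !mulr0 !addr0.
pose q (u v : R) : R := [&& A < u <= x, A < v <= x & x < u + v]%R%:R.
have bq u v : `|q u v| <= 1 by rewrite /q; case: [&& _, _ & _]; rewrite ?normr1 ?normr0.
have mq : measurable_fun setT (fun w : measurableTypeR R * measurableTypeR R => q w.1 w.2).
  have mq0 : measurable_fun setT (fun w : R * R => q w.1 w.2) by rewrite /q; meas.
  exact: mq0.
rewrite -[Ex Q (fun w => _)]/(Ex Q (fun w => q w.1 w.2)).
have bq' (w : measurableTypeR R * measurableTypeR R) : `|q w.1 w.2| <= 1 by exact: bq.
rewrite (Ex_prod12 (L1_prod_bounded K K mq bq') (L1_section1 K mq bq')).2.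
move=> key; apply: le_trans key _.
have v1 : Ex Q (fun w => `|w.2| * (A < `|w.2|)%R%:R) * p x <= D * p x by rewrite ler_pM2r.
have v2 : Ex Q (fun w => `|w.1| * (A < `|w.1|)%R%:R) * p x <= D * p x by rewrite ler_pM2r.
have G0 : 0 < 2 * mean K * incr K 1 x by rewrite incr_ic mE !mulr_gt0.
have hF : tail (Defs.conv K K) x - 2 * tail K x <= (1 + D) * (2 * mean K * incr K 1 x).
  by rewrite -ler_pdivrMr//; move: hc; rewrite ler_norml; lra.
rewrite incr_ic mE -/mu in hF.
have k : D * (6 * (mu + 1)) * p x <= e * p x by rewrite ler_pM2r.
have mp : 0 <= D * (mu * p x) by rewrite !mulr_ge0 ?ltW.
rewrite (tail_tl K) in hF; lra.
Unshelve. all: by end_near. Qed.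

Lemma reference_S2 : reference K.
Proof.
split; [exact: K_pos|exact: K_decr|exact: S2_increments_shift|exact: S2_tail_sq|
  exact: S2_both_large].
Qed.

End reference_of_S2.

(** * Extrema and the FGM distribution *)

Section slices.
Context d1 d2 (T1 : measurableType d1) (T2 : measurableType d2) (R : realType).

(** Pushforward of measures that need not be probabilities, such as restrictions to a strip or to an
    event. *)
Definition push (m : {measure set T1 -> \bar R}) (f : T1 -> T2)
    (mf : measurable_fun setT f) : {measure set T2 -> \bar R} :=
  measure_function_pushforward__canonical__measure_function_Measure m mf.

End slices.

(** Rays are replaced by arbitrary Borel sets one coordinate at a time: restricting to a strip and
    projecting yields finite measures on the line, to which [ray_measure_eq] applies. *)
Lemma ray2_measure_eq (R : realType)
    (m1 m2 : {measure set (measurableTypeR R * measurableTypeR R) -> \bar R}) :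
  (m1 setT < +oo)%E -> (m2 setT < +oo)%E ->
  (forall x y : R, m1 (`]-oo, x]%classic `*` `]-oo, y]%classic) =
                   m2 (`]-oo, x]%classic `*` `]-oo, y]%classic)) ->
  forall X, measurable X -> m1 X = m2 X.
Proof.
move=> m1oo m2oo m12.
have mray (x : R) : measurable (`]-oo, x]%classic : set (measurableTypeR R)).
  exact: measurable_itv.
have fin (m : {measure set (measurableTypeR R * measurableTypeR R) -> \bar R}) :
    (m setT < +oo)%E -> forall A, measurable A -> (m A < +oo)%E.
  by move=> moo A mA; apply: le_lt_trans moo; apply: le_measure; rewrite ?inE.
have mfst A : measurable A -> measurable (fst @^-1` A : set (measurableTypeR R * measurableTypeR R)).
  by move=> mA; rewrite -[X in measurable X]setTI; exact: measurable_fst.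
have msnd A : measurable A -> measurable (snd @^-1` A : set (measurableTypeR R * measurableTypeR R)).
  by move=> mA; rewrite -[X in measurable X]setTI; exact: measurable_snd.
have step1 y A : measurable A -> m1 (A `*` `]-oo, y]%classic) = m2 (A `*` `]-oo, y]%classic).
  move=> mA; have mD := msnd _ (mray y).
  apply: (ray_measure_eq (m1 := push (mrestr m1 mD) measurable_fst)
    (m2 := push (mrestr m2 mD) measurable_fst)) => //.
  - exact: (fin m1 m1oo _ (measurableI _ _ (mfst _ measurableT) mD)).
  - exact: (fin m2 m2oo _ (measurableI _ _ (mfst _ measurableT) mD)).
  - by move=> x; exact: m12.
apply: prod_measure_eq => // A B mA mB.
have mD := mfst _ mA.
have E (m : {measure set (measurableTypeR R * measurableTypeR R) -> \bar R}) C :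
    m (A `*` C) = push (mrestr m mD) measurable_snd C.
  by congr (m _); apply/seteqP; split=> w /= [].
rewrite !E; apply: ray_measure_eq => //.
- exact: (fin m1 m1oo _ (measurableI _ _ (msnd _ measurableT) mD)).
- exact: (fin m2 m2oo _ (measurableI _ _ (msnd _ measurableT) mD)).
- by move=> y; rewrite -!E; exact: step1.
Qed.

Lemma Ex_both d (T : measurableType d) (R : realType) (Q : probability T R)
    (U V : T -> R) (x y : R) : measurable_fun setT U -> measurable_fun setT V ->
  indep Q U V ->
  Ex Q (fun w => ((x < U w) && (y < V w))%R%:R) = tl Q U x * tl Q V y.
Proof.
move=> mU mV UV; rewrite Ex_indic; last by meas.
have pre (h : T -> R) z : h @^-1` `]z, +oo[ = [set w | (z < h w)%R].
  by apply/seteqP; split=> w; rewrite /= in_itv/= andbT.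
have -> : [set w | (x < U w)%R && (y < V w)%R] =
    U @^-1` `]x, +oo[ `&` V @^-1` `]y, +oo[.
  by rewrite !pre; apply/seteqP; split=> w /= => [/andP[]|[-> ->]].
rewrite (UV _ _ (measurable_itv `]x, +oo[) (measurable_itv `]y, +oo[)) !pre.
by rewrite /tl !Ex_indic//; meas.
Qed.

Section min_max.
Context d (T : measurableType d) (R : realType) (Q : probability T R).
Variables (U V : T -> R).
Hypotheses (mU : measurable_fun setT U) (mV : measurable_fun setT V).
Hypothesis UV : indep Q U V.

Lemma tl_min x : tl Q (fun w => Num.min (U w) (V w)) x = tl Q U x * tl Q V x.
Proof. by rewrite -Ex_both//; apply: eq_Ex => w; rewrite lt_min. Qed.

Lemma tl_max x : tl Q (fun w => Num.max (U w) (V w)) x =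
  tl Q U x + tl Q V x - tl Q U x * tl Q V x.
Proof.
rewrite -Ex_both// /tl -ExD; [|apply: L1_natb; meas..].
rewrite -ExB; [|apply: L1D; apply: L1_natb; meas|apply: L1_natb; meas].
apply: eq_Ex => w; rewrite lt_max.
by case: (x < U w); case: (x < V w); rewrite /= ?addr0 ?subr0 ?add0r ?addrK.
Qed.

Lemma L1_max : L1 Q U -> L1 Q V -> L1 Q (fun w => Num.max (U w) (V w)).
Proof.
move=> lU lV; apply: (L1_le (g := fun w => `|U w| + `|V w|)).
- by meas.
- by move=> w; rewrite /Num.max; case: ifP => _; rewrite ?lerDr ?lerDl.
- by apply: L1D; exact: L1_norm.
Qed.

Lemma L1_min : L1 Q U -> L1 Q V -> L1 Q (fun w => Num.min (U w) (V w)).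
Proof.
move=> lU lV; apply: (L1_le (g := fun w => `|U w| + `|V w|)).
- by meas.
- by move=> w; rewrite /Num.min; case: ifP => _; rewrite ?lerDr ?lerDl.
- by apply: L1D; exact: L1_norm.
Qed.

End min_max.

Section base_variables.
Context (R : realType) (K : distr R).
Hypothesis rK : reference K.
Notation p := (ic K id 1).

(** For iid variables of law [F], the maximum has tail [2 h - h ^ 2] and the minimum
    [h ^ 2], where [h] is the tail of [F]. *)
Lemma regular_quadratic_tail d (T : measurableType d) (P : probability T R)
    (W : T -> R) (F : distr R) (a b C : R) : L1 P W ->
  (forall x, tl P W x = a * tl F id x + b * tl F id x ^+ 2) ->
  (forall t e, 0 < e -> \forall x \near +oo, forall s, 0 <= s <= t ->
    `|ic F id s x - s * ic F id 1 x| <= e * ic F id 1 x) ->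
  0 < C -> (\forall x \near +oo, ic F id 1 x <= C * p x) ->
  regular K P (fun _ : unit => W).
Proof.
move=> lW tlW linF C0 FC; have mW := L1_measurable lW.
have mid : measurable_fun setT (@id R) by exact: measurable_id.
(* A difference of squares is the increment times the sum of two tails. These tails tend to 0, so
   the quadratic term is negligible against the increment and only the coefficient [a] matters
   asymptotically. *)
have icW s x : 0 <= s -> 0 <= ic F id s x /\ ic P W s x = a * ic F id s x
    + b * (ic F id s x * (tl F id x + tl F id (x + s))).
  by move=> s0; split; [exact: ic_ge0|rewrite /ic !tlW; ring].
split => //.
- by move=> e e0; have [A0 hA] := L1_tail lW e0; exists A0 => _; exact: hA.
- exists ((`|a| + 2 * `|b| + 1) * C).
    by apply: mulr_gt0 => //; rewrite ltr_wpDl// addr_ge0// mulr_ge0.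
  near=> x => _; have p0 : 0 < p x by near: x; exact: ref_pos.
  have h : ic F id 1 x <= C * p x by near: x.
  have [i0 ->] := icW 1 x ler01.
  have t1 := tl_le1 F mid x; have t2 := tl_le1 F mid (x + 1).
  have t3 := tl_ge0 F id x; have t4 := tl_ge0 F id (x + 1).
  apply: (@le_trans _ _ ((`|a| + 2 * `|b| + 1) * ic F id 1 x)).
    have k1 : a * ic F id 1 x <= `|a| * ic F id 1 x by rewrite ler_wpM2r// ler_norm.
    have k2 : b * (ic F id 1 x * (tl F id x + tl F id (x + 1))) <=
       `|b| * (ic F id 1 x * 2).
      apply: (@le_trans _ _ (`|b| * (ic F id 1 x * (tl F id x + tl F id (x + 1))))).
        by rewrite ler_wpM2r ?ler_norm// mulr_ge0// addr_ge0.
      rewrite ler_wpM2l// ler_wpM2l//; lra.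
    lra.
  by rewrite -mulrA ler_wpM2l// !addr_ge0// mulr_ge0.
- move=> t e e0; have [t0|t0] := ltP t 0; first by apply: nearW => x i s; lra.
  pose B := `|a| + 4 * `|b| * (1 + t) + 1.
  have B0 : 0 < B by rewrite ltr_wpDl// addr_ge0// !mulr_ge0// addr_ge0.
  pose D := Num.min 1 (e / (B * C)).
  have BC0 : 0 < B * C by exact: mulr_gt0.
  have D0 : 0 < D by rewrite lt_min ltr01/= divr_gt0.
  have D1 : D <= 1 by rewrite ge_min lexx.
  have De : D * (B * C) <= e by rewrite -ler_pdivlMr// ge_min lexx orbT.
  have [M hM] := tl_cvg0 F mid D0.
  near=> x => _ s st; have p0 : 0 < p x by near: x; exact: ref_pos.
  have h : ic F id 1 x <= C * p x by near: x.
  have l : forall s, 0 <= s <= t -> `|ic F id s x - s * ic F id 1 x| <= D * ic F id 1 x.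
    by near: x; exact: linF.
  have hx : tl F id x <= D by apply: hM; near: x; apply: nbhs_pinfty_ge; exact: num_real.
  set q := ic F id 1 x in h l *.
  have [q0 E1] := icW 1 x ler01; rewrite -/q in q0 E1.
  have s0 : 0 <= s by case/andP: st.
  have [is0 Es] := icW s x s0.
  rewrite Es E1.
  have ls := l s st; set u := ic F id s x in is0 ls *.
  have us : u <= (1 + t) * q.
    have : s * q <= t * q by rewrite ler_wpM2r//; case/andP: st.
    have : D * q <= 1 * q by rewrite ler_wpM2r.
    move: ls; rewrite ler_norml; lra.
  set hs := tl F id x + tl F id (x + s); set h1 := tl F id x + tl F id (x + 1).
  have hsD : 0 <= hs <= 2 * D.
    rewrite addr_ge0 ?tl_ge0//=; have : tl F id (x + s) <= tl F id x by rewrite tl_mono// lerDl.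
    rewrite /hs; lra.
  have h1D : 0 <= h1 <= 2 * D.
    rewrite addr_ge0 ?tl_ge0//=; have : tl F id (x + 1) <= tl F id x by rewrite tl_mono// lerDl.
    rewrite /h1; lra.
  have -> : a * u + b * (u * hs) - s * (a * q + b * (q * h1)) =
    a * (u - s * q) + b * (u * hs - s * q * h1) by ring.
  have k1 : `|u * hs - s * q * h1| <= 4 * (1 + t) * q * D.
    have k2 : u * hs <= (1 + t) * q * (2 * D).
      by case/andP: hsD => ? ?; apply: ler_pM.
    have k3 : s * q * h1 <= (1 + t) * q * (2 * D).
      case/andP: h1D => ? ?; apply: ler_pM => //; first exact: mulr_ge0.
      rewrite ler_wpM2r//; lra.
    have k4 : 0 <= u * hs by rewrite mulr_ge0//; case/andP: hsD.
    have k5 : 0 <= s * q * h1 by rewrite !mulr_ge0//; case/andP: h1D.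
    rewrite ler_norml; lra.
  apply: (@le_trans _ _ (D * B * q)); last first.
    apply: (@le_trans _ _ (D * B * (C * p x))).
      by rewrite ler_wpM2l// mulr_ge0// ltW.
    by rewrite !mulrA -(mulrA D) ler_pM2r.
  apply: le_trans (ler_normD _ _) _; rewrite !normrM.
  have k6 : `|a| * `|u - s * q| <= `|a| * (D * q) by rewrite ler_wpM2l.
  have k7 : `|b| * `|u * hs - s * q * h1| <= `|b| * (4 * (1 + t) * q * D) by rewrite ler_wpM2l.
  have k8 : 0 <= D * q by rewrite mulr_ge0// ltW.
  rewrite /B; lra.
Unshelve. all: by end_near. Qed.

(** The increment of [c i * W] at [x] is that of [W] at [x / c i] over a window of length [s / c i].
    As [c i <= 1] the point moves to the right and [ref_decr] returns to [p x]; as [al <= c i] the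
    window stays bounded. A zero weight gives no mass beyond [x >= 0]. *)
Lemma regular_scale d (T : measurableType d) (P : probability T R) (W : T -> R)
    (I : Type) (c : I -> R) (al : R) :
  regular K P (fun _ : unit => W) -> 0 < al ->
  (forall i, c i = 0 \/ al <= c i <= 1) ->
  regular K P (fun i w => c i * W w).
Proof.
move=> rW al0 hc.
have mW := reg_meas rW tt; have lW := reg_L1 rW tt.
have c0 i : 0 <= c i by case: (hc i) => [->//|]; lra.
have c1 i : c i <= 1 by case: (hc i) => [->//|/andP[]//].
have tlc i x : 0 < c i -> tl P (fun w => c i * W w) x = tl P W (x / c i).
  by move=> ci0; apply: eq_Ex => w; rewrite ltr_pdivrMr// mulrC.
have icc i s x : 0 < c i -> ic P (fun w => c i * W w) s x = ic P W (s / c i) (x / c i).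
  by move=> ci0; rewrite /ic !tlc// mulrDl.
have ic0 i s x : c i = 0 -> 0 <= x -> 0 <= s -> ic P (fun w => c i * W w) s x = 0.
  move=> ci0 x0 s0; rewrite /ic /tl !(@eq_Ex _ _ _ P _ (fun=> 0)) ?subrr// => w.
    by rewrite ci0 mul0r ltNge addr_ge0.
  by rewrite ci0 mul0r ltNge x0.
have [D D0 hD] := ref_decr rK.
split.
- by move=> i; meas.
- by move=> i; exact: L1Zl.
- move=> e e0; have [A0 hA] := reg_ui_ge rW e0.
  exists A0 => i; apply: le_trans (hA A0 (lexx _) tt).
  have cW w : `|c i * W w| <= `|W w| by rewrite normrM (ger0_norm (c0 i)) ler_piMl.
  apply: le_Ex => [||w].
  + by apply: L1M_natb; [exact: L1_norm (L1Zl _ _)|meas].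
  + by apply: L1M_natb; [exact: L1_norm|meas].
  + apply: ler_pM => //; rewrite ler_nat; case: (ltP A0 `|c i * W w|) => // h.
    by rewrite (lt_le_trans h).
- have [C C0 /nearyP[M hM]] := reg_ic_le rK rW.
  exists (C * (1 / al + 1) * D); first by rewrite !mulr_gt0// addr_gt0// divr_gt0.
  near=> x => i.
  have x0 : 0 <= x by near: x; apply: nbhs_pinfty_ge; exact: num_real.
  have p0 : 0 < p x by near: x; exact: ref_pos.
  have h : forall y, x <= y -> forall (i : unit) s, 0 <= s -> ic P W s y <= C * (s + 1) * p y.
    have xM : M <= x by near: x; apply: nbhs_pinfty_ge; exact: num_real.
    by move=> y xy; apply: hM; exact: le_trans xy.
  have hp : forall y, x <= y -> p y <= D * p x by near: x.
  have al1 : 0 <= 1 / al by rewrite divr_ge0// ltW.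
  case: (hc i) => [ci0|/andP[ci ci1]].
    by rewrite ic0// ltW// !mulr_gt0// addr_gt0// divr_gt0.
  have cp : 0 < c i by exact: lt_le_trans ci.
  have xc : x <= x / c i by rewrite ler_pdivlMr// ler_piMr.
  rewrite icc//; apply: le_trans (h _ xc tt _ _) _; first by rewrite divr_ge0// ltW.
  rewrite -[X in _ <= X]mulrA; apply: ler_pM.
  + by apply: mulr_ge0; [exact: ltW|rewrite addr_ge0 ?divr_ge0// ltW].
  + by apply: ic_ge0.
  + by rewrite ler_pM2l// lerD2r !mul1r lef_pV2// posrE.
  + exact: hp.
- move=> t e e0; have [t0|t0] := ltP t 0; first by apply: nearW => x i s; lra.
  pose E := e / ((1 + t) * D); have B0 : 0 < (1 + t) * D by rewrite mulr_gt0//; lra.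
  have E0 : 0 < E by rewrite divr_gt0.
  have /nearyP[M hM] := reg_lin rW ((t + 1) / al) E0.
  have eE : e = E * ((1 + t) * D) by rewrite /E divfK// gt_eqF.
  near=> x => i s st.
  have x0 : 0 <= x by near: x; apply: nbhs_pinfty_ge; exact: num_real.
  have p0 : 0 < p x by near: x; exact: ref_pos.
  have h : forall y, x <= y -> forall (i : unit) s, 0 <= s <= (t + 1) / al ->
      `|ic P W s y - s * ic P W 1 y| <= E * p y.
    have xM : M <= x by near: x; apply: nbhs_pinfty_ge; exact: num_real.
    by move=> y xy; apply: hM; exact: le_trans xy.
  have hp : forall y, x <= y -> p y <= D * p x by near: x.
  have s0 : 0 <= s by case/andP: st.
  case: (hc i) => [ci0|/andP[ci ci1]].
    by rewrite !ic0// mulr0 subrr normr0 mulr_ge0 ?ltW.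
  have cp : 0 < c i by exact: lt_le_trans ci.
  have xc : x <= x / c i by rewrite ler_pdivlMr// ler_piMr.
  rewrite !icc//.
  have b1 u : 0 <= u <= t + 1 -> 0 <= u / c i <= (t + 1) / al.
    move=> /andP[u0 ut]; rewrite divr_ge0 ?(ltW cp)//=.
    by apply: ler_pM => //; rewrite ?invr_ge0 ?(ltW cp)// lef_pV2.
  have u1 : 0 <= s <= t + 1 by lra.
  have u2 : 0 <= (1 : R) <= t + 1 by lra.
  have h1 := h _ xc tt _ (b1 _ u1); have h2 := h _ xc tt _ (b1 _ u2).
  (* Both windows have slope [s / c i] with respect to the unit increment at [x / c i], so the
     linear parts cancel. *)
  have -> : ic P W (s / c i) (x / c i) - s * ic P W (1 / c i) (x / c i) =
    (ic P W (s / c i) (x / c i) - s / c i * ic P W 1 (x / c i))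
    - s * (ic P W (1 / c i) (x / c i) - 1 / c i * ic P W 1 (x / c i)).
    ring.
  apply: le_trans (ler_normB _ _) _; rewrite normrM (ger0_norm s0).
  have k1 : s * `|ic P W (1 / c i) (x / c i) - 1 / c i * ic P W 1 (x / c i)| <=
      t * (E * p (x / c i)) by apply: ler_pM => //; case/andP: st.
  have k2 : (1 + t) * (E * p (x / c i)) <= (1 + t) * (E * (D * p x)).
    by rewrite ler_wpM2l ?addr_ge0// ler_pM2l// hp.
  rewrite eE; lra.
Unshelve. all: by end_near. Qed.

End base_variables.

(** * Passing between a law on the line and its positive part *)

Section S2_tilde_facts.
Context (R : realType).
Implicit Types F G : distr R.

Let mid : measurable_fun setT (@id R). Proof. exact: measurable_id. Qed.

Lemma near_ic_pos_part F : \forall x \near +oo, forall y, x <= y -> forall s, 0 <= s ->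
  ic (pos_part F) id s y = ic F id s y.
Proof.
apply/nearyP; exists 0 => x x0 y xy s s0.
by rewrite ic_pos_part// (le_trans x0).
Qed.

Lemma almost_decreasing_near F : almost_decreasing (incr F 1) ->
  (\forall x \near +oo, 0 < ic F id 1 x) /\
  exists2 C, 0 < C &
    \forall x \near +oo, forall y, x <= y -> ic F id 1 y <= C * ic F id 1 x.
Proof.
move=> [pos [/eqO_exP[C C0 hC] _]]; split.
  by apply: filterS pos => x; rewrite incr_ic.
exists C => //; near=> x => y xy.
have px : 0 < incr F 1 x by near: x.
have : `|sup [set incr F 1 y | y in `[x, +oo[]| <= C * `|incr F 1 x| by near: x.
rewrite (gtr0_norm px) -!incr_ic; apply: le_trans.
(* Increments are at most 1, so the set is bounded and [sup] is its genuine supremum. *)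
apply: le_trans (ler_norm _); apply: ub_le_sup.
  exists 1 => _ [z _ <-]; rewrite incr_ic /ic.
  have := tl_le1 F mid z; have := tl_ge0 F id (z + 1); lra.
by exists y => //=; rewrite in_itv/= xy.
Unshelve. all: by end_near. Qed.

Lemma S2_tilde_lin F : S_2_tilde F -> forall t e, 0 < e ->
  \forall x \near +oo, forall s, 0 <= s <= t ->
    `|ic F id s x - s * ic F id 1 x| <= e * ic F id 1 x.
Proof.
move=> [_ [_ _ LF _] _] t e e0; near=> x => s st.
have h : forall s, 0 <= s <= t -> `|ic (pos_part F) id s x
    - s * ic (pos_part F) id 1 x| <= e * ic (pos_part F) id 1 x.
  by near: x; exact: L_Delta_lin.
have E : forall y, x <= y -> forall s, 0 <= s -> ic (pos_part F) id s y = ic F id s y.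
  by near: x; exact: near_ic_pos_part.
have := h s st; rewrite !E//; by case/andP: st.
Unshelve. all: by end_near. Qed.

Lemma S2_tilde_reference F : S_2_tilde F -> (forall x, 0 < x -> 0 < tail F x) ->
  reference (pos_part F).
Proof.
move=> [_ [K0 KL1 KLD Kc] /almost_decreasing_near[pos [C C0 hC]]] Ft.
apply: reference_S2 => //.
- near=> x.
  have E : forall y, x <= y -> forall s, 0 <= s -> ic (pos_part F) id s y = ic F id s y.
    by near: x; exact: near_ic_pos_part.
  by rewrite E//; near: x.
- exists C => //; near=> x => y xy.
  have E : forall y, x <= y -> forall s, 0 <= s -> ic (pos_part F) id s y = ic F id s y.
    by near: x; exact: near_ic_pos_part.
  by rewrite !E//; move: y xy; near: x.
- by move=> x x0; rewrite tail_tl tl_pos_part ?ltW// -tail_tl; exact: Ft.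
Unshelve. all: by end_near. Qed.

Lemma same_order_near F G : S_2_tilde F -> same_order (incr F 1) (incr G 1) ->
  exists2 C, 0 < C & \forall x \near +oo, ic G id 1 x <= C * ic (pos_part F) id 1 x.
Proof.
move=> [_ _ /almost_decreasing_near[pos _]] [_ /eqO_exP[C C0 hC]].
exists C => //; near=> x.
have E : forall y, x <= y -> forall s, 0 <= s -> ic (pos_part F) id s y = ic F id s y.
  by near: x; exact: near_ic_pos_part.
have p0 : 0 < ic F id 1 x by near: x.
rewrite E//; have : `|incr G 1 x| <= C * `|incr F 1 x| by near: x.
by rewrite !incr_ic (gtr0_norm p0); apply: le_trans; exact: ler_norm.
Unshelve. all: by end_near. Qed.

End S2_tilde_facts.

Lemma Ex_indep_mul d (T : measurableType d) (R : realType) (Q : probability T R)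
    (U V : T -> R) (g : R -> R) (M : R) :
  L1 Q U -> measurable_fun setT V -> indep Q U V -> measurable_fun setT g ->
  (forall v, `|g v| <= M) ->
  Ex Q (fun w => U w * g (V w)) = Ex Q U * Ex Q (fun w => g (V w)).
Proof.
move=> lU mV UV mg gM; have mU := L1_measurable lU.
have mgV : measurable_fun setT (fun w => g (V w)) by exact: measurableT_comp.
have lf : L1 Q (fun w => U w * g (V w)) by apply: (L1M_bounded lU mgV).
have mh : measurable_fun setT (fun z : R * R => z.1 * g z.2).
  apply: measurable_funM; first exact: measurable_fst.
  exact: (measurableT_comp mg measurable_snd).
have [lp ->] := indep_Ex mU mV UV mh lf.
have ls w2 : L1 Q (fun w1 => U w1 * g (V w2)).
  apply: (@L1M_bounded _ _ _ _ M _ (fun=> g (V w2))) => //.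
rewrite (Ex_prod21 lp ls).2 -ExZl; last by exact: (L1_bounded _ mgV (fun w => gM _)).
by apply: eq_Ex => w2 /=; rewrite ExZr.
Qed.

(** * Mixtures of regular families *)

Section mixtures_of_regular.
Context (R : realType) (K : distr R) (I : Type).
Hypothesis rK : reference K.
Context d1 d3 (T1 : measurableType d1) (T3 : measurableType d3).
Variables (P : probability T1 R) (Q : probability T3 R).
Variables (U : I -> T1 -> R) (V : nat -> I -> T3 -> R) (k : nat -> R) (n : nat).
Notation p := (ic K id 1).
Hypothesis k0 : forall j, 0 <= k j.
Hypothesis mU : forall i, measurable_fun setT (U i).
Hypothesis rV : forall j, regular K Q (V j).
Hypothesis UV : forall i (h : R -> R), measurable_fun setT h ->
  (forall j, (j < n)%N -> L1 Q (fun w => h (V j i w))) ->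
  L1 P (fun w => h (U i w)) /\
  Ex P (fun w => h (U i w)) = \sum_(j < n) k j * Ex Q (fun w => h (V j i w)).

Lemma tl_mix i x : tl P (U i) x = \sum_(j < n) k j * tl Q (V j i) x.
Proof.
rewrite /tl (@UV i (fun u => (x < u)%R%:R) _ _).2//; first by meas.
by move=> j _; apply: L1_natb; have mVj := reg_meas (rV j) i; meas.
Qed.

Lemma ic_mix i s x : ic P (U i) s x = \sum_(j < n) k j * ic Q (V j i) s x.
Proof.
rewrite /ic !tl_mix -sumrB; apply: eq_bigr => j _; by rewrite -mulrBr.
Qed.

(** Each condition is linear in the law, up to the absolute value. The mixture is given through test
    functions of [U i], so that one statement serves either coordinate of a pair as well as a linear
    combination of both. *)
Lemma regular_mix : regular K P U.
Proof.
pose S := \sum_(j < n) k j + 1.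
have S0 : 0 < S by rewrite ltr_wpDl// sumr_ge0.
have kS (f : 'I_n -> R) e : 0 <= e -> (forall j, f j <= e) ->
    \sum_(j < n) k j * f j <= S * e.
  move=> e0 fe; apply: (@le_trans _ _ (\sum_(j < n) k j * e)).
    by apply: ler_sum => j _; rewrite ler_wpM2l.
  by rewrite -mulr_suml ler_wpM2r// lerDl.
split => //.
- by move=> i; exact: (@UV i id (@measurable_id _ _ _) (fun j _ => reg_L1 (rV j) i)).1.
- move=> e e0; have eS : 0 < e / S by rewrite divr_gt0.
  have /choice[A0 hA0] : forall j : 'I_n, exists A0, forall A, A0 <= A -> forall i,
      Ex Q (fun w => `|V j i w| * (A < `|V j i w|)%R%:R) <= e / S.
    by move=> j; exact: reg_ui_ge.
  pose A := \sum_(j < n) `|A0 j|; exists A => i.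
  rewrite (@UV i (fun u => `|u| * (A < `|u|)%R%:R) _ _).2; last 2 first.
  - by meas.
  - move=> j _; apply: L1M_natb; first by apply: L1_norm; exact: reg_L1.
    by have mVj := reg_meas (rV j) i; meas.
  apply: le_trans (kS _ (e / S) (ltW eS) _) _.
    move=> j; apply: hA0; rewrite /A (bigD1 j)//= (le_trans (ler_norm _))// lerDl.
    exact: sumr_ge0.
  by rewrite mulrC divfK// gt_eqF.
- have /choice[C hC] : forall j : 'I_n, exists C, 0 < C /\
      \forall x \near +oo, forall i, ic Q (V j i) 1 x <= C * p x.
    by move=> j; have [C C0 hC] := reg_big (rV j); exists C.
  pose D := \sum_(j < n) C j + 1.
  have D0 : 0 < D by rewrite ltr_wpDl// sumr_ge0// => j _; have [/ltW] := hC j.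
  exists (S * D); first exact: mulr_gt0.
  near=> x => i.
  have p0 : 0 < p x by near: x; exact: ref_pos.
  have h : forall j : 'I_n, forall i, ic Q (V j i) 1 x <= C j * p x.
    by near: x; apply: filter_forall => j; have [] := hC j.
  rewrite ic_mix -mulrA; apply: kS; first by rewrite mulr_ge0 ?ltW.
  move=> j; apply: le_trans (h j i) _; rewrite ler_wpM2r ?(ltW p0)//.
  rewrite /D (bigD1 j)//= -addrA lerDl addr_ge0// sumr_ge0// => l _.
  by have [/ltW] := hC l.
- move=> t e e0; have eS : 0 < e / S by rewrite divr_gt0.
  near=> x => i s st.
  have p0 : 0 < p x by near: x; exact: ref_pos.
  have h : forall j : 'I_n, forall i s, 0 <= s <= t ->
      `|ic Q (V j i) s x - s * ic Q (V j i) 1 x| <= e / S * p x.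
    by near: x; apply: filter_forall => j; exact: reg_lin.
  rewrite !ic_mix mulr_sumr -sumrB; apply: le_trans (ler_norm_sum _ _ _) _.
  rewrite (eq_bigr (fun j : 'I_n =>
    k j * `|ic Q (V j i) s x - s * ic Q (V j i) 1 x|)); last first.
    by move=> j _; rewrite mulrCA -mulrBr normrM (ger0_norm (k0 j)).
  apply: le_trans (kS _ (e / S * p x) _ _) _.
  + by rewrite mulr_ge0 ?ltW.
  + by move=> j; exact: h.
  + by rewrite mulrA (mulrC S) divfK// gt_eqF.
Unshelve. all: by end_near. Qed.

End mixtures_of_regular.

Lemma Pr_ray_tl d (T : measurableType d) (R : realType) (P : probability T R)
    (U : T -> R) x : measurable_fun setT U ->
  Pr P (U @^-1` `]-oo, x]) = 1 - tl P U x.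
Proof.
move=> mU; rewrite /tl Ex_indic; last by meas.
have -> : [set w | (x < U w)%R] = setT `\` U @^-1` `]-oo, x].
  apply/seteqP; split=> w; rewrite /= in_itv /= ltNge; first by move/negP.
  by case=> _ /negP.
rewrite Pr_D ?PrT//; first by lra.
by rewrite -[X in measurable X]setTI; apply: mU => //; exact: measurable_itv.
Qed.

(** The window length [s] is kept free because normalization by the largest weight changes the unit
    window. *)
Definition cross d (T : measurableType d) (R : realType) (P : probability T R)
  (U V : T -> R) (s x : R) : R := Ex P (fun w => U w * (x < V w <= x + s)%R%:R).

Lemma cross_indep d (T : measurableType d) (R : realType) (P : probability T R)
    (U V : T -> R) (s x : R) : L1 P U -> measurable_fun setT V -> indep P U V ->
  0 <= s -> cross P U V s x = Ex P U * ic P V s x.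
Proof.
move=> lU mV UV s0; rewrite ic_itv//.
apply: (@Ex_indep_mul _ _ _ P U V (fun v => (x < v <= x + s)%R%:R) 1) => //.
  by meas.
by move=> v; case: (_ && _); rewrite ?normr1 ?normr0.
Qed.

(** With [F_max = F ^ 2] and [F_min = 2 F - F ^ 2] the laws of the maximum and the minimum
    of two independent variables of law [F], one has [F = (F_min + F_max) / 2] and
    [F (1 - F) = (F_min - F_max) / 2], so the FGM distribution is a mixture of the four
    products of [F_min], [F_max] with [G_min], [G_max]. *)
Section fgm_mixture.
Context (R : realType) (F G : distr R) (r : R).
Hypothesis r1 : -1 <= r <= 1.

Notation RR := (measurableTypeR R * measurableTypeR R)%type.

Definition pair_extremum (b : bool) (w : RR) : R :=
  if b then Num.max w.1 w.2 else Num.min w.1 w.2.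

Definition fgm_space := prodP (prodP F F) (prodP G G).

(** The two binary digits of [j < 4] choose between maximum and minimum in the two coordinates. *)
Definition fgm_fst (j : nat) (w : RR * RR) : R := pair_extremum (odd j) w.1.

Definition fgm_snd (j : nat) (w : RR * RR) : R := pair_extremum (1 < j)%N w.2.

(** Expanding the product of the two sums and r times the product of the two differences, [r] gets
    the sign plus for two extrema of the same kind and minus otherwise. The range of [r] is exactly
    what makes all four weights nonnegative. *)
Lemma fgm_weight_ge0 j : 0 <= (if odd j == (1 < j)%N then 1 + r else 1 - r) / 4.
Proof. by case/andP: r1 => ? ?; apply: divr_ge0 => //; case: ifP => _; lra. Qed.

Definition fgm_weight j : {nonneg R} := NngNum (fgm_weight_ge0 j).

Let mid : measurable_fun (setT : set (measurableTypeR R)) (id : measurableTypeR R -> R).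
Proof. exact: measurable_id. Qed.

Lemma measurable_pair_extremum b : measurable_fun setT (pair_extremum b).
Proof.
case: b; [apply: measurable_maxr|apply: measurable_minr];
  first [exact: measurable_fst|exact: measurable_snd].
Qed.

Lemma measurable_fgm_fst j : measurable_fun setT (fgm_fst j).
Proof. by apply: measurable_comp_fst; exact: measurable_pair_extremum. Qed.

Lemma measurable_fgm_snd j : measurable_fun setT (fgm_snd j).
Proof. by apply: measurable_comp_snd; exact: measurable_pair_extremum. Qed.

Lemma tl_pair_extremum (H : distr R) b x : tl (prodP H H) (pair_extremum b) x =
  (if b then 2 else 0) * tl H id x + (if b then -1 else 1) * tl H id x ^+ 2.
Proof.
have I12 : indep (prodP H H) (fun w : RR => w.1 : R) (fun w : RR => w.2 : R).
  exact: (@indep_prod _ _ _ _ _ H H _ _ _ _ id id mid mid).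
have m1 : measurable_fun setT (fun w : RR => w.1 : R) by exact: measurable_fst.
have m2 : measurable_fun setT (fun w : RR => w.2 : R) by exact: measurable_snd.
have T1 : tl (prodP H H) (fun w : RR => w.1 : R) x = tl H id x.
  exact: (@tl_prod_fst _ _ _ _ _ H H id x mid).
have T2 : tl (prodP H H) (fun w : RR => w.2 : R) x = tl H id x.
  exact: (@tl_prod_snd _ _ _ _ _ H H id x mid).
case: b; rewrite /pair_extremum.
  by rewrite (tl_max m1 m2 I12) T1 T2; ring.
by rewrite (tl_min m1 m2 I12) T1 T2; ring.
Qed.

Lemma L1_pair_extremum (H : distr R) b : L1 H id -> L1 (prodP H H) (pair_extremum b).
Proof.
move=> lH.
have f1 : L1 (prodP H H) (fun w : RR => w.1 : R).
  exact: (@L1_prod_fst _ _ _ _ _ H H id).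
have f2 : L1 (prodP H H) (fun w : RR => w.2 : R).
  exact: (@L1_prod_snd _ _ _ _ _ H H id).
have m1 := L1_measurable f1; have m2 := L1_measurable f2.
by case: b; [exact: L1_max|exact: L1_min].
Qed.

Lemma tl_fgm_fst j x : tl fgm_space (fgm_fst j) x =
  (if odd j then 2 else 0) * tl F id x + (if odd j then -1 else 1) * tl F id x ^+ 2.
Proof. by rewrite -tl_pair_extremum tl_prod_fst//; exact: measurable_pair_extremum. Qed.

Lemma tl_fgm_snd j x : tl fgm_space (fgm_snd j) x =
  (if (1 < j)%N then 2 else 0) * tl G id x
  + (if (1 < j)%N then -1 else 1) * tl G id x ^+ 2.
Proof. by rewrite -tl_pair_extremum tl_prod_snd//; exact: measurable_pair_extremum. Qed.

Context d (T : measurableType d) (P : probability T R) (X Y : T -> R).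
Hypotheses (mX : measurable_fun setT X) (mY : measurable_fun setT Y).
Hypothesis XY : forall x y,
  Pr P [set w | X w <= x /\ Y w <= y] = FGM_df F G r x y.

Let mXY : measurable_fun setT (fun w => (X w, Y w) : RR).
Proof. exact: (measurable_fun_pair mX mY). Qed.

Let mW j : measurable_fun setT (fun w => (fgm_fst j w, fgm_snd j w) : RR).
Proof. exact: (measurable_fun_pair (measurable_fgm_fst j) (measurable_fgm_snd j)). Qed.

Lemma fgm_mixture A : measurable A ->
  P ((fun w => (X w, Y w) : RR) @^-1` A) = (\sum_(j < 4) (fgm_weight j)%:num%:E *
    fgm_space ((fun w => (fgm_fst j w, fgm_snd j w)) @^-1` A))%E.
Proof.
have fin m : (m setT : \bar R) = 1%E -> (m setT < +oo)%E by move=> ->; rewrite ltry.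
apply: (ray2_measure_eq (m1 := law P mXY)
  (m2 := msum (fun j => mscale (fgm_weight j) (law fgm_space (mW j))) 4)).
- by rewrite ltey_eq fin_num_measure.
- rewrite /= /msum; apply: lte_sum_pinfty => j _.
  by apply: lte_mul_pinfty => //; rewrite ltey_eq fin_num_measure.
move=> x y.
have mXx : measurable (X @^-1` `]-oo, x]).
  by rewrite -[X in measurable X]setTI; apply: mX => //; exact: measurable_itv.
have mYy : measurable (Y @^-1` `]-oo, y]).
  by rewrite -[X in measurable X]setTI; apply: mY => //; exact: measurable_itv.
have mr (z : R) : measurable (`]-oo, z]%classic : set R) by exact: measurable_itv.
transitivity (Pr P [set w | X w <= x /\ Y w <= y])%:E.
  rewrite -Pr_fin; last by have := measurableI _ _ mXx mYy.
  by [].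
rewrite XY /= /msum.
have E j : (mscale (fgm_weight j) (law fgm_space (mW j))
    (`]-oo, x]%classic `*` `]-oo, y]%classic) =
  ((fgm_weight j)%:num * ((1 - tl fgm_space (fgm_fst j) x) *
    (1 - tl fgm_space (fgm_snd j) y)))%:E)%E.
  rewrite /mscale EFinM; congr (_ * _)%E.
  have I : indep fgm_space (fgm_fst j) (fgm_snd j).
    by apply: indep_prod; exact: measurable_pair_extremum.
  rewrite -!Pr_ray_tl; [|exact: measurable_fgm_snd|exact: measurable_fgm_fst].
  have ma : measurable (fgm_fst j @^-1` `]-oo, x]).
    by rewrite -[X in measurable X]setTI; exact: (measurable_fgm_fst j measurableT (mr x)).
  have mb : measurable (fgm_snd j @^-1` `]-oo, y]).
    by rewrite -[X in measurable X]setTI; exact: (measurable_fgm_snd j measurableT (mr y)).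
  by rewrite -I//; exact: (Pr_fin _ (measurableI _ _ ma mb)).
etransitivity; last by apply: eq_bigr => j _; exact: esym (E j).
rewrite sumEFin; congr (_%:E).
rewrite !big_ord_recl big_ord0 !tl_fgm_fst !tl_fgm_snd /=.
rewrite /FGM_df /tail !df_tl; lra.
Qed.

Lemma L1_fgm (h : RR -> R) : measurable_fun setT h ->
  (forall j, (j < 4)%N -> L1 fgm_space (fun w => h (fgm_fst j w, fgm_snd j w))) ->
  L1 P (fun w => h (X w, Y w)).
Proof. by move=> mh lh; apply: (L1_mixture mXY mW fgm_mixture). Qed.

Lemma Ex_fgm (h : RR -> R) : measurable_fun setT h ->
  (forall j, (j < 4)%N -> L1 fgm_space (fun w => h (fgm_fst j w, fgm_snd j w))) ->
  Ex P (fun w => h (X w, Y w)) = \sum_(j < 4) (fgm_weight j)%:num *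
    Ex fgm_space (fun w => h (fgm_fst j w, fgm_snd j w)).
Proof. by move=> mh lh; apply: (Ex_mixture mXY mW fgm_mixture). Qed.

End fgm_mixture.

(** * Blocks *)

Section fgm_block.
Context (R : realType) (F G : distr R) (r : R).
Hypothesis r1 : -1 <= r <= 1.
Hypotheses (F_S2 : S_2_tilde F) (G_S2 : S_2_tilde G).
Hypothesis F_tail : forall x, 0 < x -> 0 < tail F x.
Hypothesis FG_order : same_order (incr F 1) (incr G 1).
Context d (T : measurableType d) (P : probability T R) (X Y : T -> R).
Hypotheses (mX : measurable_fun setT X) (mY : measurable_fun setT Y).
Hypothesis XY : forall x y,
  Pr P [set w | X w <= x /\ Y w <= y] = FGM_df F G r x y.

Notation K := (pos_part F).
Notation p := (ic K id 1).
Notation RR := (measurableTypeR R * measurableTypeR R)%type.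
Notation Q := (fgm_space F G).
Notation wt := (fgm_weight r1).

Let rK : reference K := S2_tilde_reference F_S2 F_tail.
Let lF : L1 F id. Proof. by case: F_S2. Qed.
Let lG : L1 G id. Proof. by case: G_S2. Qed.

Lemma regular_fgm_fst j : regular K Q (fun _ : unit => fgm_fst j).
Proof.
apply: (regular_quadratic_tail rK (F := F) (C := 1) _ (tl_fgm_fst F G j)) => //.
- exact: (L1_prod_fst _ (L1_pair_extremum _ lF)).
- exact: S2_tilde_lin.
- near=> x; rewrite mul1r.
  have E : forall y, x <= y -> forall s, 0 <= s -> ic K id s y = ic F id s y.
    by near: x; exact: near_ic_pos_part.
  by rewrite E.
Unshelve. all: by end_near. Qed.

Lemma regular_fgm_snd j : regular K Q (fun _ : unit => fgm_snd j).
Proof.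
have [C C0 hC] := same_order_near F_S2 FG_order.
apply: (regular_quadratic_tail rK (F := G) (C := C) _ (tl_fgm_snd F G j)) => //.
- exact: (L1_prod_snd _ (L1_pair_extremum _ lG)).
- exact: S2_tilde_lin.
Qed.

Context (I : Type) (c e : I -> R) (al : R).
Hypothesis al0 : 0 < al.
Hypothesis c1 : forall i, c i = 0 \/ al <= c i <= 1.
Hypothesis e1 : forall i, e i = 0 \/ al <= e i <= 1.

Let U j i w := c i * fgm_fst j w.
Let V j i w := e i * fgm_snd j w.

Let rU j : regular K Q (U j) := regular_scale rK (regular_fgm_fst j) al0 c1.
Let rV j : regular K Q (V j) := regular_scale rK (regular_fgm_snd j) al0 e1.

Let UV j i : indep Q (U j i) (V j i).
Proof.
have mu : measurable_fun setT (fun w : RR => c i * pair_extremum (odd j) w).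
  by apply: measurable_funM => //; exact: measurable_pair_extremum.
have mv : measurable_fun setT (fun w : RR => e i * pair_extremum (1 < j)%N w).
  by apply: measurable_funM => //; exact: measurable_pair_extremum.
exact: (indep_prod (prodP F F) (prodP G G) mu mv).
Qed.

Let mfst : measurable_fun (setT : set RR) (fun z => z.1 : R).
Proof. exact: measurable_fst. Qed.
Let msnd : measurable_fun (setT : set RR) (fun z => z.2 : R).
Proof. exact: measurable_snd. Qed.

Let Ex_mix (f : RR -> R) : measurable_fun setT f ->
  (forall j, (j < 4)%N -> L1 Q (fun w => f (fgm_fst j w, fgm_snd j w))) ->
  L1 P (fun w => f (X w, Y w)) /\
  Ex P (fun w => f (X w, Y w)) = \sum_(j < 4) (wt j)%:num *
    Ex Q (fun w => f (fgm_fst j w, fgm_snd j w)).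
Proof.
by move=> mf lf; split; [exact: (L1_fgm r1 mX mY XY mf lf)|exact: (Ex_fgm r1 mX mY XY mf lf)].
Qed.

Let mix_fst i (h : R -> R) : measurable_fun setT h ->
  (forall j, (j < 4)%N -> L1 Q (fun w => h (U j i w))) ->
  L1 P (fun w => h (c i * X w)) /\
  Ex P (fun w => h (c i * X w)) = \sum_(j < 4) (wt j)%:num * Ex Q (fun w => h (U j i w)).
Proof.
move=> mh lh; apply: (Ex_mix (f := fun z => h (c i * z.1))) => //.
by apply: (measurableT_comp mh); exact: measurable_funM.
Qed.

Let mix_snd i (h : R -> R) : measurable_fun setT h ->
  (forall j, (j < 4)%N -> L1 Q (fun w => h (V j i w))) ->
  L1 P (fun w => h (e i * Y w)) /\
  Ex P (fun w => h (e i * Y w)) = \sum_(j < 4) (wt j)%:num * Ex Q (fun w => h (V j i w)).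
Proof.
move=> mh lh; apply: (Ex_mix (f := fun z => h (e i * z.2))) => //.
by apply: (measurableT_comp mh); exact: measurable_funM.
Qed.

Let mix_sum i (h : R -> R) : measurable_fun setT h ->
  (forall j, (j < 4)%N -> L1 Q (fun w => h (U j i w + V j i w))) ->
  L1 P (fun w => h (c i * X w + e i * Y w)) /\
  Ex P (fun w => h (c i * X w + e i * Y w)) =
  \sum_(j < 4) (wt j)%:num * Ex Q (fun w => h (U j i w + V j i w)).
Proof.
move=> mh lh; apply: (Ex_mix (f := fun z => h (c i * z.1 + e i * z.2))) => //.
by apply: (measurableT_comp mh); apply: measurable_funD; exact: measurable_funM.
Qed.

Let w0 j : 0 <= (wt j)%:num. Proof. by []. Qed.

Lemma regular_block_fst : regular K P (fun i w => c i * X w).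
Proof.
by apply: (regular_mix rK w0 _ rU mix_fst) => i; exact: measurable_funM.
Qed.

Lemma regular_block_snd : regular K P (fun i w => e i * Y w).
Proof.
by apply: (regular_mix rK w0 _ rV mix_snd) => i; exact: measurable_funM.
Qed.

Let rS j := regular_sum2 rK (rU j) (rV j) (UV j).

Lemma regular_block : regular K P (fun i w => c i * X w + e i * Y w).
Proof.
apply: (regular_mix rK w0 _ rS mix_sum) => i.
by apply: measurable_funD; exact: measurable_funM.
Qed.

Let mUj j i : measurable_fun setT (U j i) := reg_meas (rU j) i.
Let mVj j i : measurable_fun setT (V j i) := reg_meas (rV j) i.

Lemma incr_block t eps : 0 < eps -> \forall x \near +oo, forall i s, 0 <= s <= t ->
  `|ic P (fun w => c i * X w + e i * Y w) s x - ic P (fun w => c i * X w) s x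
    - ic P (fun w => e i * Y w) s x| <= eps * p x.
Proof.
pose S := \sum_(j < 4) (wt j)%:num + 1.
have S0 : 0 < S by rewrite ltr_wpDl// sumr_ge0.
move=> e0; have eS : 0 < eps / S by rewrite divr_gt0.
near=> x => i s st.
have p0 : 0 < p x by near: x; exact: ref_pos.
have h : forall j : 'I_4, forall i s, 0 <= s <= t ->
    `|ic Q (fun w => U j i w + V j i w) s x - ic Q (U j i) s x - ic Q (V j i) s x|
    <= eps / S * p x.
  near: x; apply: filter_forall => j; exact: (incr_sum2 rK (rU j) (rV j) (UV j)).
rewrite (ic_mix (k := fun j => (wt j)%:num) rS mix_sum)
  (ic_mix (k := fun j => (wt j)%:num) rU mix_fst)
  (ic_mix (k := fun j => (wt j)%:num) rV mix_snd) -!sumrB.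
apply: le_trans (ler_norm_sum _ _ _) _.
apply: (@le_trans _ _ (\sum_(j < 4) (wt j)%:num * (eps / S * p x))).
  apply: ler_sum => j _; rewrite -!mulrBr normrM ger0_norm// ler_wpM2l//.
  exact: h.
rewrite -mulr_suml [X in _ <= X](_ : _ = S * (eps / S * p x)); last first.
  by rewrite mulrA (mulrC S) divfK// gt_eqF.
by rewrite ler_wpM2r ?lerDl// mulr_ge0 ?ltW.
Unshelve. all: by end_near. Qed.

Let cross_fst i s x : 0 <= s -> cross P (fun w => c i * X w) (fun w => e i * Y w) s x =
  \sum_(j < 4) (wt j)%:num * (Ex Q (U j i) * ic Q (V j i) s x).
Proof.
move=> s0.
rewrite /cross (Ex_mix (f := fun z => c i * z.1 * (x < e i * z.2 <= x + s)%R%:R) _ _).2.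
- apply: eq_bigr => j _; congr (_ * _).
  by rewrite -(@cross_indep _ _ _ Q _ _ s x (reg_L1 (rU j) i) (mVj j i) (UV j i) s0).
- apply: measurable_funM; first exact: measurable_funM.
  apply: measurable_natb; apply: measurable_and.
    by apply: measurable_fun_ltr => //; exact: measurable_funM.
  by apply: measurable_fun_ler => //; exact: measurable_funM.
- move=> j _; have mV := mVj j i.
  apply: (L1M_natb (b := fun w => (x < V j i w <= x + s)%R)); last by meas.
  exact: reg_L1 (rU j) i.
Qed.

Let cross_snd i s x : 0 <= s -> cross P (fun w => e i * Y w) (fun w => c i * X w) s x =
  \sum_(j < 4) (wt j)%:num * (Ex Q (V j i) * ic Q (U j i) s x).
Proof.
move=> s0.
rewrite /cross (Ex_mix (f := fun z => e i * z.2 * (x < c i * z.1 <= x + s)%R%:R) _ _).2.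
- apply: eq_bigr => j _; congr (_ * _).
  by rewrite -(@cross_indep _ _ _ Q _ _ s x (reg_L1 (rV j) i) (mUj j i) (indepC (UV j i)) s0).
- apply: measurable_funM; first exact: measurable_funM.
  apply: measurable_natb; apply: measurable_and.
    by apply: measurable_fun_ltr => //; exact: measurable_funM.
  by apply: measurable_fun_ler => //; exact: measurable_funM.
- move=> j _; have mU := mUj j i.
  apply: (L1M_natb (b := fun w => (x < U j i w <= x + s)%R)); last by meas.
  exact: reg_L1 (rV j) i.
Qed.

(** Mix [tail_sum2] over the four components. Within a component the coordinates are independent, so
    the mean times the increment is a cross moment; being an expectation of a function of the pair,
    it mixes to the cross moment of the dependent pair. *)
Lemma tail_block : usmall K (fun i x => tl P (fun w => c i * X w + e i * Y w) x
  - tl P (fun w => c i * X w) x - tl P (fun w => e i * Y w) x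
  - cross P (fun w => c i * X w) (fun w => e i * Y w) 1 x
  - cross P (fun w => e i * Y w) (fun w => c i * X w) 1 x).
Proof.
apply: (@eq_usmall _ _ _ (fun i x => \sum_(j < 4) (wt j)%:num *
  (tl Q (fun w => U j i w + V j i w) x - tl Q (U j i) x - tl Q (V j i) x
   - Ex Q (V j i) * ic Q (U j i) 1 x - Ex Q (U j i) * ic Q (V j i) 1 x))).
  apply: nearW => x i.
  rewrite (tl_mix (k := fun j => (wt j)%:num) rS mix_sum)
    (tl_mix (k := fun j => (wt j)%:num) rU mix_fst)
    (tl_mix (k := fun j => (wt j)%:num) rV mix_snd).
  rewrite cross_fst// cross_snd// -!sumrB; apply: eq_bigr => j _; ring.
apply: usmall_sum => // j _.
apply: (@usmallM _ _ _ (fun _ _ => (wt j)%:num) (wt j)%:num).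
  by move=> i x; rewrite ger0_norm.
exact: (tail_sum2 rK (rU j) (rV j) (UV j)).
Qed.

(** In each mixture component the cross moment is a bounded mean times an increment and inherits the
    linearity of the latter in the window length. *)
Lemma cross_fst_lin t eps : 0 < eps -> \forall x \near +oo, forall i s, 0 <= s <= t ->
  `|cross P (fun w => c i * X w) (fun w => e i * Y w) s x
    - s * cross P (fun w => c i * X w) (fun w => e i * Y w) 1 x| <= eps * p x.
Proof.
move=> e0.
have /choice[M hM] : forall j : 'I_4, exists M, forall i, `|Ex Q (U j i)| <= M.
  by move=> j; exact: reg_Ex_bound (rU j).
pose S := \sum_(j < 4) (wt j)%:num * `|M j| + 1.
have S0 : 0 < S by rewrite ltr_wpDl// sumr_ge0// => j _; rewrite mulr_ge0.
have eS : 0 < eps / S by rewrite divr_gt0.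
near=> x => i s st.
have p0 : 0 < p x by near: x; exact: ref_pos.
have h : forall j : 'I_4, forall i s, 0 <= s <= t ->
    `|ic Q (V j i) s x - s * ic Q (V j i) 1 x| <= eps / S * p x.
  near: x; apply: filter_forall => j; exact: (reg_lin (rV j)).
have s0 : 0 <= s by case/andP: st.
rewrite !cross_fst// mulr_sumr -sumrB; apply: le_trans (ler_norm_sum _ _ _) _.
apply: (@le_trans _ _ (\sum_(j < 4) (wt j)%:num * `|M j| * (eps / S * p x))).
  apply: ler_sum => j _; rewrite (_ : _ - _ = (wt j)%:num * (Ex Q (U j i) *
      (ic Q (V j i) s x - s * ic Q (V j i) 1 x))); last by ring.
  rewrite (normrM (wt j)%:num) (ger0_norm (w0 j)) -mulrA ler_wpM2l//.
  rewrite normrM; apply: ler_pM => //; last exact: h.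
  by rewrite (le_trans (hM j i))// ler_norm.
rewrite -mulr_suml [X in _ <= X](_ : _ = S * (eps / S * p x)); last first.
  by rewrite mulrA (mulrC S) divfK// gt_eqF.
by rewrite ler_wpM2r ?lerDl// mulr_ge0 ?ltW.
Unshelve. all: by end_near. Qed.

Lemma cross_snd_lin t eps : 0 < eps -> \forall x \near +oo, forall i s, 0 <= s <= t ->
  `|cross P (fun w => e i * Y w) (fun w => c i * X w) s x
    - s * cross P (fun w => e i * Y w) (fun w => c i * X w) 1 x| <= eps * p x.
Proof.
move=> e0.
have /choice[M hM] : forall j : 'I_4, exists M, forall i, `|Ex Q (V j i)| <= M.
  by move=> j; exact: reg_Ex_bound (rV j).
pose S := \sum_(j < 4) (wt j)%:num * `|M j| + 1.
have S0 : 0 < S by rewrite ltr_wpDl// sumr_ge0// => j _; rewrite mulr_ge0.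
have eS : 0 < eps / S by rewrite divr_gt0.
near=> x => i s st.
have p0 : 0 < p x by near: x; exact: ref_pos.
have h : forall j : 'I_4, forall i s, 0 <= s <= t ->
    `|ic Q (U j i) s x - s * ic Q (U j i) 1 x| <= eps / S * p x.
  near: x; apply: filter_forall => j; exact: (reg_lin (rU j)).
have s0 : 0 <= s by case/andP: st.
rewrite !cross_snd// mulr_sumr -sumrB; apply: le_trans (ler_norm_sum _ _ _) _.
apply: (@le_trans _ _ (\sum_(j < 4) (wt j)%:num * `|M j| * (eps / S * p x))).
  apply: ler_sum => j _; rewrite (_ : _ - _ = (wt j)%:num * (Ex Q (V j i) *
      (ic Q (U j i) s x - s * ic Q (U j i) 1 x))); last by ring.
  rewrite (normrM (wt j)%:num) (ger0_norm (w0 j)) -mulrA ler_wpM2l//.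
  rewrite normrM; apply: ler_pM => //; last exact: h.
  by rewrite (le_trans (hM j i))// ler_norm.
rewrite -mulr_suml [X in _ <= X](_ : _ = S * (eps / S * p x)); last first.
  by rewrite mulrA (mulrC S) divfK// gt_eqF.
by rewrite ler_wpM2r ?lerDl// mulr_ge0 ?ltW.
Unshelve. all: by end_near. Qed.

End fgm_block.

(** * Sums with fixed weights *)

Section partial_sums.
Context d (T : measurableType d) (R : realType) (P : probability T R).
Context d' (E : measurableType d') (Z : nat -> T -> E).
Hypothesis mZ : forall i, measurable_fun setT (Z i).
Hypothesis Zind : mutually_independent P Z.

Let event (J : {fset nat}) (B : nat -> set E) : set T :=
  \bigcap_(i in [set` J]) Z i @^-1` B i.

Let mpre i A : measurable A -> measurable (Z i @^-1` A).
Proof. by move=> mA; rewrite -[X in measurable X]setTI; exact: mZ. Qed.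

Let mevent J B : (forall i, measurable (B i)) -> measurable (event J B).
Proof. by move=> mB; apply: fin_bigcap_measurable => // i _; exact: mpre. Qed.

Let eventU1 k J B C : k \notin J ->
  event (k |` J)%fset (fun i => if i == k then C else B i) = Z k @^-1` C `&` event J B.
Proof.
move=> kJ; apply/seteqP; split=> w.
  move=> h; split.
    by have := h k; rewrite /= eqxx; apply; exact: fset1U1.
  move=> i /= iJ; have := h i; rewrite /= fset1Ur// => /(_ isT).
  by case: eqP => // ik; move: kJ; rewrite -ik iJ.
move=> [wC wJ] i /=; rewrite in_fset1U; case: eqP => [-> //|_ /= iJ]; exact: wJ.
Qed.

Let event_Pr k J B C : (forall i, measurable (B i)) -> measurable C -> k \notin J ->
  Pr P (Z k @^-1` C `&` event J B) = Pr P (Z k @^-1` C) * Pr P (event J B).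
Proof.
move=> mB mC kJ; rewrite -eventU1// /event !Zind//; last by move=> i; case: ifP.
rewrite big_fsetU1//= eqxx; congr (_ * _).
rewrite big_seq [RHS]big_seq; apply: eq_bigr => i iJ.
by case: eqP => // ik; move: kJ; rewrite -ik iJ.
Qed.

Lemma indep_distinct i j : i != j -> indep P (Z i) (Z j).
Proof.
move=> ij A B mA mB.
have := @event_Pr i [fset j]%fset (fun=> B) A (fun=> mB) mA.
rewrite in_fset1 ij => /(_ isT).
have -> // : event [fset j]%fset (fun=> B) = Z j @^-1` B.
apply/seteqP; split=> w; first by move=> h; apply: h; rewrite /= in_fset1.
by move=> wB k /=; rewrite in_fset1 => /eqP ->.
Qed.

Variable phi : nat -> E -> R.
Hypothesis mphi : forall i, measurable_fun setT (phi i).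

Let S k w := \sum_(i < k) phi i (Z i w).

Let mphiZ i : measurable_fun setT (fun w => phi i (Z i w)).
Proof. exact: measurableT_comp. Qed.

Lemma measurable_partial_sum k : measurable_fun setT (S k).
Proof. by apply: measurable_sum => i; exact: mphiZ. Qed.

(** The induction needs independence from all cylinders on indices at least [k], not only from
    [Z k]: adding the term of index [k] uses the joint law of [S k] and [Z k] on an event about
    later indices. *)
Let S_event k : forall (J : {fset nat}) B (A : set R), (forall i, measurable (B i)) ->
  measurable A -> (forall j, j \in J -> (k <= j)%N) ->
  Pr P (S k @^-1` A `&` event J B) = Pr P (S k @^-1` A) * Pr P (event J B).
Proof.
elim: k => [|k IH] J B A mB mA Jk.
  have S0 w : S 0 w = 0 by rewrite /S big_ord0.
  have [A0|A0] := pselect (A 0).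
    have -> : S 0 @^-1` A = setT by apply/seteqP; split=> w //= _; rewrite S0.
    by rewrite setTI PrT mul1r.
  have -> : S 0 @^-1` A = set0 by apply/seteqP; split=> w //=; rewrite S0.
  by rewrite set0I /Pr measure0 mul0r.
have kJ : k \notin J by apply/negP => /Jk; rewrite ltnn.
have mSk := measurable_partial_sum k.
have mp : measurable_fun setT (fun w => (S k w, Z k w)).
  exact: (measurable_fun_pair mSk (mZ k)).
have mE := mevent J mB.
have e0 : 0 <= Pr P (event J B) by rewrite fine_ge0.
pose m2 := mscale (NngNum e0) (law P mp).
have mf : measurable_fun setT (fun z : R * E => z.1 + phi k z.2).
  apply: measurable_funD; first exact: measurable_fst.
  exact: (measurableT_comp (mphi k) measurable_snd).
have mA' : measurable ((fun z : R * E => z.1 + phi k z.2) @^-1` A).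
  by rewrite -[X in measurable X]setTI; exact: mf.
have SE : S k.+1 @^-1` A =
    (fun w => (S k w, Z k w)) @^-1` ((fun z : R * E => z.1 + phi k z.2) @^-1` A).
  by apply/seteqP; split=> w; rewrite /= /S big_ord_recr.
have Jk' j : j \in J -> (k <= j)%N by move=> /Jk; exact: ltnW.
(* The law of the pair restricted to the event is its full law times the probability of the event.
   This is checked on rectangles, then used on the preimage of [A] under the addition map, which is
   not a rectangle. *)
have key : forall X, measurable X -> push (mrestr P mE) mp X = m2 X.
  apply: prod_measure_eq.
    rewrite /= /pushforward /mrestr preimage_setT setTI.
    by rewrite ltey_eq fin_num_measure.
  move=> C D mC mD.
  have mSC : measurable (S k @^-1` C) by rewrite -[X in measurable X]setTI; exact: mSk.
  have mZD := mpre k mD.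
  transitivity (Pr P (S k @^-1` C `&` (Z k @^-1` D `&` event J B)))%:E.
    rewrite setIA -Pr_fin; first by [].
    by apply: measurableI => //; exact: measurableI.
  transitivity (Pr P (event J B) * Pr P (S k @^-1` C `&` Z k @^-1` D))%:E; last first.
    rewrite EFinM /m2 /mscale /=; congr (_ * _)%E.
    exact: esym (Pr_fin P (measurableI _ _ mSC mZD)).
  congr (_%:E).
  have mB' i : measurable (if i == k then D else B i) by case: ifP.
  rewrite -eventU1// IH//; last first.
    by move=> j; rewrite in_fset1U => /orP[/eqP ->//|]; exact: Jk'.
  rewrite eventU1// event_Pr//.
  have -> : Z k @^-1` D = event [fset k]%fset (fun=> D).
    apply/seteqP; split=> w; last by move=> h; apply: h; rewrite /= in_fset1.
    by move=> wB i /=; rewrite in_fset1 => /eqP ->.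
  rewrite IH//; last by move=> j; rewrite in_fset1 => /eqP ->.
  by rewrite [RHS]mulrC mulrA.
have := key _ mA'; rewrite /= /pushforward /mrestr /m2 /mscale /= => h.
have mS' : measurable (S k.+1 @^-1` A).
  by rewrite -[X in measurable X]setTI; exact: measurable_partial_sum.
apply: EFin_inj; rewrite mulrC EFinM.
transitivity (P (S k.+1 @^-1` A `&` event J B)).
  exact: esym (Pr_fin P (measurableI _ _ mS' mE)).
rewrite SE in mS' *; etransitivity; first exact: h.
by congr (_ * _)%E; exact: Pr_fin.
Qed.

Lemma indep_partial_sum k : indep P (S k) (Z k).
Proof.
move=> A B mA mB.
have -> : Z k @^-1` B = event [fset k]%fset (fun=> B).
  apply/seteqP; split=> w; last by move=> h; apply: h; rewrite /= in_fset1.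
  by move=> wB i /=; rewrite in_fset1 => /eqP ->.
by apply: S_event => // j; rewrite in_fset1 => /eqP ->.
Qed.

End partial_sums.

Lemma indep_comp d (T : measurableType d) (R : realType) (P : probability T R)
    d1 d2 d3 d4 (E1 : measurableType d1) (E2 : measurableType d2)
    (E3 : measurableType d3) (E4 : measurableType d4)
    (U : T -> E1) (V : T -> E2) (f : E1 -> E3) (g : E2 -> E4) :
  measurable_fun setT f -> measurable_fun setT g -> indep P U V ->
  indep P (fun w => f (U w)) (fun w => g (V w)).
Proof.
move=> mf mg UV A B mA mB.
have mfA : measurable (f @^-1` A) by rewrite -[X in measurable X]setTI; exact: mf.
have mgB : measurable (g @^-1` B) by rewrite -[X in measurable X]setTI; exact: mg.
exact: UV mfA mgB.
Qed.

Section scaling.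
Context d (T : measurableType d) (R : realType) (P : probability T R).
Implicit Types f g h : T -> R.

Lemma tl_scale (M x : R) f g : 0 < M -> (forall w, f w = M * g w) ->
  tl P f x = tl P g (x / M).
Proof. by move=> M0 fg; apply: eq_Ex => w; rewrite fg ltr_pdivrMr// mulrC. Qed.

Lemma ic_scale (M x : R) f g : 0 < M -> (forall w, f w = M * g w) ->
  ic P f 1 x = ic P g M^-1 (x / M).
Proof.
by move=> M0 fg; rewrite /ic !(tl_scale _ M0 fg) mulrDl mul1r.
Qed.

Lemma cross_scale (M x : R) f g f' g' : 0 < M -> L1 P f' -> measurable_fun setT g' ->
  (forall w, f w = M * f' w) -> (forall w, g w = M * g' w) ->
  cross P f g 1 x = M * cross P f' g' M^-1 (x / M).
Proof.
move=> M0 lf mg ff gg; rewrite -ExZl; last by apply: L1M_natb => //; meas.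
apply: eq_Ex => w; rewrite ff gg mulrA; congr (_ * _).
have -> : x / M + M^-1 = (x + 1) / M by rewrite mulrDl mul1r.
rewrite ltr_pdivrMr// ler_pdivlMr//.
by rewrite !(mulrC _ M).
Qed.

Lemma cross_cst (k s x : R) f : 0 <= s -> measurable_fun setT f ->
  cross P (fun=> k) f s x = k * ic P f s x.
Proof. by move=> s0 mf; rewrite ic_itv// -ExZl//; apply: L1_natb; meas. Qed.

Lemma tl0 x f : 0 <= x -> f =1 (fun=> 0) -> tl P f x = 0.
Proof.
move=> x0 f0; rewrite /tl -[RHS](Ex_cst P); apply: eq_Ex => w.
by rewrite f0 ltNge x0.
Qed.

Lemma ic0 s x f : 0 <= x -> 0 <= s -> f =1 (fun=> 0) -> ic P f s x = 0.
Proof. by move=> x0 s0 f0; rewrite /ic !tl0 ?addr_ge0// subrr. Qed.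

Lemma cross0l s x f g : f =1 (fun=> 0) -> cross P f g s x = 0.
Proof.
move=> f0; rewrite /cross -[RHS](Ex_cst P); apply: eq_Ex => w.
by rewrite f0 mul0r.
Qed.

Lemma cross0r s x f g : 0 <= x -> g =1 (fun=> 0) -> cross P f g s x = 0.
Proof.
move=> x0 g0; rewrite /cross -[RHS](Ex_cst P); apply: eq_Ex => w.
by rewrite g0 ltNge x0 mulr0.
Qed.

End scaling.

Lemma regular0 (R : realType) (K : distr R) (I : Type) d (T : measurableType d)
    (P : probability T R) : reference K -> regular K P (fun (_ : I) (_ : T) => 0).
Proof.
move=> rK.
split => //.
- by move=> _; exact: L1_cst.
- move=> e e0; exists 0 => _; rewrite (eq_Ex P (g := fun=> 0)) ?Ex_cst ?ltW// => w.
  by rewrite normr0 mul0r.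
- exists 1 => //; near=> x => _.
  have x0 : 0 <= x by near: x; apply: nbhs_pinfty_ge; exact: num_real.
  have p0 : 0 < ic K id 1 x by near: x; exact: ref_pos.
  by rewrite ic0// mul1r ltW.
- move=> t e e0; near=> x => _ s /andP[s0 _].
  have x0 : 0 <= x by near: x; apply: nbhs_pinfty_ge; exact: num_real.
  have p0 : 0 < ic K id 1 x by near: x; exact: ref_pos.
  by rewrite !(ic0 P)// mulr0 subrr normr0 mulr_ge0 ?ltW.
Unshelve. all: by end_near. Qed.

Lemma sum_offdiag (R : realType) (N : nat) (a b : 'I_N -> R) :
  \sum_(i < N) \sum_(j < N | j != i) a i * b j =
  (\sum_(i < N) a i) * (\sum_(i < N) b i) - \sum_(i < N) a i * b i.
Proof.
rewrite mulr_suml -sumrB; apply: eq_bigr => i _.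
by rewrite [X in _ = _ * X - _](bigD1 i)//= mulrDr mulr_sumr addrAC subrr add0r.
Qed.

Section fixed_weights.
Context (R : realType) (F G : distr R) (r : R).
Hypothesis r1 : -1 <= r <= 1.
Hypotheses (F_S2 : S_2_tilde F) (G_S2 : S_2_tilde G).
Hypothesis F_tail : forall x, 0 < x -> 0 < tail F x.
Hypothesis FG_order : same_order (incr F 1) (incr G 1).
Context d (T : measurableType d) (P : probability T R) (X Y : nat -> T -> R).
Hypotheses (mX : forall k, measurable_fun setT (X k)).
Hypotheses (mY : forall k, measurable_fun setT (Y k)).
Hypothesis X_law : forall k x, Pr P [set w | X k w <= x] = df F x.
Hypothesis Y_law : forall k x, Pr P [set w | Y k w <= x] = df G x.
Hypothesis XY : forall k x y,
  Pr P [set w | X k w <= x /\ Y k w <= y] = FGM_df F G r x y.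
Hypothesis XY_indep : mutually_independent P (fun k w => (X k w, Y k w)).

Notation K := (pos_part F).
Notation p := (ic K id 1).

Let rK : reference K := S2_tilde_reference F_S2 F_tail.

Lemma same_law (H : distr R) (Z : T -> R) (h : R -> R) : measurable_fun setT Z ->
  (forall x, Pr P [set w | Z w <= x] = df H x) ->
  measurable_fun setT h -> L1 H h ->
  L1 P (fun w => h (Z w)) /\ Ex P (fun w => h (Z w)) = Ex H h.
Proof.
move=> mZ ZH mh lh.
have HP A : measurable A -> H (id @^-1` A) = P (Z @^-1` A).
  move=> mA; apply/esym.
  have mZ' : measurable_fun setT (Z : T -> measurableTypeR R) by exact: mZ.
  apply: (@ray_measure_eq R (law P mZ') H _ _ _ A mA).
  - by rewrite /= ltey_eq fin_num_measure.
  - by rewrite /= ltey_eq fin_num_measure.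
  move=> x; have mr : measurable (`]-oo, x]%classic : set (measurableTypeR R)).
    exact: measurable_itv.
  have mZr : measurable (Z @^-1` `]-oo, x]).
    by rewrite -[X in measurable X]setTI; exact: mZ.
  transitivity (Pr P [set w | Z w <= x])%:E; first exact: (Pr_fin P mZr).
  by rewrite ZH /df; exact: esym (Pr_fin H mr).
have mid : measurable_fun (setT : set (measurableTypeR R)) (id : measurableTypeR R -> R).
  exact: measurable_id.
have [l E] := @eq_law _ _ _ _ _ _ _ H P id mid Z mZ h HP mh lh.
by split => //; rewrite -E.
Qed.

Let lF : L1 F id. Proof. by case: F_S2. Qed.
Let lG : L1 G id. Proof. by case: G_S2. Qed.

Lemma L1_X k : L1 P (X k).
Proof. exact: (same_law (mX k) (X_law k) (@measurable_id _ _ _) lF).1. Qed.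

Lemma L1_Y k : L1 P (Y k).
Proof. exact: (same_law (mY k) (Y_law k) (@measurable_id _ _ _) lG).1. Qed.

Lemma Ex_X k : Ex P (X k) = mean F.
Proof. exact: (same_law (mX k) (X_law k) (@measurable_id _ _ _) lF).2. Qed.

Lemma Ex_Y k : Ex P (Y k) = mean G.
Proof. exact: (same_law (mY k) (Y_law k) (@measurable_id _ _ _) lG).2. Qed.

Context (I : Type) (c e : I -> nat -> R) (al : R).
Hypothesis al0 : 0 < al.
Hypothesis c1 : forall i k, c i k = 0 \/ al <= c i k <= 1.
Hypothesis e1 : forall i k, e i k = 0 \/ al <= e i k <= 1.

Let U k i w := c i k * X k w.
Let V k i w := e i k * Y k w.
Let B k i w := U k i w + V k i w.
Let S k i w := \sum_(j < k) B j i w.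

Let rU k : regular K P (U k) := regular_block_fst r1 F_S2 F_tail
  (mX k) (mY k) (XY k) al0 (fun i => c1 i k).
Let rV k : regular K P (V k) := regular_block_snd r1 F_S2 G_S2 F_tail FG_order
  (mX k) (mY k) (XY k) al0 (fun i => e1 i k).
Let rB k : regular K P (B k) := regular_block r1 F_S2 G_S2 F_tail FG_order
  (mX k) (mY k) (XY k) al0 (fun i => c1 i k) (fun i => e1 i k).

Let mXY k : measurable_fun setT (fun w => (X k w, Y k w)).
Proof. exact: (measurable_fun_pair (mX k) (mY k)). Qed.

Let SB k i : indep P (S k i) (B k i).
Proof.
have mphi j : measurable_fun setT (fun z : R * R => c i j * z.1 + e i j * z.2) by meas.
have := indep_partial_sum mXY XY_indep mphi k.
exact: (@indep_comp _ _ _ _ _ _ _ _ _ _ _ _ _ _ id _ (@measurable_id _ _ _) (mphi k)).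
Qed.

Let Srec k : S k.+1 = (fun i w => S k i w + B k i w).
Proof. by apply/funext => i; apply/funext => w; rewrite /S big_ord_recr. Qed.

Lemma regular_sum k : regular K P (S k).
Proof.
elim: k => [|k IH].
  have -> : S 0 = (fun _ _ => 0).
    by apply/funext => i; apply/funext => w; rewrite /S big_ord0.
  exact: regular0.
by rewrite Srec; exact: (regular_sum2 rK IH (rB k) (SB k)).
Qed.

Let Ex_S k i : Ex P (S k i) = \sum_(j < k) Ex P (B j i).
Proof. by apply: Ex_sum => j _; exact: (reg_L1 (rB j) i). Qed.

Let incr_S k : usmall K (fun i x => ic P (S k i) 1 x - \sum_(j < k) ic P (B j i) 1 x).
Proof.
elim: k => [|k IH].
  apply: (eq_usmall _ (usmall_cst0 I rK)); near=> x => i.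
  have x0 : 0 <= x by near: x; apply: nbhs_pinfty_ge; exact: num_real.
  by rewrite big_ord0 ic0 ?subr0// => w; rewrite /S big_ord0.
have H : usmall K (fun i x => ic P (S k.+1 i) 1 x - ic P (S k i) 1 x - ic P (B k i) 1 x).
  move=> eps eps0; rewrite Srec.
  have := incr_sum2 rK (regular_sum k) (rB k) (SB k) 1 eps0.
  by apply: filterS => x h i; apply: h; rewrite lexx ler01.
apply: eq_usmall (usmallD IH H); apply: nearW => x i.
by rewrite big_ord_recr /=; ring.
Unshelve. all: by end_near. Qed.

(** The off-diagonal double sum is written as a product of sums minus the diagonal, which reduces
    the induction step to a ring identity once [incr_S] has replaced the increment of the partial
    sum. *)
Let tail_S k : usmall K (fun i x => tl P (S k i) x - \sum_(j < k) tl P (B j i) x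
  - ((\sum_(j < k) Ex P (B j i)) * (\sum_(j < k) ic P (B j i) 1 x)
     - \sum_(j < k) Ex P (B j i) * ic P (B j i) 1 x)).
Proof.
elim: k => [|k IH].
  apply: (eq_usmall _ (usmall_cst0 I rK)); near=> x => i.
  have x0 : 0 <= x by near: x; apply: nbhs_pinfty_ge; exact: num_real.
  by rewrite !big_ord0 mul0r !subr0 tl0// => w; rewrite /S big_ord0.
have H := tail_sum2 rK (regular_sum k) (rB k) (SB k).
have [M hM] := reg_Ex_bound (rB k).
have H2 := usmallM (k := fun i _ => Ex P (B k i)) (fun i _ => hM i) (incr_S k).
apply: eq_usmall (usmallD IH (usmallD H H2)); apply: nearW => x i.
rewrite Srec !big_ord_recr /= Ex_S; ring.
Unshelve. all: by end_near. Qed.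

Definition second_order N i s x : R :=
  mean F * (\sum_(j < N) \sum_(l < N | l != j) c i j * ic P (U l i) s x)
  + mean G * (\sum_(j < N) \sum_(l < N | l != j) e i j * ic P (V l i) s x)
  + \sum_(j < N) \sum_(l < N)
      (cross P (U j i) (V l i) s x + cross P (V l i) (U j i) s x).

Let Ex_U k i : Ex P (U k i) = c i k * mean F.
Proof. by rewrite /U ExZl ?Ex_X//; exact: L1_X. Qed.

Let Ex_V k i : Ex P (V k i) = e i k * mean G.
Proof. by rewrite /V ExZl ?Ex_Y//; exact: L1_Y. Qed.

Let indep_UV j l i : j != l -> indep P (U j i) (V l i).
Proof.
move=> jl; have := indep_distinct XY_indep jl.
apply: (@indep_comp _ _ _ _ _ _ _ _ _ _ _ _ _ _
  (fun z : R * R => c i j * z.1) (fun z => e i l * z.2)); meas.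
Qed.

Let cross_UV j l i s x : j != l -> 0 <= s ->
  cross P (U j i) (V l i) s x = c i j * mean F * ic P (V l i) s x.
Proof.
move=> jl s0; rewrite cross_indep ?Ex_U//; first exact: (reg_L1 (rU j) i).
  exact: (reg_meas (rV l) i).
exact: indep_UV.
Qed.

Let cross_VU j l i s x : j != l -> 0 <= s ->
  cross P (V l i) (U j i) s x = e i l * mean G * ic P (U j i) s x.
Proof.
move=> jl s0; rewrite cross_indep ?Ex_V//; first exact: (reg_L1 (rV l) i).
  exact: (reg_meas (rU j) i).
exact/indepC/indep_UV.
Qed.

(** Across distinct pairs the cross moments factor into a mean and an increment, so they merge with
    the first two sums into the off-diagonal products of block means and block increments. Only the
    cross moments within a pair survive. *)
Let second_orderE N i s x : 0 <= s -> second_order N i s x =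
  (\sum_(j < N) (c i j * mean F + e i j * mean G))
    * (\sum_(j < N) (ic P (U j i) s x + ic P (V j i) s x))
  - \sum_(j < N) (c i j * mean F + e i j * mean G) * (ic P (U j i) s x + ic P (V j i) s x)
  + \sum_(j < N) (cross P (U j i) (V j i) s x + cross P (V j i) (U j i) s x).
Proof.
move=> s0; rewrite /second_order !sum_offdiag.
have -> : \sum_(j < N) \sum_(l < N)
      (cross P (U j i) (V l i) s x + cross P (V l i) (U j i) s x) =
  \sum_(j < N) (cross P (U j i) (V j i) s x + cross P (V j i) (U j i) s x)
  + (\sum_(j < N) \sum_(l < N | l != j) (c i j * mean F) * ic P (V l i) s x
    + \sum_(j < N) \sum_(l < N | l != j) ic P (U j i) s x * (e i l * mean G)).
  rewrite -!big_split /=; apply: eq_bigr => j _.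
  rewrite (bigD1 j)//= -big_split /=; congr (_ + _); apply: eq_bigr => l lj.
  have jl : (j != l :> nat) by rewrite eq_sym.
  by rewrite cross_UV// cross_VU// (mulrC (ic _ _ _ _)).
rewrite !sum_offdiag.
rewrite (eq_bigr (fun j : 'I_N => c i j * mean F * ic P (U j i) s x
  + c i j * mean F * ic P (V j i) s x + e i j * mean G * ic P (U j i) s x
  + e i j * mean G * ic P (V j i) s x)
  (F1 := fun j : 'I_N => (c i j * mean F + e i j * mean G) * _)); last first.
  by move=> j _; ring.
rewrite !big_split /= -!mulr_suml.
have a1 : \sum_(j < N) c i j * mean F * ic P (U j i) s x =
  mean F * \sum_(j < N) c i j * ic P (U j i) s x.
  by rewrite mulr_sumr; apply: eq_bigr => j _; ring.
have a2 : \sum_(j < N) e i j * mean G * ic P (V j i) s x =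
  mean G * \sum_(j < N) e i j * ic P (V j i) s x.
  by rewrite mulr_sumr; apply: eq_bigr => j _; ring.
have a3 : \sum_(j < N) ic P (U j i) s x * (e i j * mean G) =
  \sum_(j < N) e i j * mean G * ic P (U j i) s x.
  by apply: eq_bigr => j _; ring.
rewrite a1 a2 a3; ring.
Qed.

(** After normalization the window has length 1 / M, depending on the weights, whereas
    [tail_expansion] has the unit window; hence a length [s i] that varies with [i]. Diagonal cross
    moments use the FGM blocks, the others factor. *)
Lemma second_order_lin N t : 0 <= t -> forall (s : I -> R), (forall i, 0 <= s i <= t) ->
  usmall K (fun i x => second_order N i (s i) x - s i * second_order N i 1 x).
Proof.
move=> t0 s st.
have s0 i : 0 <= s i by case/andP: (st i).
have lin (W : I -> T -> R) : regular K P W ->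
    usmall K (fun i x => ic P (W i) (s i) x - s i * ic P (W i) 1 x).
  by move=> rW eps eps0; apply: filterS (reg_lin rW t eps0) => x h i; exact: h.
have cb k i : `|c i k| <= 1.
  by case: (c1 i k) => [->|/andP[h1 h2]]; rewrite ?normr0// ger0_norm// (le_trans _ h1)// ltW.
have eb k i : `|e i k| <= 1.
  by case: (e1 i k) => [->|/andP[h1 h2]]; rewrite ?normr0// ger0_norm// (le_trans _ h1)// ltW.
have H1 : usmall K (fun i x => mean F * \sum_(j < N) \sum_(l < N | l != j)
    c i j * (ic P (U l i) (s i) x - s i * ic P (U l i) 1 x)).
  apply: (usmallM (k := fun _ _ => mean F) (M := `|mean F|)) => //.
  apply: usmall_sum => // j _; apply: usmall_sum => // l _.
  by apply: (usmallM (k := fun i _ => c i j) (M := 1)) => //; exact: lin.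
have H2 : usmall K (fun i x => mean G * \sum_(j < N) \sum_(l < N | l != j)
    e i j * (ic P (V l i) (s i) x - s i * ic P (V l i) 1 x)).
  apply: (usmallM (k := fun _ _ => mean G) (M := `|mean G|)) => //.
  apply: usmall_sum => // j _; apply: usmall_sum => // l _.
  by apply: (usmallM (k := fun i _ => e i j) (M := 1)) => //; exact: lin.
have C1 j l : usmall K (fun i x => cross P (U j i) (V l i) (s i) x
    - s i * cross P (U j i) (V l i) 1 x).
  have [->|jl] := eqVneq j l.
    move=> eps eps0; have := cross_fst_lin r1 F_S2 G_S2 F_tail FG_order (mX l) (mY l) (XY l)
      al0 (fun i => c1 i l) (fun i => e1 i l) t eps0.
    by apply: filterS => x h i; exact: h.
  apply: (@eq_usmall _ _ _ (fun i x => c i j *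
      (mean F * (ic P (V l i) (s i) x - s i * ic P (V l i) 1 x)))).
    by apply: nearW => x i; rewrite !cross_UV//; ring.
  apply: (usmallM (k := fun i _ => c i j) (M := 1)) => //.
  by apply: (usmallM (k := fun _ _ => mean F) (M := `|mean F|)) => //; exact: lin.
have C2 j l : usmall K (fun i x => cross P (V l i) (U j i) (s i) x
    - s i * cross P (V l i) (U j i) 1 x).
  have [->|jl] := eqVneq j l.
    move=> eps eps0; have := cross_snd_lin r1 F_S2 G_S2 F_tail FG_order (mX l) (mY l) (XY l)
      al0 (fun i => c1 i l) (fun i => e1 i l) t eps0.
    by apply: filterS => x h i; exact: h.
  apply: (@eq_usmall _ _ _ (fun i x => e i l *
      (mean G * (ic P (U j i) (s i) x - s i * ic P (U j i) 1 x)))).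
    by apply: nearW => x i; rewrite !cross_VU//; ring.
  apply: (usmallM (k := fun i _ => e i l) (M := 1)) => //.
  by apply: (usmallM (k := fun _ _ => mean G) (M := `|mean G|)) => //; exact: lin.
have H3 : usmall K (fun i x => \sum_(j < N) \sum_(l < N)
    ((cross P (U j i) (V l i) (s i) x - s i * cross P (U j i) (V l i) 1 x)
    + (cross P (V l i) (U j i) (s i) x - s i * cross P (V l i) (U j i) 1 x))).
  by apply: usmall_sum => // j _; apply: usmall_sum => // l _; exact: usmallD.
apply: eq_usmall (usmallD (usmallD H1 H2) H3); apply: nearW => x i.
have dist (a : nat -> R) (f g : nat -> R) :
    \sum_(j < N) \sum_(l < N | l != j) a j * (f l - s i * g l) =
    \sum_(j < N) \sum_(l < N | l != j) a j * f l
    - s i * \sum_(j < N) \sum_(l < N | l != j) a j * g l.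
  rewrite mulr_sumr -sumrB; apply: eq_bigr => j _.
  by rewrite mulr_sumr -sumrB; apply: eq_bigr => l _; ring.
have dist2 (f g f' g' : nat -> nat -> R) :
    \sum_(j < N) \sum_(l < N) ((f j l - s i * g j l) + (f' j l - s i * g' j l)) =
    \sum_(j < N) \sum_(l < N) (f j l + f' j l)
    - s i * \sum_(j < N) \sum_(l < N) (g j l + g' j l).
  rewrite mulr_sumr -sumrB; apply: eq_bigr => j _.
  by rewrite mulr_sumr -sumrB; apply: eq_bigr => l _; ring.
rewrite (dist (c i) (fun l => ic P (U l i) (s i) x) (fun l => ic P (U l i) 1 x)).
rewrite (dist (e i) (fun l => ic P (V l i) (s i) x) (fun l => ic P (V l i) 1 x)).
rewrite (dist2 (fun j l => cross P (U j i) (V l i) (s i) x)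
  (fun j l => cross P (U j i) (V l i) 1 x) (fun j l => cross P (V l i) (U j i) (s i) x)
  (fun j l => cross P (V l i) (U j i) 1 x)).
rewrite /second_order; ring.
Qed.

(** Start from [tail_S] and open the blocks: [H1] opens their tails, while [H2] and [H3] open their
    increments in the product of sums and in the diagonal that is subtracted from it. *)
Lemma tail_expansion N : usmall K (fun i x => tl P (S N i) x
  - (\sum_(j < N) tl P (U j i) x + \sum_(j < N) tl P (V j i) x)
  - second_order N i 1 x).
Proof.
have HB j : usmall K (fun i x => tl P (B j i) x - tl P (U j i) x - tl P (V j i) x
    - cross P (U j i) (V j i) 1 x - cross P (V j i) (U j i) 1 x).
  exact: (tail_block r1 F_S2 G_S2 F_tail FG_order (mX j) (mY j) (XY j) al0
    (fun i => c1 i j) (fun i => e1 i j)).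
have HI j : usmall K (fun i x => ic P (B j i) 1 x - ic P (U j i) 1 x - ic P (V j i) 1 x).
  move=> eps eps0; have := incr_block r1 F_S2 G_S2 F_tail FG_order (mX j) (mY j) (XY j) al0
    (fun i => c1 i j) (fun i => e1 i j) 1 eps0.
  by apply: filterS => x h i; apply: h; rewrite lexx ler01.
have [M hM] : exists M, forall i, `|Ex P (S N i)| <= M := reg_Ex_bound (regular_sum N).
have H1 : usmall K (fun i x => \sum_(j < N) (tl P (B j i) x - tl P (U j i) x - tl P (V j i) x
    - cross P (U j i) (V j i) 1 x - cross P (V j i) (U j i) 1 x)).
  by apply: usmall_sum.
have H2 : usmall K (fun i x => Ex P (S N i) *
    \sum_(j < N) (ic P (B j i) 1 x - ic P (U j i) 1 x - ic P (V j i) 1 x)).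
  apply: (usmallM (k := fun i _ => Ex P (S N i)) (fun i _ => hM i)).
  exact: usmall_sum.
have H3 : usmall K (fun i x => \sum_(j < N) Ex P (B j i) *
    (ic P (B j i) 1 x - ic P (U j i) 1 x - ic P (V j i) 1 x)).
  apply: usmall_sum => // j _; have [Mj hMj] := reg_Ex_bound (rB j).
  exact: (usmallM (k := fun i _ => Ex P (B j i)) (fun i _ => hMj i)).
apply: eq_usmall (usmallD (usmallB (usmallD (tail_S N) H1) H3) H2).
apply: nearW => x i; rewrite second_orderE// Ex_S.
have EB j : Ex P (B j i) = c i j * mean F + e i j * mean G.
  by rewrite /B ExD ?Ex_U ?Ex_V//; [exact: (reg_L1 (rU j) i)|exact: (reg_L1 (rV j) i)].
rewrite (eq_bigr (fun j : 'I_N => c i j * mean F + e i j * mean G)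
  (F1 := fun j : 'I_N => Ex P (B j i)));
  last by move=> j _; exact: EB.
have s1 : \sum_(j < N) (ic P (B j i) 1 x - ic P (U j i) 1 x - ic P (V j i) 1 x) =
  \sum_(j < N) ic P (B j i) 1 x - \sum_(j < N) (ic P (U j i) 1 x + ic P (V j i) 1 x).
  by rewrite -sumrB; apply: eq_bigr => j _; ring.
have s2 : \sum_(j < N) Ex P (B j i) * (ic P (B j i) 1 x - ic P (U j i) 1 x - ic P (V j i) 1 x) =
  \sum_(j < N) Ex P (B j i) * ic P (B j i) 1 x
  - \sum_(j < N) (c i j * mean F + e i j * mean G) * (ic P (U j i) 1 x + ic P (V j i) 1 x).
  by rewrite -sumrB; apply: eq_bigr => j _; rewrite EB; ring.
have s3 : \sum_(j < N) (tl P (B j i) x - tl P (U j i) x - tl P (V j i) x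
    - cross P (U j i) (V j i) 1 x - cross P (V j i) (U j i) 1 x) =
  \sum_(j < N) tl P (B j i) x - \sum_(j < N) tl P (U j i) x - \sum_(j < N) tl P (V j i) x
  - \sum_(j < N) (cross P (U j i) (V j i) 1 x + cross P (V j i) (U j i) 1 x).
  by rewrite -!sumrB; apply: eq_bigr => j _; ring.
rewrite s1 s2 s3; ring.
Qed.

End fixed_weights.

(** * Random weights *)

Lemma measurable_bigsum d (T : measurableType d) (R : realType) (I : Type) (s : seq I)
    (D : pred I) (f : I -> T -> R) : (forall i, measurable_fun setT (f i)) ->
  measurable_fun setT (fun w => \sum_(i <- s | D i) f i w).
Proof.
move=> mf; elim: s => [|k s IH].
  rewrite (_ : (fun _ => _) = fun=> 0); first exact: measurable_cst.
  by apply/funext => w; rewrite big_nil.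
rewrite (_ : (fun _ => _) = fun w =>
    (if D k then f k w else 0) + \sum_(i <- s | D i) f i w); last first.
  by apply/funext => w; rewrite big_cons; case: ifP; rewrite ?add0r.
by apply: measurable_funD => //; case: (D k).
Qed.

Section remainder.
Context (R : realType) (n m : nat) (muF muG : R).

(** The difference of both sides of the expansion before taking expectations, as a function of
    values of the variables and weights. Fixed and random weights then share one integrand, and
    conditioning on the weights is a single use of Fubini. *)
Definition remainder (x : R) (X Y c e : nat -> R) : R :=
  (x < \sum_(i < n) c i * X i + \sum_(j < m) e j * Y j)%R%:R
  - (\sum_(i < n) (x < c i * X i)%R%:R + \sum_(j < m) (x < e j * Y j)%R%:R
    + muF * (\sum_(i < n) \sum_(l < n | l != i) c i * (x < c l * X l <= x + 1)%R%:R)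
    + muG * (\sum_(j < m) \sum_(l < m | l != j) e j * (x < e l * Y l <= x + 1)%R%:R)
    + \sum_(i < n) \sum_(j < m) (c i * X i * (x < e j * Y j <= x + 1)%R%:R
                               + e j * Y j * (x < c i * X i <= x + 1)%R%:R)).

Definition increments (x : R) (X Y c e : nat -> R) : R :=
  \sum_(i < n) (x < c i * X i <= x + 1)%R%:R + \sum_(j < m) (x < e j * Y j <= x + 1)%R%:R.

Lemma measurable_remainder d (T : measurableType d) x (X Y c e : nat -> T -> R) :
  (forall k, measurable_fun setT (X k)) -> (forall k, measurable_fun setT (Y k)) ->
  (forall k, measurable_fun setT (c k)) -> (forall k, measurable_fun setT (e k)) ->
  measurable_fun setT (fun w => remainder x (X^~ w) (Y^~ w) (c^~ w) (e^~ w)).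
Proof.
move=> mX mY mc me.
have mcX k : measurable_fun setT (fun w => c k w * X k w) by exact: measurable_funM.
have meY k : measurable_fun setT (fun w => e k w * Y k w) by exact: measurable_funM.
have itv (f : T -> R) : measurable_fun setT f ->
    measurable_fun setT (fun w => (x < f w <= x + 1)%R%:R : R) by move=> mf; meas.
apply: measurable_funB.
  apply: measurable_natb; apply: measurable_fun_ltr => //.
  by apply: measurable_funD; apply: measurable_bigsum.
apply: measurable_funD; last first.
  apply: measurable_bigsum => i; apply: measurable_bigsum => j.
  by apply: measurable_funD; apply: measurable_funM => //; exact: itv.
apply: measurable_funD; last first.
  apply: measurable_funM => //; apply: measurable_bigsum => i; apply: measurable_bigsum => j.
  by apply: measurable_funM => //; exact: itv.
apply: measurable_funD; last first.
  apply: measurable_funM => //; apply: measurable_bigsum => i; apply: measurable_bigsum => j.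
  by apply: measurable_funM => //; exact: itv.
by apply: measurable_funD; apply: measurable_bigsum => i;
  apply: measurable_natb; apply: measurable_fun_ltr.
Qed.

Lemma measurable_increments d (T : measurableType d) x (X Y c e : nat -> T -> R) :
  (forall k, measurable_fun setT (X k)) -> (forall k, measurable_fun setT (Y k)) ->
  (forall k, measurable_fun setT (c k)) -> (forall k, measurable_fun setT (e k)) ->
  measurable_fun setT (fun w => increments x (X^~ w) (Y^~ w) (c^~ w) (e^~ w)).
Proof.
move=> mX mY mc me.
have mcX k : measurable_fun setT (fun w => c k w * X k w) by exact: measurable_funM.
have meY k : measurable_fun setT (fun w => e k w * Y k w) by exact: measurable_funM.
have itv (f : T -> R) : measurable_fun setT f ->
    measurable_fun setT (fun w => (x < f w <= x + 1)%R%:R : R) by move=> mf; meas.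
by apply: measurable_funD; apply: measurable_bigsum => k; exact: itv.
Qed.

Context d (T : measurableType d) (P : probability T R) (X Y c e : nat -> T -> R) (b : R).
Hypotheses (lX : forall k, L1 P (X k)) (lY : forall k, L1 P (Y k)).
Hypotheses (mc : forall k, measurable_fun setT (c k)).
Hypotheses (me : forall k, measurable_fun setT (e k)).
Hypotheses (cb : forall k w, `|c k w| <= b) (eb : forall k w, `|e k w| <= b).

Let cX k w := c k w * X k w.
Let eY k w := e k w * Y k w.

Let lcX k : L1 P (cX k).
Proof.
apply: (@eq_L1 _ _ _ _ (fun w => X k w * c k w)) => [w|]; first by rewrite mulrC.
exact: L1M_bounded (lX k) (mc k) (cb k).
Qed.

Let leY k : L1 P (eY k).
Proof.
apply: (@eq_L1 _ _ _ _ (fun w => Y k w * e k w)) => [w|]; first by rewrite mulrC.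
exact: L1M_bounded (lY k) (me k) (eb k).
Qed.

Let L1_tlb (U : T -> R) x : measurable_fun setT U -> L1 P (fun w => (x < U w)%R%:R).
Proof. by move=> mU; apply: L1_natb; meas. Qed.

Let L1_itv (U : T -> R) x : measurable_fun setT U -> L1 P (fun w => (x < U w <= x + 1)%R%:R).
Proof. by move=> mU; apply: L1_natb; meas. Qed.

Let L1M_itv (V U : T -> R) x : L1 P V -> measurable_fun setT U ->
  L1 P (fun w => V w * (x < U w <= x + 1)%R%:R).
Proof. by move=> lV mU; apply: L1M_natb => //; meas. Qed.

Let lc k : L1 P (c k). Proof. exact: (L1_bounded _ (mc k) (cb k)). Qed.
Let le' k : L1 P (e k). Proof. exact: (L1_bounded _ (me k) (eb k)). Qed.

Let mcX k : measurable_fun setT (cX k) := L1_measurable (lcX k).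
Let meY k : measurable_fun setT (eY k) := L1_measurable (leY k).

Let l1 x : L1 P (fun w => (x < \sum_(i < n) cX i w + \sum_(j < m) eY j w)%R%:R).
Proof. by apply: L1_tlb; apply: measurable_funD; exact: measurable_bigsum. Qed.
Let l2 x : L1 P (fun w => \sum_(i < n) (x < cX i w)%R%:R).
Proof. by apply: L1_sum => i _; exact: L1_tlb. Qed.
Let l3 x : L1 P (fun w => \sum_(j < m) (x < eY j w)%R%:R).
Proof. by apply: L1_sum => i _; exact: L1_tlb. Qed.
Let l4 x : L1 P (fun w => \sum_(i < n) \sum_(l < n | l != i)
  c i w * (x < cX l w <= x + 1)%R%:R).
Proof. by apply: L1_sum => i _; apply: L1_sum => l _; exact: L1M_itv. Qed.
Let l5 x : L1 P (fun w => \sum_(i < m) \sum_(l < m | l != i)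
  e i w * (x < eY l w <= x + 1)%R%:R).
Proof. by apply: L1_sum => i _; apply: L1_sum => l _; exact: L1M_itv. Qed.
Let l6 x : L1 P (fun w => \sum_(i < n) \sum_(j < m)
  (cX i w * (x < eY j w <= x + 1)%R%:R + eY j w * (x < cX i w <= x + 1)%R%:R)).
Proof. by apply: L1_sum => i _; apply: L1_sum => l _; apply: L1D; exact: L1M_itv. Qed.
Let l23 x := L1D (l2 x) (l3 x).
Let l234 x := L1D (l23 x) (L1Zl muF (l4 x)).
Let l2345 x := L1D (l234 x) (L1Zl muG (l5 x)).
Let l23456 x := L1D (l2345 x) (l6 x).

Lemma L1_remainder x : L1 P (fun w => remainder x (X^~ w) (Y^~ w) (c^~ w) (e^~ w)).
Proof. exact: L1B (l1 x) (l23456 x). Qed.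

Lemma Ex_remainder x :
  Ex P (fun w => remainder x (X^~ w) (Y^~ w) (c^~ w) (e^~ w)) =
  tl P (fun w => \sum_(i < n) cX i w + \sum_(j < m) eY j w) x
  - (\sum_(i < n) tl P (cX i) x + \sum_(j < m) tl P (eY j) x
    + muF * (\sum_(i < n) \sum_(l < n | l != i) cross P (c i) (cX l) 1 x)
    + muG * (\sum_(j < m) \sum_(l < m | l != j) cross P (e j) (eY l) 1 x)
    + \sum_(i < n) \sum_(j < m) (cross P (cX i) (eY j) 1 x + cross P (eY j) (cX i) 1 x)).
Proof.
rewrite [LHS](ExB (l1 x) (l23456 x)) (ExD (l2345 x) (l6 x)).
rewrite (ExD (l234 x) (L1Zl muG (l5 x))) (ExD (l23 x) (L1Zl muF (l4 x))).
rewrite (ExD (l2 x) (l3 x)) (ExZl muF (l4 x)) (ExZl muG (l5 x)).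
congr (_ - (_ + _ + _ * _ + _ * _ + _)).
- by rewrite Ex_sum//; move=> i _; exact: L1_tlb.
- by rewrite Ex_sum//; move=> i _; exact: L1_tlb.
- rewrite Ex_sum => [|i _]; last by apply: L1_sum => l _; exact: L1M_itv.
  by apply: eq_bigr => i _; rewrite Ex_sum//; move=> l _; exact: L1M_itv.
- rewrite Ex_sum => [|i _]; last by apply: L1_sum => l _; exact: L1M_itv.
  by apply: eq_bigr => i _; rewrite Ex_sum//; move=> l _; exact: L1M_itv.
- rewrite Ex_sum => [|i _]; last first.
    by apply: L1_sum => l _; apply: L1D; exact: L1M_itv.
  apply: eq_bigr => i _; rewrite Ex_sum => [|l _]; last by apply: L1D; exact: L1M_itv.
  by apply: eq_bigr => l _; rewrite ExD//; exact: L1M_itv.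
Qed.

Let lX1 x : L1 P (fun w => \sum_(i < n) (x < cX i w <= x + 1)%R%:R).
Proof. by apply: L1_sum => i _; exact: L1_itv. Qed.
Let lY1 x : L1 P (fun w => \sum_(j < m) (x < eY j w <= x + 1)%R%:R).
Proof. by apply: L1_sum => i _; exact: L1_itv. Qed.

Lemma L1_increments x : L1 P (fun w => increments x (X^~ w) (Y^~ w) (c^~ w) (e^~ w)).
Proof. exact: (L1D (lX1 x) (lY1 x)). Qed.

Lemma Ex_increments x :
  Ex P (fun w => increments x (X^~ w) (Y^~ w) (c^~ w) (e^~ w)) =
  \sum_(i < n) ic P (cX i) 1 x + \sum_(j < m) ic P (eY j) 1 x.
Proof.
rewrite [LHS](ExD (lX1 x) (lY1 x)).
by congr (_ + _); rewrite Ex_sum => [|i _]; try exact: L1_itv;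
  apply: eq_bigr => i _; rewrite ic_itv.
Qed.

End remainder.

(** * Normalization by the largest weight *)

Section finite_sums.
Context (R : realType).

Lemma max_two_families n m (f g : nat -> R) : (0 < n)%N -> (0 < m)%N ->
  exists M, [/\ forall k, (k < n)%N -> f k <= M, forall k, (k < m)%N -> g k <= M &
    (exists2 k, (k < n)%N & f k = M) \/ (exists2 k, (k < m)%N & g k = M)].
Proof.
move=> n0 m0.
have fmax h N : (0 < N)%N -> exists2 k, (k < N)%N & forall l : nat, (l < N)%N -> h l <= h k :> R.
  move=> N0; case: (@arg_maxP _ R _ (Ordinal N0) xpredT (fun j : 'I_N => h j) isT) => k _ hk.
  by exists k => // l lN; exact: (hk (Ordinal lN)).
have [k kn fk] := fmax f n n0; have [l lm gl] := fmax g m m0.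
have [fg|gf] := leP (f k) (g l).
  exists (g l); split => //; last by right; exists l.
  by move=> j /fk /le_trans; apply.
exists (f k); split => //; last by left; exists k.
by move=> j /gl /le_trans; apply; exact: ltW.
Qed.

Lemma normalized_range (a b M w : R) (t : bool) : 0 < a -> a <= M <= b -> a <= w ->
  (t -> w <= M) -> let c := if t then w / M else 0 in c = 0 \/ a / b <= c <= 1.
Proof.
move=> a0 /andP[aM Mb] aw; case: t => /= [/(_ isT) wM|_]; [right|by left].
have M0 : 0 < M by exact: lt_le_trans aM.
have b0 : 0 < b by exact: lt_le_trans Mb.
apply/andP; split; last by rewrite ler_pdivrMr// mul1r.
by apply: ler_pM => //; rewrite ?lef_pV2 ?posrE ?invr_ge0// ltW.
Qed.

Lemma sum_widen n N (f : nat -> R) : (n <= N)%N ->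
  \sum_(i < n) f i = \sum_(i < N) (if (i < n)%N then f i else 0).
Proof. by move=> nN; rewrite (big_ord_widen N f nN) big_mkcond. Qed.

Lemma sum_widen_offdiag n N (f : nat -> nat -> R) : (n <= N)%N ->
  \sum_(i < n) \sum_(l < n | l != i) f i l =
  \sum_(i < N) \sum_(l < N | l != i) (if (i < n)%N && (l < n)%N then f i l else 0).
Proof.
move=> nN.
rewrite (eq_bigr (fun i : 'I_n => \sum_(l < n) (if (l != i :> nat) then f i l else 0)));
  last by move=> i _; rewrite big_mkcond.
rewrite (sum_widen (fun i => \sum_(l < n) (if (l != i :> nat) then f i l else 0)) nN).
apply: eq_bigr => i _; rewrite [RHS]big_mkcond; case: ifP => i_n; last first.
  by rewrite big1// => l _; case: ifP.
rewrite (sum_widen (fun l => if (l != i :> nat) then f i l else 0) nN).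
by apply: eq_bigr => l _; rewrite /= -val_eqE; case: (l < n)%N; case: ifP.
Qed.

Lemma sum2_widen n m N (f : nat -> nat -> R) : (n <= N)%N -> (m <= N)%N ->
  \sum_(i < n) \sum_(j < m) f i j =
  \sum_(i < N) \sum_(j < N) (if (i < n)%N && (j < m)%N then f i j else 0).
Proof.
move=> nN mN; rewrite (sum_widen (fun i => \sum_(j < m) f i j) nN).
apply: eq_bigr => i _; case: ifP => i_n; last by rewrite big1.
by rewrite (sum_widen (f i) mN).
Qed.

End finite_sums.

Section uniform_expansion.
Context (R : realType) (F G : distr R) (r : R).
Hypothesis r1 : -1 <= r <= 1.
Hypotheses (F_S2 : S_2_tilde F) (G_S2 : S_2_tilde G).
Hypothesis F_tail : forall x, 0 < x -> 0 < tail F x.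
Hypothesis FG_order : same_order (incr F 1) (incr G 1).
Context d (T : measurableType d) (P : probability T R) (X Y : nat -> T -> R).
Hypotheses (mX : forall k, measurable_fun setT (X k)).
Hypotheses (mY : forall k, measurable_fun setT (Y k)).
Hypothesis X_law : forall k x, Pr P [set w | X k w <= x] = df F x.
Hypothesis Y_law : forall k x, Pr P [set w | Y k w <= x] = df G x.
Hypothesis XY : forall k x y,
  Pr P [set w | X k w <= x /\ Y k w <= y] = FGM_df F G r x y.
Hypothesis XY_indep : mutually_independent P (fun k w => (X k w, Y k w)).
Context (I : Type) (u v : I -> nat -> R) (a b : R) (n m : nat).
Hypotheses (a0 : 0 < a) (ab : a <= b) (n0 : (0 < n)%N) (m0 : (0 < m)%N).
Hypothesis uab : forall i k, a <= u i k <= b.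
Hypothesis vab : forall i k, a <= v i k <= b.

Notation K := (pos_part F).
Notation p := (ic K id 1).

Let rK : reference K := S2_tilde_reference F_S2 F_tail.
Let lX k : L1 P (X k) := L1_X F_S2 mX X_law k.
Let lY k : L1 P (Y k) := L1_Y G_S2 mY Y_law k.

Let weights : exists M : I -> R, forall i, [/\ a <= M i <= b,
  forall k, (k < n)%N -> u i k <= M i, forall k, (k < m)%N -> v i k <= M i &
  (exists2 k, (k < n)%N & u i k = M i) \/ (exists2 k, (k < m)%N & v i k = M i)].
Proof.
suff /choice[M hM] : forall i, exists M, [/\ a <= M <= b,
    forall k, (k < n)%N -> u i k <= M, forall k, (k < m)%N -> v i k <= M &
    (exists2 k, (k < n)%N & u i k = M) \/ (exists2 k, (k < m)%N & v i k = M)].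
  by exists M.
move=> i; have [M [h1 h2 h3]] := max_two_families (u i) (v i) n0 m0.
exists M; split => //.
by case: h3 => -[k _ <-]; [exact: uab|exact: vab].
Qed.

Section normalized.
Variable M : I -> R.
Hypothesis Mab : forall i, a <= M i <= b.

Let c i k := if (k < n)%N then u i k / M i else 0.
Let e i k := if (k < m)%N then v i k / M i else 0.

Let M0 i : 0 < M i. Proof. by case/andP: (Mab i) => h _; exact: lt_le_trans h. Qed.
Let N := maxn n m.
Let nN : (n <= N)%N. Proof. exact: leq_maxl. Qed.
Let mN : (m <= N)%N. Proof. exact: leq_maxr. Qed.

Let cE i k w : (k < n)%N -> u i k * X k w = M i * (c i k * X k w).
Proof. by move=> kn; rewrite /c kn mulrA (mulrC (M i)) divfK// gt_eqF. Qed.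
Let eE i k w : (k < m)%N -> v i k * Y k w = M i * (e i k * Y k w).
Proof. by move=> km; rewrite /e km mulrA (mulrC (M i)) divfK// gt_eqF. Qed.
Let c0 i k w : (k < n)%N = false -> c i k * X k w = 0.
Proof. by rewrite /c => ->; rewrite mul0r. Qed.
Let e0 i k w : (k < m)%N = false -> e i k * Y k w = 0.
Proof. by rewrite /e => ->; rewrite mul0r. Qed.

Let mcX i k : measurable_fun setT (fun w => c i k * X k w).
Proof. exact: measurable_funM. Qed.
Let meY i k : measurable_fun setT (fun w => e i k * Y k w).
Proof. exact: measurable_funM. Qed.
Let lcX i k : L1 P (fun w => c i k * X k w). Proof. exact: L1Zl. Qed.
Let leY i k : L1 P (fun w => e i k * Y k w). Proof. exact: L1Zl. Qed.

Let ub i k : `|u i k| <= b.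
Proof. by case/andP: (uab i k) => h1 h2; rewrite ger0_norm// (le_trans _ h1)// ltW. Qed.
Let vb i k : `|v i k| <= b.
Proof. by case/andP: (vab i k) => h1 h2; rewrite ger0_norm// (le_trans _ h1)// ltW. Qed.

(** Scaling leaves tails unchanged at [x / M i], whereas the second-order terms are homogeneous of
    degree one in the factor outside the indicator, whence the coefficient [M i]. The zero weights
    added up to [N] contribute nothing because [x >= 0]. *)
Lemma Ex_remainder_normalized i x : 0 <= x ->
  Ex P (fun w => remainder n m (mean F) (mean G) x (X^~ w) (Y^~ w) (u i) (v i)) =
  tl P (fun w => \sum_(j < N) (c i j * X j w + e i j * Y j w)) (x / M i)
  - (\sum_(j < N) tl P (fun w => c i j * X j w) (x / M i)
     + \sum_(j < N) tl P (fun w => e i j * Y j w) (x / M i))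
  - M i * second_order F G P X Y c e N i (M i)^-1 (x / M i).
Proof.
move=> x0; have z0 : 0 <= x / M i by rewrite divr_ge0// ltW.
have s0 : 0 <= (M i)^-1 by rewrite invr_ge0 ltW.
rewrite (@Ex_remainder _ n m (mean F) (mean G) _ _ P X Y (fun k _ => u i k) (fun k _ => v i k) b
  lX lY _ _ (fun k _ => ub i k) (fun k _ => vb i k)) => //.
have -> : tl P (fun w => \sum_(j < n) u i j * X j w + \sum_(j < m) v i j * Y j w) x =
    tl P (fun w => \sum_(j < N) (c i j * X j w + e i j * Y j w)) (x / M i).
  apply: tl_scale => // w; rewrite big_split /= mulrDr !mulr_sumr.
  rewrite (sum_widen (fun j => u i j * X j w) nN) (sum_widen (fun j => v i j * Y j w) mN).
  congr (_ + _); apply: eq_bigr => j _; case: ifP => jn.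
  - exact: cE.
  - by rewrite c0// mulr0.
  - exact: eE.
  - by rewrite e0// mulr0.
have -> : \sum_(j < n) tl P (fun w => u i j * X j w) x =
    \sum_(j < N) tl P (fun w => c i j * X j w) (x / M i).
  rewrite (sum_widen (fun j => tl P (fun w => u i j * X j w) x) nN).
  apply: eq_bigr => j _; case: ifP => jn.
    by apply: tl_scale => // w; exact: cE.
  by apply/esym/tl0 => // w; exact: c0.
have -> : \sum_(j < m) tl P (fun w => v i j * Y j w) x =
    \sum_(j < N) tl P (fun w => e i j * Y j w) (x / M i).
  rewrite (sum_widen (fun j => tl P (fun w => v i j * Y j w) x) mN).
  apply: eq_bigr => j _; case: ifP => jn.
    by apply: tl_scale => // w; exact: eE.
  by apply/esym/tl0 => // w; exact: e0.
have -> : \sum_(j < n) \sum_(l < n | l != j) cross P (fun=> u i j) (fun w => u i l * X l w) 1 x =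
    M i * \sum_(j < N) \sum_(l < N | l != j)
      c i j * ic P (fun w => c i l * X l w) (M i)^-1 (x / M i).
  rewrite (sum_widen_offdiag (fun j l => cross P (fun=> u i j) (fun w => u i l * X l w) 1 x) nN).
  rewrite mulr_sumr; apply: eq_bigr => j _; rewrite mulr_sumr; apply: eq_bigr => l _.
  case: (boolP (l < n)%N) => ln; last first.
    rewrite andbF ic0 ?mulr0// => w; exact/c0/negbTE.
  rewrite andbT; case: ifP => jn; last by rewrite /c jn mul0r mulr0.
  rewrite cross_cst//; last exact: measurable_funM.
  rewrite (ic_scale P x (M0 i) (fun w => cE i w ln)) mulrA; congr (_ * _).
  by rewrite /c jn mulrC divfK// gt_eqF.
have -> : \sum_(j < m) \sum_(l < m | l != j) cross P (fun=> v i j) (fun w => v i l * Y l w) 1 x =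
    M i * \sum_(j < N) \sum_(l < N | l != j)
      e i j * ic P (fun w => e i l * Y l w) (M i)^-1 (x / M i).
  rewrite (sum_widen_offdiag (fun j l => cross P (fun=> v i j) (fun w => v i l * Y l w) 1 x) mN).
  rewrite mulr_sumr; apply: eq_bigr => j _; rewrite mulr_sumr; apply: eq_bigr => l _.
  case: (boolP (l < m)%N) => ln; last first.
    rewrite andbF ic0 ?mulr0// => w; exact/e0/negbTE.
  rewrite andbT; case: ifP => jn; last by rewrite /e jn mul0r mulr0.
  rewrite cross_cst//; last exact: measurable_funM.
  rewrite (ic_scale P x (M0 i) (fun w => eE i w ln)) mulrA; congr (_ * _).
  by rewrite /e jn mulrC divfK// gt_eqF.
have -> : \sum_(j < n) \sum_(l < m)
      (cross P (fun w => u i j * X j w) (fun w => v i l * Y l w) 1 x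
       + cross P (fun w => v i l * Y l w) (fun w => u i j * X j w) 1 x) =
    M i * \sum_(j < N) \sum_(l < N)
      (cross P (fun w => c i j * X j w) (fun w => e i l * Y l w) (M i)^-1 (x / M i)
       + cross P (fun w => e i l * Y l w) (fun w => c i j * X j w) (M i)^-1 (x / M i)).
  rewrite (sum2_widen (fun j l => cross P (fun w => u i j * X j w) (fun w => v i l * Y l w) 1 x
       + cross P (fun w => v i l * Y l w) (fun w => u i j * X j w) 1 x) nN mN).
  rewrite mulr_sumr; apply: eq_bigr => j _; rewrite mulr_sumr; apply: eq_bigr => l _.
  case: (boolP (j < n)%N) => jn /=; last first.
    have h w : c i j * X j w = 0 by exact/c0/negbTE.
    by rewrite cross0l// cross0r// addr0 mulr0.
  case: (boolP (l < m)%N) => lm; last first.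
    have h w : e i l * Y l w = 0 by exact/e0/negbTE.
    by rewrite cross0r// cross0l// addr0 mulr0.
  rewrite mulrDr.
  rewrite (cross_scale x (M0 i) (lcX i j) (meY i l) (fun w => cE i w jn) (fun w => eE i w lm)).
  by rewrite (cross_scale x (M0 i) (leY i l) (mcX i j) (fun w => eE i w lm) (fun w => cE i w jn)).
rewrite /second_order; ring.
Qed.

End normalized.

Let same_tl (H : distr R) (Z : T -> R) y : measurable_fun setT Z ->
  (forall x, Pr P [set w | Z w <= x] = df H x) -> tl P Z y = tl H id y.
Proof.
move=> mZ ZH.
have mh : measurable_fun (setT : set R) (fun z : R => (y < z)%R%:R : R) by meas.
have lh : L1 H (fun z : R => (y < z)%R%:R : R).
  by apply: L1_natb; apply: measurable_fun_ltr => //; exact: measurable_id.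
exact: (same_law mZ ZH mh lh).2.
Qed.

Let b0 : 0 < b. Proof. exact: lt_le_trans ab. Qed.

(** By linearity a window of length 1 / M has at least the share 1 / M - 1 / (2 b) of the unit
    increment, and this is at least 1 / (2 b). *)
Let window_ge (f g : R -> R) z M : a <= M <= b -> 0 <= f z ->
  (forall s, 0 <= s <= a^-1 -> `|g s - s * f z| <= (2 * b)^-1 * f z) ->
  f z <= 2 * b * g M^-1.
Proof.
move=> /andP[h1 h2] f0 /(_ M^-1); have M0 : 0 < M by exact: lt_le_trans h1.
rewrite invr_ge0 (ltW M0) lef_pV2 ?posrE// h1 => /(_ isT).
rewrite ler_norml => /andP[h3 _].
have h4 : b^-1 * f z <= M^-1 * f z by rewrite ler_wpM2r// lef_pV2.
rewrite mulrC -ler_pdivrMr ?mulr_gt0//.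
have -> : f z / (2 * b) = b^-1 * f z - (2 * b)^-1 * f z by field; rewrite gt_eqF.
lra.
Qed.

Let Ex_inc i x : Ex P (fun w => increments n m x (X^~ w) (Y^~ w) (u i) (v i)) =
  \sum_(k < n) ic P (fun w => u i k * X k w) 1 x
  + \sum_(k < m) ic P (fun w => v i k * Y k w) 1 x.
Proof.
have ub k : T -> `|u i k| <= b.
  by move=> _; case/andP: (uab i k) => h1 h2; rewrite ger0_norm// (le_trans _ h1)// ltW.
have vb k : T -> `|v i k| <= b.
  by move=> _; case/andP: (vab i k) => h1 h2; rewrite ger0_norm// (le_trans _ h1)// ltW.
exact: (@Ex_increments _ n m _ _ P X Y (fun k _ => u i k) (fun k _ => v i k) b
  lX lY _ _ ub vb).
Qed.

Let ic_term_le N (f : nat -> R) k : (k < N)%N -> (forall j, 0 <= f j) ->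
  f k <= \sum_(j < N) f j.
Proof.
by move=> kN f0; rewrite (bigD1 (Ordinal kN))//= lerDl sumr_ge0.
Qed.

(** The variable carrying the largest weight has, at [z * M], the increment of its marginal at [z]
    over a window of length 1 / M, which [window_ge] bounds below. If that variable is one of the
    [Y k], the comparison of the increments of [F] with those of [G] is used. The condition is on
    [z], so that it is uniform over the weights. *)
Lemma near_increments_ge : exists2 C, 0 < C & \forall z \near +oo, forall i M,
  a <= M <= b ->
  (exists2 k, (k < n)%N & u i k = M) \/ (exists2 k, (k < m)%N & v i k = M) ->
  p z <= C * Ex P (fun w => increments n m (z * M) (X^~ w) (Y^~ w) (u i) (v i)).
Proof.
have e0 : 0 < (2 * b)^-1 by rewrite invr_gt0 mulr_gt0.
have [C C0 hC] : exists2 C, 0 < C & \forall y \near +oo, ic F id 1 y <= C * ic G id 1 y.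
  have [_ _ /almost_decreasing_near[pos _]] := G_S2.
  have [/eqO_exP[C C0 hC] _] := FG_order.
  exists C => //; near=> y.
  have p0 : 0 < ic G id 1 y by near: y.
  have : `|incr F 1 y| <= C * `|incr G 1 y| by near: y.
  by rewrite !incr_ic (gtr0_norm p0); apply: le_trans; exact: ler_norm.
exists (2 * b * (1 + C)); first by rewrite !mulr_gt0// addr_gt0.
near=> z => i M Mab hM.
have z0 : 0 <= z by near: z; apply: nbhs_pinfty_ge; exact: num_real.
have [M0 _] : 0 < M /\ True by split => //; case/andP: Mab => h _; exact: lt_le_trans h.
have hF : forall s, 0 <= s <= a^-1 ->
    `|ic F id s z - s * ic F id 1 z| <= (2 * b)^-1 * ic F id 1 z.
  by near: z; exact: S2_tilde_lin.
have hG : forall s, 0 <= s <= a^-1 ->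
    `|ic G id s z - s * ic G id 1 z| <= (2 * b)^-1 * ic G id 1 z.
  by near: z; exact: S2_tilde_lin.
have FG : ic F id 1 z <= C * ic G id 1 z by near: z.
have mid : measurable_fun (setT : set (measurableTypeR R)) (id : measurableTypeR R -> R).
  exact: measurable_id.
rewrite ic_pos_part// Ex_inc.
have zM : z * M / M = z by rewrite mulfK// gt_eqF.
have u0 k : 0 <= ic P (fun w => u i k * X k w) 1 (z * M).
  by apply: ic_ge0 => //; exact: measurable_funM.
have v0 k : 0 <= ic P (fun w => v i k * Y k w) 1 (z * M).
  by apply: ic_ge0 => //; exact: measurable_funM.
have su0 : 0 <= \sum_(k < n) ic P (fun w => u i k * X k w) 1 (z * M) by exact: sumr_ge0.
have sv0 : 0 <= \sum_(k < m) ic P (fun w => v i k * Y k w) 1 (z * M) by exact: sumr_ge0.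
have hu := fun k (kn : (k < n)%N) => ic_term_le kn u0.
have hv := fun k (km : (k < m)%N) => ic_term_le km v0.
set su := \sum_(k < n) _ in su0 hu *; set sv := \sum_(k < m) _ in sv0 hv *.
have bsu : 0 <= 2 * b * su by rewrite !mulr_ge0// ltW.
have bsv : 0 <= 2 * b * sv by rewrite !mulr_ge0// ltW.
have Cbsu : 0 <= C * (2 * b * su) by rewrite mulr_ge0// ltW.
have Cbsv : 0 <= C * (2 * b * sv) by rewrite mulr_ge0// ltW.
rewrite (_ : 2 * b * (1 + C) * (su + sv) = 2 * b * su + 2 * b * sv
  + C * (2 * b * su) + C * (2 * b * sv)); last by ring.
case: hM => -[k kn kM].
  have h : ic F id M^-1 z <= su.
    have := hu k kn; rewrite (@ic_scale _ _ _ P M _ _ (X k) M0); last by move=> w; rewrite kM.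
    by rewrite zM /ic !(same_tl _ (mX k) (X_law k)).
  have := window_ge (f := ic F id 1) (g := fun s => ic F id s z) Mab (ic_ge0 F mid z ler01) hF.
  have : 2 * b * ic F id M^-1 z <= 2 * b * su by rewrite ler_pM2l// mulr_gt0.
  lra.
have h : ic G id M^-1 z <= sv.
  have := hv k kn; rewrite (@ic_scale _ _ _ P M _ _ (Y k) M0); last by move=> w; rewrite kM.
  by rewrite zM /ic !(same_tl _ (mY k) (Y_law k)).
have h1 := window_ge (f := ic G id 1) (g := fun s => ic G id s z) Mab (ic_ge0 G mid z ler01) hG.
have h2 : 2 * b * ic G id M^-1 z <= 2 * b * sv by rewrite ler_pM2l// mulr_gt0.
have : C * ic G id 1 z <= C * (2 * b * sv) by rewrite ler_pM2l//; exact: le_trans h2.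
lra.
Unshelve. all: by end_near. Qed.

Lemma uniform_expansion eps : 0 < eps -> \forall x \near +oo, forall i,
  `|Ex P (fun w => remainder n m (mean F) (mean G) x (X^~ w) (Y^~ w) (u i) (v i))|
  <= eps * Ex P (fun w => increments n m x (X^~ w) (Y^~ w) (u i) (v i)).
Proof.
move=> eps0; have [M hM] := weights.
have Mab i : a <= M i <= b by have [] := hM i.
have uM i k : (k < n)%N -> u i k <= M i by have [_ h _ _] := hM i; exact: h.
have vM i k : (k < m)%N -> v i k <= M i by have [_ _ h _] := hM i; exact: h.
have [C C0 hC] := near_increments_ge.
pose c i k := if (k < n)%N then u i k / M i else 0.
pose e i k := if (k < m)%N then v i k / M i else 0.
have al0 : 0 < a / b by exact: divr_gt0.
have c1 i k : c i k = 0 \/ a / b <= c i k <= 1.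
  by apply: normalized_range => //; [case/andP: (uab i k)|exact: uM].
have e1 i k : e i k = 0 \/ a / b <= e i k <= 1.
  by apply: normalized_range => //; [case/andP: (vab i k)|exact: vM].
(* One half of [eps] goes to [tail_expansion], the other to [second_order_lin]; the latter error is
   multiplied by [M i], hence the further division by [b]. *)
have e'0 : 0 < eps / (2 * C) by rewrite divr_gt0// mulr_gt0.
have e''0 : 0 < eps / (2 * C) / b by rewrite divr_gt0.
have sr i : 0 <= (M i)^-1 <= a^-1.
  have /andP[h1 h2] := Mab i; have Mi : 0 < M i by exact: lt_le_trans h1.
  by rewrite invr_ge0 (ltW Mi) lef_pV2 ?posrE.
have ai0 : 0 <= a^-1 by rewrite invr_ge0 ltW.
have H1 := tail_expansion r1 F_S2 G_S2 F_tail FG_order mX mY X_law Y_law XY XY_indep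
  al0 c1 e1 (maxn n m) e'0.
have H2 := second_order_lin r1 F_S2 G_S2 F_tail FG_order mX mY X_law Y_law XY XY_indep
  al0 c1 e1 (maxn n m) ai0 sr e''0.
move: H1 H2 hC => /nearyP[L1 H1] /nearyP[L2 H2] /nearyP[L3 hC].
pose L := Num.max L1 (Num.max L2 L3).
(* As [M i <= b], this threshold ensures [x / M i >= L] for all weights at once; the maximum with 0
   keeps the factor nonnegative. *)
apply/nearyP; exists (Num.max L 0 * b) => x Lx i.
have /andP[M1 M2] := Mab i; have Mi : 0 < M i by exact: lt_le_trans M1.
have L0 : 0 <= Num.max L 0 by rewrite le_max lexx orbT.
have x0 : 0 <= x by apply: le_trans Lx; apply: mulr_ge0 => //; exact: ltW.
have Lz : L <= x / M i.
  have h : Num.max L 0 <= x / M i.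
    by rewrite ler_pdivlMr//; apply: le_trans Lx; rewrite ler_wpM2l.
  by apply: le_trans h; rewrite le_max lexx.
move: (Lz); rewrite !ge_max => /and3P[Lz1 Lz2 Lz3].
have h1 := H1 _ Lz1; have h2 := H2 _ Lz2; have h3 := hC _ Lz3.
rewrite (Ex_remainder_normalized Mab)// -/(c i) -/(e i).
have {h3} := h3 i (M i) (Mab i) _; rewrite divfK ?gt_eqF//.
case: (hM i) => _ _ _ hor /(_ hor).
move: (h1 i) (h2 i).
set A := tl P _ _ - _; set S1 := second_order _ _ _ _ _ _ _ _ _ 1 _.
set SM := second_order _ _ _ _ _ _ _ _ _ _^-1 _; set inc := Ex P _ => hA hS hp.
have -> : A - M i * SM = (A - S1) - M i * (SM - (M i)^-1 * S1).
  by field; rewrite gt_eqF.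
apply: le_trans (ler_normB _ _) _; rewrite normrM (gtr0_norm Mi).
have h4 : M i * `|SM - (M i)^-1 * S1| <= b * (eps / (2 * C) / b * p (x / M i)).
  by apply: ler_pM => //; exact: ltW.
have E4 : b * (eps / (2 * C) / b * p (x / M i)) = eps / (2 * C) * p (x / M i).
  by field; rewrite !gt_eqF.
rewrite E4 in h4.
have h5 : eps / (2 * C) * p (x / M i) <= eps / (2 * C) * (C * inc) by rewrite ler_pM2l.
have E5 : eps / (2 * C) * (C * inc) = eps / 2 * inc by field; rewrite gt_eqF.
rewrite E5 in h5.
have := lerD hA h4; lra.
Qed.

End uniform_expansion.

(** * Conditioning on the weights *)

Section conditioning.
Context d (T : measurableType d) (R : realType) (P : probability T R).

(** Conditioning on [W] in the form of an iterated expectation: [w'] is a second sample point, which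
    freezes the value of [W], so no conditional expectation is formed. *)
Lemma indep_Ex_sections d1 d2 (T1 : measurableType d1) (T2 : measurableType d2)
    (Z : T -> T1) (W : T -> T2) (h : T1 * T2 -> R) :
  measurable_fun setT Z -> measurable_fun setT W -> indep P Z W ->
  measurable_fun setT h -> L1 P (fun w => h (Z w, W w)) ->
  (forall t, L1 P (fun w => h (Z w, t))) ->
  L1 P (fun w' => Ex P (fun w => h (Z w, W w'))) /\
  Ex P (fun w => h (Z w, W w)) = Ex P (fun w' => Ex P (fun w => h (Z w, W w'))).
Proof.
move=> mZ mW ZW mh lh hs; have [l ->] := indep_Ex mZ mW ZW mh lh.
exact: (@Ex_prod21 _ _ _ _ _ P P (fun w => h (Z w.1, W w.2)) l (fun w' => hs (W w'))).
Qed.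

Lemma Pr1_ae (A : set T) : measurable A -> Pr P A = 1 -> {ae P, forall w, A w}.
Proof.
move=> mA PA; exists (~` A); split => //; first exact: measurableC.
by rewrite probability_setC// Pr_fin// PA subee.
Qed.

Variables (c e Z W : T -> R).
Hypotheses (mc : measurable_fun setT c) (me : measurable_fun setT e).
Hypotheses (mZ : measurable_fun setT Z) (mW : measurable_fun setT W).

Let natb_meas (U : T -> R) x : measurable_fun setT U ->
  measurable_fun setT (fun w => (x < U w <= x + 1)%R%:R : R).
Proof. by move=> mU; meas. Qed.

Lemma ae_eq_tl x : {ae P, forall w, Z w = W w} -> tl P Z x = tl P W x.
Proof.
move=> ZW; apply: ae_eq_Ex; [by meas|by meas|].
by apply: filterS ZW => w ->.
Qed.

Lemma ae_eq_ic s x : {ae P, forall w, Z w = W w} -> ic P Z s x = ic P W s x.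
Proof. by move=> ZW; rewrite /ic !ae_eq_tl. Qed.

Lemma ae_eq_cross x : {ae P, forall w, c w = e w} -> {ae P, forall w, Z w = W w} ->
  cross P c Z 1 x = cross P e W 1 x.
Proof.
move=> ce ZW; apply: ae_eq_Ex.
- by apply: measurable_funM => //; exact: natb_meas.
- by apply: measurable_funM => //; exact: natb_meas.
- by apply: filterS2 ce ZW => w -> ->.
Qed.

Lemma Pr_tl x : Pr P [set w | Z w > x] = tl P Z x.
Proof. by rewrite /tl Ex_indic//; meas. Qed.

Lemma Pr_ic x : Pr P [set w | Z w \in `]x, x + 1]] = ic P Z 1 x.
Proof.
rewrite ic_itv// Ex_indic; last by meas.
by congr Pr; apply/seteqP; split=> w; rewrite /= in_itv.
Qed.

Lemma expectation_cross x :
  fine 'E_P[(fun w => c w * \1_[set w | Z w \in `]x, x + 1]] w)] = cross P c Z 1 x.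
Proof.
rewrite unlock; apply: eq_Ex => w; rewrite indicE; congr (_ * _%:R).
by rewrite (mem_setE (fun w => Z w \in `]x, x + 1])) unfold_in /= in_itv.
Qed.

End conditioning.

Section random_weights.
Context (R : realType) (F G : distr R) (r : R).
Hypothesis r1 : -1 <= r <= 1.
Hypotheses (F_S2 : S_2_tilde F) (G_S2 : S_2_tilde G).
Hypothesis F_tail : forall x, 0 < x -> 0 < tail F x.
Hypothesis FG_order : same_order (incr F 1) (incr G 1).
Context d (T : measurableType d) (P : probability T R).
Context d1 d2 (T1 : measurableType d1) (T2 : measurableType d2).
Variables (Z : T -> T1) (W : T -> T2).
Hypotheses (mZ : measurable_fun setT Z) (mW : measurable_fun setT W) (ZW : indep P Z W).
Variables (f g : nat -> T1 -> R) (u v : nat -> T2 -> R).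
Hypotheses (mf : forall k, measurable_fun setT (f k)).
Hypotheses (mg : forall k, measurable_fun setT (g k)).
Hypotheses (mu : forall k, measurable_fun setT (u k)).
Hypotheses (mv : forall k, measurable_fun setT (v k)).
Hypothesis X_law : forall k x, Pr P [set w | f k (Z w) <= x] = df F x.
Hypothesis Y_law : forall k x, Pr P [set w | g k (Z w) <= x] = df G x.
Hypothesis XY : forall k x y,
  Pr P [set w | f k (Z w) <= x /\ g k (Z w) <= y] = FGM_df F G r x y.
Hypothesis XY_indep : mutually_independent P (fun k w => (f k (Z w), g k (Z w))).
Context (a b : R) (n m : nat).
Hypotheses (a0 : 0 < a) (ab : a <= b) (n0 : (0 < n)%N) (m0 : (0 < m)%N).
Hypothesis uab : forall k t, a <= u k t <= b.
Hypothesis vab : forall k t, a <= v k t <= b.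

Let X k w := f k (Z w).
Let Y k w := g k (Z w).
Let mX k : measurable_fun setT (X k). Proof. exact: measurableT_comp. Qed.
Let mY k : measurable_fun setT (Y k). Proof. exact: measurableT_comp. Qed.
Let lX k : L1 P (X k) := L1_X F_S2 mX X_law k.
Let lY k : L1 P (Y k) := L1_Y G_S2 mY Y_law k.

Let muW k : measurable_fun setT (fun w => u k (W w)). Proof. exact: measurableT_comp. Qed.
Let mvW k : measurable_fun setT (fun w => v k (W w)). Proof. exact: measurableT_comp. Qed.

Let ub k t : `|u k t| <= b.
Proof. by case/andP: (uab k t) => h1 h2; rewrite ger0_norm// (le_trans _ h1)// ltW. Qed.
Let vb k t : `|v k t| <= b.
Proof. by case/andP: (vab k t) => h1 h2; rewrite ger0_norm// (le_trans _ h1)// ltW. Qed.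

Notation rem := (remainder n m (mean F) (mean G)).
Notation inc := (increments n m).

(** The family of weights is indexed by the sample points themselves. Uniformity gives one threshold
    on [x] valid for every frozen value of the weights, and the resulting inequality is
    integrated. *)
Lemma random_weights_expansion eps : 0 < eps -> \forall x \near +oo,
  `|Ex P (fun w => rem x (X^~ w) (Y^~ w) (fun k => u k (W w)) (fun k => v k (W w)))|
  <= eps * Ex P (fun w => inc x (X^~ w) (Y^~ w) (fun k => u k (W w)) (fun k => v k (W w))).
Proof.
move=> eps0.
have := uniform_expansion r1 F_S2 G_S2 F_tail FG_order mX mY X_law Y_law XY XY_indep a0 ab n0 m0
  (u := fun w k => u k (W w)) (v := fun w k => v k (W w)) (fun w k => uab k (W w))
  (fun w k => vab k (W w)) eps0.
apply: filterS => x H.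
have mfz k : measurable_fun setT (fun z : T1 * T2 => f k z.1) by exact: measurable_comp_fst.
have mgz k : measurable_fun setT (fun z : T1 * T2 => g k z.1) by exact: measurable_comp_fst.
have muz k : measurable_fun setT (fun z : T1 * T2 => u k z.2) by exact: measurable_comp_snd.
have mvz k : measurable_fun setT (fun z : T1 * T2 => v k z.2) by exact: measurable_comp_snd.
have [lR ->] := indep_Ex_sections mZ mW ZW
  (measurable_remainder n m (mean F) (mean G) x mfz mgz muz mvz)
  (L1_remainder n m (mean F) (mean G) lX lY muW mvW (fun k w => ub k (W w))
    (fun k w => vb k (W w)) x)
  (fun t => L1_remainder n m (mean F) (mean G) lX lY (fun k => measurable_cst (u k t))
    (fun k => measurable_cst (v k t)) (fun k _ => ub k t) (fun k _ => vb k t) x).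
have [lI ->] := indep_Ex_sections mZ mW ZW
  (measurable_increments n m x mfz mgz muz mvz)
  (L1_increments n m lX lY muW mvW (fun k w => ub k (W w)) (fun k w => vb k (W w)) x)
  (fun t => L1_increments n m lX lY (fun k => measurable_cst (u k t))
    (fun k => measurable_cst (v k t)) (fun k _ => ub k t) (fun k _ => vb k t) x).
apply: le_trans (normr_Ex lR) _; rewrite -ExZl//.
by apply: le_Ex => //; [exact: L1_norm|exact: L1Zl].
Qed.

End random_weights.

Section generated_sigma_algebra.
Context d (T : measurableType d) d' (U : measurableType d') (Z : nat -> T -> U).

(** The sample space with the smaller sigma-algebra generated by the sequence. Independence of two
    sequences thereby becomes independence of two identity maps, with no product space of
    sequences. *)
Definition gen_type := g_sigma_algebraType
  (\bigcup_i preimage_set_system setT (Z i) measurable).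

Lemma measurable_id_gen : (forall i, measurable_fun setT (Z i)) ->
  measurable_fun (setT : set T) (id : T -> gen_type).
Proof.
move=> mZ _ A; rewrite setTI preimage_id; apply: smallest_sub.
  exact: sigma_algebra_measurable.
by move=> _ [i _ [B mB <-]]; exact: mZ.
Qed.

Lemma measurable_gen i : measurable_fun (setT : set gen_type) (Z i : gen_type -> U).
Proof. by move=> _ B mB; apply: sub_sigma_algebra; exists i => //; exists B. Qed.

End generated_sigma_algebra.

Lemma clamp_range (R : realType) (lo hi y : R) : lo <= hi ->
  lo <= Num.max lo (Num.min hi y) <= hi.
Proof. by move=> h; rewrite le_max lexx ge_max h ge_min lexx. Qed.

Lemma clamp_id (R : realType) (lo hi y : R) : lo <= y <= hi ->
  Num.max lo (Num.min hi y) = y.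
Proof. by case/andP=> h1 h2; rewrite min_r// max_r. Qed.

Theorem theorem2p2 (R : realType) (d : measure_display) (T : measurableType d)
    (P : probability T R) (F G : distr R) (r : R)
    (X Y xi eta : nat -> {RV P >-> R}) (a1 b1 a2 b2 : R)
    (F_tail : forall x, 0 < x -> 0 < tail F x)
    (G_tail : forall x, 0 < x -> 0 < tail G x)
    (r_range : -1 <= r <= 1)
    (X_law : forall i x, Pr P [set w | X i w <= x] = df F x)
    (Y_law : forall i y, Pr P [set w | Y i w <= y] = df G y)
    (XY_law : forall i x y,
      Pr P [set w | X i w <= x /\ Y i w <= y] = FGM_df F G r x y)
    (XY_indep : mutually_independent P (fun i w => (X i w, Y i w)))
    (xi_eta_ge0 : forall i, {ae P, forall w, 0 <= xi i w /\ 0 <= eta i w})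
    (xi_eta_indep : independent_sequences P
      (fun i w => (X i w, Y i w)) (fun i w => (xi i w, eta i w)))
    (ab1 : 0 < a1 <= b1) (ab2 : 0 < a2 <= b2)
    (xi_eta_bounded : forall i j,
      Pr P [set w | xi i w \in `[a1, b1] /\ eta j w \in `[a2, b2]] = 1)
    (F_S2 : S_2_tilde F) (G_S2 : S_2_tilde G)
    (FG_order : same_order (incr F 1) (incr G 1))
    (n m : nat) (n_gt0 : (0 < n)%N) (m_gt0 : (0 < m)%N) :
  let xiX i w := xi i w * X i w in
  let etaY j w := eta j w * Y j w in
  let S w := \sum_(i < n) xiX i w in
  let T' w := \sum_(j < m) etaY j w in
  let E (Z : T -> R) : R := fine 'E_P[Z] in
  let I (Z : T -> R) (x : R) : T -> R := \1_[set w | Z w \in `]x, x + 1]] in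
  (fun x : R =>
    Pr P [set w | S w + T' w > x] -
    ( \sum_(i < n) Pr P [set w | xiX i w > x]
    + \sum_(j < m) Pr P [set w | etaY j w > x]
    + mean F * \sum_(i < n) \sum_(l < n | l != i)
        E (fun w => xi i w * I (xiX l) x w)
    + mean G * \sum_(j < m) \sum_(l < m | l != j)
        E (fun w => eta j w * I (etaY l) x w)
    + \sum_(i < n) \sum_(j < m)
        ( E (fun w => xiX i w * I (etaY j) x w)
        + E (fun w => etaY j w * I (xiX i) x w))))
  =o_ (pinfty_nbhs R)
  (fun x : R =>
      \sum_(i < n) Pr P [set w | xiX i w \in `]x, x + 1]]
    + \sum_(j < m) Pr P [set w | etaY j w \in `]x, x + 1]]).
Proof.
move=> xiX etaY S T' E I.
have mX k : measurable_fun setT (X k) by [].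
have mY k : measurable_fun setT (Y k) by [].
have mxi k : measurable_fun setT (xi k) by [].
have meta k : measurable_fun setT (eta k) by [].
pose T1 := gen_type (fun i w => (X i w, Y i w)).
pose T2 := gen_type (fun i w => (xi i w, eta i w)).
have m1 : measurable_fun setT (id : T -> T1).
  by apply: measurable_id_gen => i; exact: measurable_pair.
have m2 : measurable_fun setT (id : T -> T2).
  by apply: measurable_id_gen => i; exact: measurable_pair.
have I12 : indep P (id : T -> T1) (id : T -> T2).
  by move=> A B mA mB; exact: xi_eta_indep.
pose f k : T1 -> R := X k.
pose g k : T1 -> R := Y k.
(* Clamped weights satisfy everywhere the bounds that hold almost surely. *)
pose u k : T2 -> R := fun w => Num.max a1 (Num.min b1 (xi k w)).
pose v k : T2 -> R := fun w => Num.max a2 (Num.min b2 (eta k w)).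
have mf k : measurable_fun setT (f k).
  exact: (measurableT_comp measurable_fst (measurable_gen (Z := fun i w => (X i w, Y i w)) k)).
have mg k : measurable_fun setT (g k).
  exact: (measurableT_comp measurable_snd (measurable_gen (Z := fun i w => (X i w, Y i w)) k)).
have mu k : measurable_fun setT (u k).
  apply: measurable_maxr => //; apply: measurable_minr => //.
  exact: (measurableT_comp measurable_fst (measurable_gen (Z := fun i w => (xi i w, eta i w)) k)).
have mv k : measurable_fun setT (v k).
  apply: measurable_maxr => //; apply: measurable_minr => //.
  exact: (measurableT_comp measurable_snd (measurable_gen (Z := fun i w => (xi i w, eta i w)) k)).
have /andP[a10 ab1'] := ab1; have /andP[a20 ab2'] := ab2.
(* Both families are normalized by one common maximum, so they need common bounds. *)
have uab k t : Num.min a1 a2 <= u k t <= Num.max b1 b2.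
  have /andP[h1 h2] := clamp_range (xi k t) ab1'.
  by apply/andP; split; [rewrite ge_min h1|rewrite le_max h2].
have vab k t : Num.min a1 a2 <= v k t <= Num.max b1 b2.
  have /andP[h1 h2] := clamp_range (eta k t) ab2'.
  by apply/andP; split; [rewrite ge_min h1 orbT|rewrite le_max h2 orbT].
have ae_uv : {ae P, forall w, forall k, xi k w = u k w /\ eta k w = v k w}.
  apply: ae_foralln => k.
  have mA : measurable [set w | xi k w \in `[a1, b1] /\ eta k w \in `[a2, b2]].
    apply: measurableI; rewrite -[X in measurable X]setTI.
      exact: (mxi k measurableT _ (measurable_itv `[a1, b1])).
    exact: (meta k measurableT _ (measurable_itv `[a2, b2])).
  apply: filterS (Pr1_ae mA (xi_eta_bounded k k)) => w /=.
  by rewrite !in_itv /= => -[h1 h2]; rewrite /u /v !clamp_id.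
have ae_u k : {ae P, forall w, xi k w = u k w}.
  by apply: filterS ae_uv => w /(_ k)[].
have ae_v k : {ae P, forall w, eta k w = v k w}.
  by apply: filterS ae_uv => w /(_ k)[].
have ae_uX k : {ae P, forall w, xi k w * X k w = u k w * X k w}.
  by apply: filterS (ae_u k) => w ->.
have ae_vY k : {ae P, forall w, eta k w * Y k w = v k w * Y k w}.
  by apply: filterS (ae_v k) => w ->.
have muP k : measurable_fun (setT : set T) (u k) by exact: (measurableT_comp (mu k) m2).
have mvP k : measurable_fun (setT : set T) (v k) by exact: (measurableT_comp (mv k) m2).
have mxX k : measurable_fun setT (fun w => xi k w * X k w) by exact: measurable_funM.
have meY k : measurable_fun setT (fun w => eta k w * Y k w) by exact: measurable_funM.
have muX k : measurable_fun (setT : set T) (fun w => u k w * X k w) by exact: measurable_funM.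
have mvY k : measurable_fun (setT : set T) (fun w => v k w * Y k w) by exact: measurable_funM.
have aa : 0 < Num.min a1 a2 by rewrite lt_min a10.
have aabb : Num.min a1 a2 <= Num.max b1 b2 by rewrite ge_min le_max ab1'.
have lX k : L1 P (X k) := L1_X F_S2 mX X_law k.
have lY k : L1 P (Y k) := L1_Y G_S2 mY Y_law k.
have ub k w : `|u k w| <= Num.max b1 b2.
  by case/andP: (uab k w) => h1 h2; rewrite ger0_norm// (le_trans _ h1)// ltW.
have vb k w : `|v k w| <= Num.max b1 b2.
  by case/andP: (vab k w) => h1 h2; rewrite ger0_norm// (le_trans _ h1)// ltW.
apply/eqoP => eps eps0.
have := random_weights_expansion r_range F_S2 G_S2 F_tail FG_order m1 m2 I12 mf mg mu mv
  X_law Y_law XY_law XY_indep aa aabb n_gt0 m_gt0 uab vab eps0.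
apply: filterS => x.
rewrite (Ex_remainder n m (mean F) (mean G) lX lY muP mvP ub vb).
rewrite (Ex_increments n m lX lY muP mvP ub vb) => H.
have tX k : Pr P [set w | xiX k w > x] = tl P (fun w => u k w * X k w) x.
  by rewrite (Pr_tl P (mxX k) x); exact: (ae_eq_tl (mxX k) (muX k) x (ae_uX k)).
have tY k : Pr P [set w | etaY k w > x] = tl P (fun w => v k w * Y k w) x.
  by rewrite (Pr_tl P (meY k) x); exact: (ae_eq_tl (meY k) (mvY k) x (ae_vY k)).
have iX k : Pr P [set w | xiX k w \in `]x, x + 1]] = ic P (fun w => u k w * X k w) 1 x.
  by rewrite (Pr_ic P (mxX k) x); exact: (ae_eq_ic (mxX k) (muX k) 1 x (ae_uX k)).
have iY k : Pr P [set w | etaY k w \in `]x, x + 1]] = ic P (fun w => v k w * Y k w) 1 x.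
  by rewrite (Pr_ic P (meY k) x); exact: (ae_eq_ic (meY k) (mvY k) 1 x (ae_vY k)).
have cXX k l : E (fun w => xi k w * I (xiX l) x w) =
    cross P (u k) (fun w => u l w * X l w) 1 x.
  rewrite /E /I (@expectation_cross _ _ _ P (xi k) (xiX l) x).
  exact: (ae_eq_cross (mxi k) (muP k) (mxX l) (muX l) x (ae_u k) (ae_uX l)).
have cYY k l : E (fun w => eta k w * I (etaY l) x w) =
    cross P (v k) (fun w => v l w * Y l w) 1 x.
  rewrite /E /I (@expectation_cross _ _ _ P (eta k) (etaY l) x).
  exact: (ae_eq_cross (meta k) (mvP k) (meY l) (mvY l) x (ae_v k) (ae_vY l)).
have cXY k l : E (fun w => xiX k w * I (etaY l) x w) =
    cross P (fun w => u k w * X k w) (fun w => v l w * Y l w) 1 x.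
  rewrite /E /I (@expectation_cross _ _ _ P (xiX k) (etaY l) x).
  exact: (ae_eq_cross (mxX k) (muX k) (meY l) (mvY l) x (ae_uX k) (ae_vY l)).
have cYX k l : E (fun w => etaY k w * I (xiX l) x w) =
    cross P (fun w => v k w * Y k w) (fun w => u l w * X l w) 1 x.
  rewrite /E /I (@expectation_cross _ _ _ P (etaY k) (xiX l) x).
  exact: (ae_eq_cross (meY k) (mvY k) (mxX l) (muX l) x (ae_vY k) (ae_uX l)).
have tS : Pr P [set w | S w + T' w > x] =
    tl P (fun w => \sum_(i < n) u i w * X i w + \sum_(j < m) v j w * Y j w) x.
  have mL : measurable_fun setT (fun w => S w + T' w).
    apply: measurable_funD; apply: measurable_bigsum => k; [exact: mxX|exact: meY].
  have mR : measurable_fun (setT : set T)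
      (fun w => \sum_(i < n) u i w * X i w + \sum_(j < m) v j w * Y j w).
    by apply: measurable_funD; apply: measurable_bigsum => k.
  rewrite (Pr_tl P mL x); apply: (ae_eq_tl mL mR).
  apply: filterS ae_uv => w h; congr (_ + _); apply: eq_bigr => k _.
    by rewrite /xiX (h k).1.
  by rewrite /etaY (h k).2.
have sX : \sum_(i < n) Pr P [set w | xiX i w > x] =
    \sum_(i < n) tl P (fun w => u i w * X i w) x by apply: eq_bigr => k _.
have sY : \sum_(j < m) Pr P [set w | etaY j w > x] =
    \sum_(j < m) tl P (fun w => v j w * Y j w) x by apply: eq_bigr => k _.
have sXX : \sum_(i < n) \sum_(l < n | l != i) E (fun w => xi i w * I (xiX l) x w) =
    \sum_(i < n) \sum_(l < n | l != i) cross P (u i) (fun w => u l w * X l w) 1 x.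
  by apply: eq_bigr => k _; apply: eq_bigr.
have sYY : \sum_(j < m) \sum_(l < m | l != j) E (fun w => eta j w * I (etaY l) x w) =
    \sum_(j < m) \sum_(l < m | l != j) cross P (v j) (fun w => v l w * Y l w) 1 x.
  by apply: eq_bigr => k _; apply: eq_bigr.
have sXY : \sum_(i < n) \sum_(j < m) (E (fun w => xiX i w * I (etaY j) x w)
      + E (fun w => etaY j w * I (xiX i) x w)) =
    \sum_(i < n) \sum_(j < m) (cross P (fun w => u i w * X i w) (fun w => v j w * Y j w) 1 x
      + cross P (fun w => v j w * Y j w) (fun w => u i w * X i w) 1 x).
  by apply: eq_bigr => k _; apply: eq_bigr => l _; rewrite cXY cYX.
have iXs : \sum_(i < n) Pr P [set w | xiX i w \in `]x, x + 1]] =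
    \sum_(i < n) ic P (fun w => u i w * X i w) 1 x by apply: eq_bigr => k _.
have iYs : \sum_(j < m) Pr P [set w | etaY j w \in `]x, x + 1]] =
    \sum_(j < m) ic P (fun w => v j w * Y j w) 1 x by apply: eq_bigr => k _.
rewrite tS sX sY sXX sYY sXY iXs iYs; apply: le_trans H _.
by rewrite ler_pM2l// ler_norm.
Qed.
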